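(* Let $(E_n)_{n\in\mathbb N}$ and $(F_n)_{n\in\mathbb N}$ be sequences of nonzero finite dimensional Banach spaces and let $(p_n)$, $(q_n)$ be sequences of exponents with $1\le p_n<2$, $p_n\to2$, and $2<q_n<\infty$, $q_n\to2$, such that: (1) for every $n$ and $x,y\in E_n$: $\|x+y\|^2+\|x-y\|^2\le2(\|x\|^{p_n}+\|y\|^{p_n})^{2/p_n}$; (2) for every $n$ there is a basis $\mathcal B_n$ of $E_n$ such that for every $y\in\mathcal B_n$ there is $x\in\mathcal B_n$ with $\|x+\lambda y\|^{p_n}=1+|\lambda|^{p_n}$ for all $\lambda\in\mathbb R$; (3) for every $n$ and $x,y\in F_n$: $\|x+y\|^2+\|x-y\|^2\ge2(\|x\|^{q_n}+\|y\|^{q_n})^{2/q_n}$; (4) for every $n$ there is a basis $\mathcal B'_n$ of $F_n$ such that for every $y\in\mathcal B'_n$ there is $x\in\mathcal B'_n$ with $\|x+\lambda y\|^{q_n}=1+|\lambda|^{q_n}$ for all $\lambda\in\mathbb R$; (5) there is a constant $C$ such that for all $n$ and all $x,y\in F_n$: $\|x+y\|^2+\|x-y\|^2\le2(\|x\|^2+\|Cy\|^2)$. Let $E=\big(\bigoplus_nE_n\big)_{\ell_2}$ and $F=\big(\bigoplus_nF_n\big)_{\ell_2}$. Then for every Hilbert space $H$, every linear isometric embedding $T$ of $E\oplus_2F$ into $E\oplus_2F\oplus_2H$ maps $E$ onto $E$ and $F$ onto $F$. In particular, every ultrapower of $E\oplus_2F$ is linearly isometric to $E\oplus_2F\oplus_2H$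 for some Hilbert space $H$, every linear isometric operator $E\oplus_2F\to E\oplus_2F\oplus_2H$ ($H$ any Hilbert space) maps $E\oplus_2F$ onto $E\oplus_2F$, and hence the space $E\oplus_2F$ is uncountably categorical.
   Context: Banach spaces are over $\mathbb K\in\{\mathbb R,\mathbb C\}$. Hilbert spaces may have any dimension (including finite or $0$). $\big(\bigoplus_nE_n\big)_{\ell_2}$ is the space of sequences $x=(x_n)$, $x_n\in E_n$, with $\|x\|^2=\sum_n\|x_n\|_{E_n}^2<\infty$. $X\oplus_2Y$ is the direct sum with norm $\|x+y\|^2=\|x\|^2+\|y\|^2$; the summands are identified with subspaces of it. Ultrapowers are Banach space ultrapowers $X_{\mathcal U}=\ell_\infty(I,X)/\{(x_i):\lim_{i,\mathcal U}\|x_i\|=0\}$, $\mathcal U$ an ultrafilter on a set $I$. Banach spaces $X,Y$ are elementarily equivalent if there are ultrafilters $\mathcal U,\mathcal V$ such that $X_{\mathcal U}$ and $Y_{\mathcal V}$ are linearly isometric (this is an equivalence relation). The elementary class of $X$ is the class of all Banach spaces elementarily equivalent to $X$. An infinite dimensional Banach space is uncountably categorical if for some uncountable cardinal $\kappa$ its elementary class contains, up to linear isometry, exactly one space of density character $\kappa$. *)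

(* Defs.v *)
From HB Require Import structures.
From mathcomp Require Import all_boot all_order all_algebra.
From mathcomp Require Import generic_quotient ring_quotient sesquilinear.
From mathcomp Require Import complex ring lra.
From mathcomp Require Import all_classical all_reals all_analysis.
Set Implicit Arguments.
Unset Strict Implicit.
Unset Printing Implicit Defensive.
Import Order.TTheory GRing.Theory Num.Theory.
Import numFieldNormedType.Exports.
Local Open Scope classical_set_scope.
Local Open Scope ring_scope.

Variant scalar_kind := RealScalars | ComplexScalars.

Definition scalars (R : realType) (k : scalar_kind) : numFieldType :=
  match k with
  | RealScalars => R
  | ComplexScalars => complex R
  end.

Section Scalars.
Variables (R : realType) (k : scalar_kind).
Local Notation K := (scalars R k).

Definition scalar_re : K -> R :=
  match k return scalars R k -> R with
  | RealScalars => id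
  | ComplexScalars => @complex.Re R
  end.

Definition real_scalar : R -> K :=
  match k return R -> scalars R k with
  | RealScalars => id
  | ComplexScalars => fun x => Complex x 0
  end.

Definition scalar_conj : K -> K :=
  match k return scalars R k -> scalars R k with
  | RealScalars => id
  | ComplexScalars => @conjc R
  end.

Lemma real_scalarK : cancel real_scalar scalar_re.
Proof. by rewrite /scalar_re /real_scalar; case: k. Qed.

Lemma scalar_reK (a : K) : 0 <= a -> real_scalar (scalar_re a) = a.
Proof.
rewrite /scalar_re /real_scalar; case: k a => //= -[a b] /=.
by rewrite lecE /= => /andP[/eqP->].
Qed.

Lemma ler_real_scalar x y : (real_scalar x <= real_scalar y) = (x <= y).
Proof. by rewrite /real_scalar; case: k => //=; rewrite lecE /= eqxx. Qed.

Lemma real_scalar0 : real_scalar 0 = 0.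
Proof. by rewrite /real_scalar; case: k. Qed.

Lemma real_scalarD x y : real_scalar (x + y) = real_scalar x + real_scalar y.
Proof.
by rewrite /real_scalar; case: k => //=; apply/eqP;
  rewrite eq_complex /= addr0 !eqxx.
Qed.

Lemma real_scalarM x y : real_scalar (x * y) = real_scalar x * real_scalar y.
Proof.
by rewrite /real_scalar; case: k => //=; apply/eqP;
  rewrite eq_complex /= !mulr0 mul0r subr0 addr0 !eqxx.
Qed.

Lemma ltr_real_scalar x y : (real_scalar x < real_scalar y) = (x < y).
Proof.
by rewrite !lt_neqAle ler_real_scalar (can_eq real_scalarK).
Qed.

Lemma real_scalar_ge0 x : (0 <= real_scalar x) = (0 <= x).
Proof. by rewrite -real_scalar0 ler_real_scalar. Qed.

(* Norms in a normed module over the complex numbers are complex valued. *)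
Definition rnorm (V : normedZmodType K) (x : V) : R := scalar_re `|x|.

Section Rnorm.
Variable V : normedZmodType K.
Implicit Types x y : V.

Lemma normr_rnorm x : `|x| = real_scalar (rnorm x).
Proof. by rewrite /rnorm scalar_reK. Qed.

Lemma rnorm_ge0 x : 0 <= rnorm x.
Proof. by rewrite -real_scalar_ge0 -normr_rnorm. Qed.

Lemma rnormD x y : rnorm (x + y) <= rnorm x + rnorm y.
Proof. by rewrite -ler_real_scalar real_scalarD -!normr_rnorm ler_normD. Qed.

Lemma rnorm0 : rnorm (0 : V) = 0.
Proof. by rewrite /rnorm normr0 -real_scalar0 real_scalarK. Qed.

Lemma rnorm_eq0 x : rnorm x = 0 -> x = 0.
Proof.
by move=> x0; apply/eqP; rewrite -normr_eq0 normr_rnorm x0 real_scalar0.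
Qed.

Lemma rnormN x : rnorm (- x) = rnorm x.
Proof. by rewrite /rnorm normrN. Qed.

Lemma rnormBC x y : rnorm (x - y) = rnorm (y - x).
Proof. by rewrite /rnorm distrC. Qed.

Lemma rnormB x y : rnorm (x - y) <= rnorm x + rnorm y.
Proof. by rewrite -(rnormN y) rnormD. Qed.

Lemma rnormB_trans x y z : rnorm (x - z) <= rnorm (x - y) + rnorm (y - z).
Proof. by rewrite (le_trans _ (rnormD _ _))// addrA subrK. Qed.

Lemma rnorm_lip x y : `|rnorm x - rnorm y| <= rnorm (x - y).
Proof.
rewrite ler_norml lerBlDr lerNl opprB lerBlDr {1}rnormBC.
have := rnormD (y - x) x; rewrite subrK => ->.
by have := rnormD (x - y) y; rewrite subrK => ->.
Qed.

End Rnorm.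

Lemma rnormZ (V : normedModType K) (a : K) (x : V) :
  rnorm (a *: x) = rnorm a * rnorm x.
Proof.
apply: (can_inj real_scalarK).
by rewrite real_scalarM -!normr_rnorm normrZ.
Qed.

Lemma rnorm_real_scalar x : 0 <= x -> rnorm (real_scalar x) = x.
Proof.
by move=> x0; rewrite /rnorm ger0_norm ?real_scalar_ge0// real_scalarK.
Qed.

Section Completeness.
Local Notation h := (2^-1 : R).

Definition fast_cauchy (V : normedModType K) (u : nat -> V) :=
  forall n, rnorm (u n.+1 - u n) <= h ^+ n.

Lemma fast_cauchy_dist (V : normedModType K) (u : nat -> V) : fast_cauchy u ->
  forall m n, rnorm (u (m + n)%N - u n) <= 2 * h ^+ n.
Proof.
move=> uf; elim=> [n|m IH n].
  by rewrite add0n subrr rnorm0 mulr_ge0// exprn_ge0.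
apply: le_trans (rnormB_trans _ (u n.+1) _) _.
rewrite addSnnS; apply: le_trans (lerD (IH _) (uf n)) _.
by rewrite exprS mulrA mulfV// mul1r mulrDl mul1r.
Qed.

Lemma exp_half_small (e : R) : 0 < e -> exists n, forall m, (n <= m)%N ->
  h ^+ m < e.
Proof.
move=> e0.
have : (fun n => h ^+ n) @ \oo --> (0 : R).
  by apply: cvg_expr; rewrite ger0_norm ?invr_ge0// invf_lt1// ltr1n.
move=> /cvgrPdist_lt /(_ _ e0)[n _ nP]; exists n => m nm.
by have := nP m nm; rewrite /= sub0r normrN ger0_norm ?exprn_ge0 ?invr_ge0.
Qed.

Lemma rnorm_cvgP (V : normedModType K) T (F : set_system T) {FF : Filter F}
    (f : T -> V) (l : V) :
  (f @ F --> l) <-> forall e : R, 0 < e -> \forall t \near F, rnorm (l - f t) < e.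
Proof.
split.
  move=> /cvgrPdist_lt fl e e0.
  have := fl (real_scalar e); rewrite -real_scalar0 ltr_real_scalar => /(_ e0).
  by apply: filterS => t; rewrite normr_rnorm ltr_real_scalar.
move=> fl; apply/cvgrPdist_lt => e e0.
have : 0 < scalar_re e.
  by rewrite -ltr_real_scalar scalar_reK ?real_scalar0// ltW.
move=> /fl; apply: filterS => t.
by rewrite normr_rnorm -ltr_real_scalar scalar_reK// ltW.
Qed.

Lemma fast_cauchy_cvg (V : completeNormedModType K) (u : nat -> V) :
  fast_cauchy u -> exists l, forall n, rnorm (l - u n) <= 2 * h ^+ n.
Proof.
move=> uf.
have uc : cauchy (u @ \oo).
  apply: cauchy_exP => e e0.
  have re0 : 0 < scalar_re e.
    by rewrite -ltr_real_scalar scalar_reK ?real_scalar0// ltW.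
  have [n nP] := @exp_half_small (scalar_re e / 2) (divr_gt0 re0 (ltr0Sn R 1)).
  exists (u n); exists n => // m /= nm; rewrite -ball_normE /=.
  rewrite normr_rnorm -(scalar_reK (ltW e0)) ltr_real_scalar rnormBC.
  rewrite -(subnK nm); apply: le_lt_trans (fast_cauchy_dist uf _ _) _.
  by rewrite mulrC -ltr_pdivlMr// nP.
have /cvg_ex[l ul] : cvg (u @ \oo) by apply: cauchy_cvg.
exists l => n; apply/ler_addgt0Pr => e e0.
have [N _ NP] := (rnorm_cvgP _ _).1 ul e e0.
apply: le_trans (rnormB_trans _ (u (N + n)%N) _) _.
rewrite addrC lerD ?fast_cauchy_dist// ltW// NP//=.
by rewrite leq_addr.
Qed.

Lemma fast_cauchy_complete (V : normedModType K) :
  (forall u : nat -> V, fast_cauchy u ->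
    exists l C, forall n, rnorm (l - u n) <= C * h ^+ n) ->
  forall F : set_system V, ProperFilter F -> cauchy F -> cvg F.
Proof.
move=> cV F FF /cauchyP Fc.
have h0 n : 0 < h ^+ n :> R by rewrite exprn_gt0// invr_gt0.
have Fc' n : exists x : V, F [set y | rnorm (x - y) < h ^+ n / 2].
  have e0 : 0 < real_scalar (h ^+ n / 2).
    by rewrite -real_scalar0 ltr_real_scalar divr_gt0.
  have [x Fx] := Fc _ e0; exists x; apply: filterS Fx => y.
  by rewrite -ball_normE/= normr_rnorm ltr_real_scalar.
have [u uP] := choice Fc'.
have uf : fast_cauchy u.
  move=> n; have [y [/= y1 y2]] := filter_ex (filterI (uP n) (uP n.+1)).
  apply: le_trans (rnormB_trans _ y _) _.
  rewrite (rnormBC y) (le_trans (lerD (ltW y2) (ltW y1)))//.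
  rewrite -mulrDl ler_pdivrMr// mulr_natr mulr2n lerD2r exprS ler_piMl ?ltW//.
  by rewrite -[1 + 1]/(2 : R) invf_lt1// ltr1n.
have [l [C lP]] := cV u uf; apply/cvg_ex; exists l.
apply/(rnorm_cvgP id) => e e0.
have D0 : 0 < `|C| + 1 by rewrite ltr_wpDl.
have [n /(_ n (leqnn n)) nP] := @exp_half_small (e / (`|C| + 1)) (divr_gt0 e0 D0).
apply: filterS (uP n) => y /= yn.
apply: le_lt_trans (rnormB_trans _ (u n) _) _.
apply: lt_trans (_ : _ < `|C| * h ^+ n + h ^+ n) _.
  apply: ler_ltD; first by rewrite (le_trans (lP n))// ler_wpM2r ?(ltW (h0 n))// ler_norm.
  by rewrite (lt_trans yn)// ltr_pdivrMr// ltr_pMr// ltr1n.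
by rewrite -[X in _ + X]mul1r -mulrDl mulrC -ltr_pdivlMr.
Qed.

End Completeness.
End Scalars.


Section Sum2.
Variables (R : realType) (k : scalar_kind).
Local Notation K := (scalars R k).

(* Pairs, with the l2 norm instead of the max norm that the library puts on
   products. *)
Definition sum2 (X Y : completeNormedModType K) : Type := (X * Y)%type.

Section Sum2Norm.
Variables X Y : completeNormedModType K.

HB.instance Definition _ := GRing.Lmodule.copy (sum2 X Y) (X * Y)%type.

Definition sum2_norm (z : sum2 X Y) : K :=
  real_scalar k (Num.sqrt (rnorm z.1 ^+ 2 + rnorm z.2 ^+ 2)).

Let sum2_normD (x y : sum2 X Y) :
  sum2_norm (x + y) <= sum2_norm x + sum2_norm y.
Proof.
rewrite /sum2_norm -real_scalarD ler_real_scalar.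
have le2 (a b : R) : 0 <= b -> a ^+ 2 <= b ^+ 2 -> a <= b.
  move=> b0; case: (leP 0 a) => [a0|a0 _]; last exact: le_trans (ltW a0) b0.
  by rewrite ler_sqr.
set a := rnorm x.1; set b := rnorm y.1; set c := rnorm x.2; set d := rnorm y.2.
have sq (s t : R) : Num.sqrt (s ^+ 2 + t ^+ 2) ^+ 2 = s ^+ 2 + t ^+ 2.
  by rewrite sqr_sqrtr// addr_ge0 ?sqr_ge0.
have A0 := sqrtr_ge0 (a ^+ 2 + c ^+ 2); have B0 := sqrtr_ge0 (b ^+ 2 + d ^+ 2).
have A2 := sq a c; have B2 := sq b d.
move: A0 A2 B0 B2; set A := Num.sqrt _; set B := Num.sqrt (b ^+ 2 + _).
move=> A0 A2 B0 B2.
apply: (le2); first exact: addr_ge0.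
rewrite sqr_sqrtr ?addr_ge0 ?sqr_ge0//.
have cs : a * b + c * d <= A * B.
  apply: (le2); first exact: mulr_ge0.
  rewrite exprMn A2 B2 -subr_ge0.
  have -> : (a ^+ 2 + c ^+ 2) * (b ^+ 2 + d ^+ 2) - (a * b + c * d) ^+ 2 =
    (a * d - b * c) ^+ 2 by ring.
  exact: sqr_ge0.
have h1 : rnorm (x + y).1 ^+ 2 <= (a + b) ^+ 2.
  by rewrite ler_sqr ?nnegrE ?addr_ge0 ?rnorm_ge0// rnormD.
have h2 : rnorm (x + y).2 ^+ 2 <= (c + d) ^+ 2.
  by rewrite ler_sqr ?nnegrE ?addr_ge0 ?rnorm_ge0// rnormD.
by rewrite (le_trans (lerD h1 h2))// !sqrrD A2 B2; lra.
Qed.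

Let sum2_normZ (a : K) (x : sum2 X Y) : sum2_norm (a *: x) = `|a| * sum2_norm x.
Proof.
rewrite /sum2_norm/= !rnormZ (normr_rnorm a) -real_scalarM; congr real_scalar.
rewrite !exprMn -mulrDr sqrtrM ?sqr_ge0// sqrtr_sqr ger0_norm//.
exact: rnorm_ge0.
Qed.

Let sum2_norm0_eq0 (x : sum2 X Y) : sum2_norm x = 0 -> x = 0.
Proof.
rewrite /sum2_norm -(real_scalar0 R k) => /(can_inj (@real_scalarK R k)) /eqP.
rewrite sqrtr_eq0 => x0.
have := addr_ge0 (sqr_ge0 (rnorm x.1)) (sqr_ge0 (rnorm x.2)).
rewrite le0r ltNge x0 orbF paddr_eq0 ?sqr_ge0// !sqrf_eq0.
by move=> /andP[/eqP/rnorm_eq0 x1 /eqP/rnorm_eq0 x2]; case: x x1 x2 {x0} => ? ? /= -> ->.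
Qed.

HB.instance Definition _ := Lmodule_isNormed.Build K (sum2 X Y)
  sum2_normD sum2_normZ sum2_norm0_eq0.

Lemma rnorm_sum2 (z : sum2 X Y) :
  rnorm z = Num.sqrt (rnorm z.1 ^+ 2 + rnorm z.2 ^+ 2).
Proof. by rewrite [LHS]real_scalarK. Qed.

Let sum2_complete (F : set_system (sum2 X Y)) :
  ProperFilter F -> cauchy F -> cvg F.
Proof.
apply: fast_cauchy_complete => u uf.
have le1 (z : sum2 X Y) : rnorm z.1 <= rnorm z.
  rewrite rnorm_sum2 -[leLHS]ger0_norm ?rnorm_ge0// -sqrtr_sqr.
  by rewrite ler_sqrt ?lerDl ?addr_ge0 ?sqr_ge0.
have le2 (z : sum2 X Y) : rnorm z.2 <= rnorm z.
  rewrite rnorm_sum2 -[leLHS]ger0_norm ?rnorm_ge0// -sqrtr_sqr.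
  by rewrite ler_sqrt ?lerDr ?addr_ge0 ?sqr_ge0.
have u1 : fast_cauchy (fun n => (u n).1).
  by move=> n; exact: le_trans (le1 (u n.+1 - u n)) (uf n).
have u2 : fast_cauchy (fun n => (u n).2).
  by move=> n; exact: le_trans (le2 (u n.+1 - u n)) (uf n).
have [l1 l1P] := fast_cauchy_cvg u1; have [l2 l2P] := fast_cauchy_cvg u2.
exists ((l1, l2) : sum2 X Y), 4 => n.
have h0 : 0 <= 2^-1 ^+ n :> R by rewrite exprn_ge0.
rewrite rnorm_sum2 -[leRHS]ger0_norm ?mulr_ge0// -sqrtr_sqr ler_sqrt ?sqr_ge0//.
have sq a : 0 <= a -> a <= 2 * 2^-1 ^+ n -> a ^+ 2 <= (2 * 2^-1 ^+ n) ^+ 2 :> R.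
  by move=> a0 aD; rewrite ler_sqr ?nnegrE ?mulr_ge0.
apply: le_trans (lerD (sq _ (rnorm_ge0 _) (l1P n)) (sq _ (rnorm_ge0 _) (l2P n))) _.
have := sqr_ge0 (2^-1 ^+ n : R); rewrite !exprMn; lra.
Qed.

HB.instance Definition _ := Uniform_isComplete.Build (sum2 X Y) sum2_complete.

End Sum2Norm.

Definition sum2_inl (X Y : completeNormedModType K) (x : X) : sum2 X Y := (x, 0).

Definition sum2_inr (X Y : completeNormedModType K) (y : Y) : sum2 X Y := (0, y).

End Sum2.


Section SquareSums.
Variable R : realType.
Implicit Types a b : nat -> R.

Lemma sum_le_limn_series a : (forall n, 0 <= a n) -> cvgn (series a) ->
  forall N, \sum_(0 <= n < N) a n <= limn (series a).
Proof.
move=> a0 ca N; apply: (nondecreasing_cvgn_le (u_ := series a)) => // m n mn.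
by apply: nondecreasing_series => // i _ _; exact: a0.
Qed.

Lemma series_bounded_cvg a M : (forall n, 0 <= a n) ->
  (forall N, \sum_(0 <= n < N) a n <= M) ->
  cvgn (series a) /\ limn (series a) <= M.
Proof.
move=> a0 aM.
have ca : cvgn (series a).
  apply: nondecreasing_is_cvgn.
    by move=> m n mn; apply: nondecreasing_series => // i _ _; exact: a0.
  by exists M => _ [N _ <-]; exact: aM.
by split=> //; apply: limr_le => //; near=> N; exact: aM.
Unshelve. all: by end_near. Qed.

Lemma minkowski_partial a b (A B : R) : 0 <= A -> 0 <= B ->
  (forall n, 0 <= a n) -> (forall n, 0 <= b n) ->
  (forall N, \sum_(0 <= n < N) a n ^+ 2 <= A ^+ 2) ->
  (forall N, \sum_(0 <= n < N) b n ^+ 2 <= B ^+ 2) ->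
  forall N, \sum_(0 <= n < N) (a n + b n) ^+ 2 <= (A + B) ^+ 2.
Proof.
move=> A0 B0 a0 b0 aA bB N.
have all0 (c : nat -> R) C : 0 = C -> (forall n, 0 <= c n) ->
    (forall N, \sum_(0 <= n < N) c n ^+ 2 <= C ^+ 2) -> forall n, c n = 0.
  move=> <- c0 cC n; have := cC n.+1; rewrite big_nat_recr//= expr0n/= => cn.
  have s0 : 0 <= \sum_(0 <= i < n) c i ^+ 2 by apply: sumr_ge0 => i _; exact: sqr_ge0.
  apply/eqP; rewrite -sqrf_eq0 eq_le sqr_ge0 andbT.
  by apply: le_trans cn; rewrite lerDr.
have [A_0|An0] := eqVneq 0 A.
  rewrite -A_0 add0r; under eq_bigr do rewrite (all0 a A)// add0r.
  exact: bB.
have [B_0|Bn0] := eqVneq 0 B.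
  rewrite -B_0 addr0; under eq_bigr do rewrite (all0 b B)// addr0.
  exact: aA.
have Ap : 0 < A by rewrite lt_def eq_sym An0.
have Bp : 0 < B by rewrite lt_def eq_sym Bn0.
have ineq n : (a n + b n) ^+ 2 <=
    (1 + B / A) * a n ^+ 2 + (1 + A / B) * b n ^+ 2.
  rewrite -subr_ge0.
  have -> : (1 + B / A) * a n ^+ 2 + (1 + A / B) * b n ^+ 2 - (a n + b n) ^+ 2 =
      (B * a n - A * b n) ^+ 2 / (A * B).
    by field; rewrite gt_eqF// gt_eqF.
  by rewrite divr_ge0 ?sqr_ge0 ?mulr_ge0.
apply: le_trans (ler_sum _ (fun n _ => ineq n)) _.
rewrite big_split/= -!mulr_sumr.
have -> : (A + B) ^+ 2 = (1 + B / A) * A ^+ 2 + (1 + A / B) * B ^+ 2.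
  by field; rewrite gt_eqF// gt_eqF.
by rewrite lerD// ler_wpM2l ?addr_ge0 ?divr_ge0.
Qed.

End SquareSums.

Section L2Sum.
Variables (R : realType) (k : scalar_kind).
Local Notation K := (scalars R k).

Definition dfamily (E : nat -> completeNormedModType K) : Type := forall n, E n.

Section Family.
Variable E : nat -> completeNormedModType K.
Implicit Types x y z : dfamily E.

HB.instance Definition _ := Choice.copy (dfamily E) (forall n, E n).

Let famA : associative (fun x y : dfamily E => (fun n => x n + y n) : dfamily E).
Proof. by move=> x y z; apply: functional_extensionality_dep => n; exact: addrA. Qed.
Let famC : commutative (fun x y : dfamily E => (fun n => x n + y n) : dfamily E).
Proof. by move=> x y; apply: functional_extensionality_dep => n; exact: addrC. Qed.
Let fam0 : left_id ((fun=> 0) : dfamily E)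
  (fun x y : dfamily E => (fun n => x n + y n) : dfamily E).
Proof. by move=> x; apply: functional_extensionality_dep => n; exact: add0r. Qed.
Let famN : left_inverse ((fun=> 0) : dfamily E)
  (fun x : dfamily E => (fun n => - x n) : dfamily E)
  (fun x y : dfamily E => (fun n => x n + y n) : dfamily E).
Proof. by move=> x; apply: functional_extensionality_dep => n; exact: addNr. Qed.

HB.instance Definition _ := GRing.isZmodule.Build (dfamily E) famA famC fam0 famN.

Let scale (a : K) (x : dfamily E) : dfamily E := fun n => a *: x n.
Let scaleA a b x : scale a (scale b x) = scale (a * b) x.
Proof. by apply: functional_extensionality_dep => n; exact: scalerA. Qed.
Let scale1 : left_id 1 scale.
Proof. by move=> x; apply: functional_extensionality_dep => n; exact: scale1r. Qed.
Let scaleDr : right_distributive scale +%R.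
Proof. by move=> a x y; apply: functional_extensionality_dep => n; exact: scalerDr. Qed.
Let scaleDl x : {morph scale^~ x : a b / a + b}.
Proof. by move=> a b; apply: functional_extensionality_dep => n; exact: scalerDl. Qed.

HB.instance Definition _ := GRing.Zmodule_isLmodule.Build K (dfamily E)
  scaleA scale1 scaleDr scaleDl.

Definition square_summable x := cvgn (series (fun n => rnorm (x n) ^+ 2)).

Definition l2_mem : {pred dfamily E} := [pred x | `[< square_summable x >]].

Let sq0 x n : 0 <= rnorm (x n) ^+ 2.
Proof. exact: sqr_ge0. Qed.

Lemma square_summableD x y : square_summable x -> square_summable y ->
  square_summable (x + y) /\
  Num.sqrt (limn (series (fun n => rnorm ((x + y) n) ^+ 2))) <=
  Num.sqrt (limn (series (fun n => rnorm (x n) ^+ 2))) +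
  Num.sqrt (limn (series (fun n => rnorm (y n) ^+ 2))).
Proof.
move=> sx sy.
set A := Num.sqrt (limn (series (fun n => rnorm (x n) ^+ 2))).
set B := Num.sqrt (limn (series (fun n => rnorm (y n) ^+ 2))).
have AP z : square_summable z -> forall N, \sum_(0 <= n < N) rnorm (z n) ^+ 2 <=
    Num.sqrt (limn (series (fun n => rnorm (z n) ^+ 2))) ^+ 2.
  move=> sz N; have H := sum_le_limn_series (sq0 z) sz.
  rewrite sqr_sqrtr; first exact: H.
  by have := H 0%N; rewrite big_nil.
have [|cD lD] := @series_bounded_cvg _ _ ((A + B) ^+ 2) (sq0 (x + y)).
  move=> N; apply: le_trans (@minkowski_partial _ (fun n => rnorm (x n))
    (fun n => rnorm (y n)) A B (sqrtr_ge0 _) (sqrtr_ge0 _) _ _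
    (AP x sx) (AP y sy) N).
  apply: ler_sum => n _; rewrite ler_sqr ?nnegrE ?rnorm_ge0//.
  - exact: rnormD.
  - by rewrite addr_ge0 ?rnorm_ge0.
  - by move=> n; exact: rnorm_ge0.
  - by move=> n; exact: rnorm_ge0.
split=> //; rewrite -[leRHS]ger0_norm ?addr_ge0 ?sqrtr_ge0// -sqrtr_sqr.
by rewrite ler_sqrt ?sqr_ge0.
Qed.

Lemma square_summableZ (a : K) x : square_summable x ->
  square_summable (a *: x) /\
  limn (series (fun n => rnorm ((a *: x) n) ^+ 2)) =
  rnorm a ^+ 2 * limn (series (fun n => rnorm (x n) ^+ 2)).
Proof.
move=> sx.
have H : (series (fun n => rnorm ((a *: x) n) ^+ 2)) @ \oo -->
    rnorm a ^+ 2 * limn (series (fun n => rnorm (x n) ^+ 2)).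
  have -> : series (fun n => rnorm ((a *: x) n) ^+ 2) =
      (fun N => rnorm a ^+ 2 * series (fun n => rnorm (x n) ^+ 2) N).
    apply/funext => N; rewrite /series/= mulr_sumr; apply: eq_bigr => n _.
    by rewrite -exprMn -rnormZ.
  exact: cvgMr.
by split; [apply/cvg_ex; eexists; exact: H|exact: cvg_lim].
Qed.

Let l2_submod : submod_closed l2_mem.
Proof.
split.
  rewrite inE.
  have [||//] := @series_bounded_cvg R (fun n => rnorm ((0 : dfamily E) n) ^+ 2) 0.
    by move=> n; exact: sqr_ge0.
  move=> N.
  by rewrite big1// => n _; rewrite rnorm0 expr0n.
move=> a x y; rewrite !inE => sx sy.
by apply: (square_summableD _ sy).1; exact: (square_summableZ a sx).1.
Qed.

HB.instance Definition _ := GRing.isSubmodClosed.Build K (dfamily E) l2_mem l2_submod.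

Record l2sum : Type := L2Sum { l2fun : dfamily E ; l2funP : l2fun \in l2_mem }.

HB.instance Definition _ := [isSub for l2fun].
HB.instance Definition _ := [Choice of l2sum by <:].
HB.instance Definition _ := [SubChoice_isSubLmodule of l2sum by <:].

Lemma l2sumP (x : l2sum) : square_summable (l2fun x).
Proof. by have := l2funP x; rewrite inE. Qed.

Lemma l2funD (x y : l2sum) : l2fun (x + y) = l2fun x + l2fun y.
Proof. exact: (raddfD val). Qed.

Lemma l2funB (x y : l2sum) : l2fun (x - y) = l2fun x - l2fun y.
Proof. exact: (raddfB val). Qed.

Lemma l2funZ (a : K) (x : l2sum) : l2fun (a *: x) = a *: l2fun x.
Proof. exact: (linearZ_LR val). Qed.

Definition l2_norm (x : l2sum) : K :=
  real_scalar k (Num.sqrt (limn (series (fun n => rnorm (l2fun x n) ^+ 2)))).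

Let l2_normD (x y : l2sum) : l2_norm (x + y) <= l2_norm x + l2_norm y.
Proof.
rewrite /l2_norm -real_scalarD ler_real_scalar l2funD.
exact: (square_summableD (@l2sumP x) (@l2sumP y)).2.
Qed.

Let l2_normZ (a : K) (x : l2sum) : l2_norm (a *: x) = `|a| * l2_norm x.
Proof.
rewrite /l2_norm (normr_rnorm a) -real_scalarM; congr real_scalar.
rewrite l2funZ (square_summableZ a (@l2sumP x)).2 sqrtrM ?sqr_ge0// sqrtr_sqr ger0_norm//.
exact: rnorm_ge0.
Qed.

Lemma l2_partial (x : l2sum) N :
  \sum_(0 <= n < N) rnorm (l2fun x n) ^+ 2 <= scalar_re (l2_norm x) ^+ 2.
Proof.
have H := sum_le_limn_series (sq0 (l2fun x)) (@l2sumP x).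
rewrite real_scalarK sqr_sqrtr; first exact: H.
by have := H 0%N; rewrite big_nil.
Qed.

Lemma l2_coord (x : l2sum) n : rnorm (l2fun x n) <= scalar_re (l2_norm x).
Proof.
rewrite -ler_sqr ?nnegrE ?rnorm_ge0//; last by rewrite real_scalarK sqrtr_ge0.
apply: le_trans (l2_partial x n.+1); rewrite big_nat_recr//= lerDr.
by apply: sumr_ge0 => i _; exact: sqr_ge0.
Qed.

Let l2_norm0_eq0 (x : l2sum) : l2_norm x = 0 -> x = 0.
Proof.
move=> x0; apply/val_inj/functional_extensionality_dep => n.
apply/rnorm_eq0/eqP; rewrite eq_le rnorm_ge0 andbT.
by have := l2_coord x n; rewrite x0 -{1}(real_scalar0 R k) real_scalarK.
Qed.

HB.instance Definition _ := Lmodule_isNormed.Build K l2sum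
  l2_normD l2_normZ l2_norm0_eq0.

Lemma rnorm_l2sum (x : l2sum) :
  rnorm x = Num.sqrt (limn (series (fun n => rnorm (l2fun x n) ^+ 2))).
Proof. by rewrite [LHS]real_scalarK. Qed.

Let l2_complete (F : set_system l2sum) : ProperFilter F -> cauchy F -> cvg F.
Proof.
apply: fast_cauchy_complete => u uf.
have un n : fast_cauchy (fun m => l2fun (u m) n).
  by move=> m; have := l2_coord (u m.+1 - u m) n; rewrite l2funB => /le_trans; apply; exact: uf.
pose l n := sval (cid (fast_cauchy_cvg (un n))).
have lP n : forall m, rnorm (l n - l2fun (u m) n) <= 2 * 2^-1 ^+ m.
  by rewrite /l; case: cid.
clearbody l.
have h0 n : 0 < 2^-1 ^+ n :> R by rewrite exprn_gt0.
have close n N : \sum_(0 <= i < N) rnorm (l i - l2fun (u n) i) ^+ 2 <=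
    (2 * 2^-1 ^+ n) ^+ 2.
  have : (fun m => \sum_(0 <= i < N) rnorm (l2fun (u m) i - l2fun (u n) i) ^+ 2)
      @ \oo --> \sum_(0 <= i < N) rnorm (l i - l2fun (u n) i) ^+ 2.
    apply: (cvg_big add_continuous) => i _; rewrite expr2; under eq_fun do rewrite expr2.
    have ci : rnorm (l2fun (u m) i - l2fun (u n) i) @[m --> \oo] -->
        rnorm (l i - l2fun (u n) i).
      apply/cvgrPdist_lt => e e0.
      have [M MP] := exp_half_small (divr_gt0 e0 (ltr0Sn R 1)).
      exists M => // m /= Mm; apply: le_lt_trans (rnorm_lip _ _) _.
      rewrite opprB addrA subrK.
      by apply: le_lt_trans (lP i m) _; rewrite mulrC -ltr_pdivlMr// MP.
    exact: cvgM.
  move=> cl; rewrite -(cvg_lim _ cl)//; apply: limr_le.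
    by apply/cvg_ex; eexists; exact: cl.
  exists n => // m /= nm.
  have := l2_partial (u m - u n) N; rewrite l2funB => /le_trans; apply.
  have hn : 0 <= 2 * 2^-1 ^+ n :> R by rewrite mulr_ge0// ltW.
  have nu : 0 <= scalar_re (l2_norm (u m - u n)) := rnorm_ge0 (u m - u n).
  rewrite ler_sqr//.
  by have := fast_cauchy_dist uf (m - n)%N n; rewrite subnK.
pose d n : dfamily E := fun i => l i - l2fun (u n) i.
have dP n := series_bounded_cvg (sq0 (d n)) (close n).
have lS : (l : dfamily E) \in l2_mem.
  have -> : (l : dfamily E) = d 0%N + l2fun (u 0%N).
    by apply: functional_extensionality_dep => i; rewrite [RHS]subrK.
  by rewrite rpredD ?l2funP// inE; exact: (dP 0%N).1.
exists (L2Sum lS), 2 => n; rewrite rnorm_l2sum.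
rewrite -[leRHS]ger0_norm ?mulr_ge0 ?(ltW (h0 _))// -sqrtr_sqr.
by rewrite ler_sqrt ?sqr_ge0//; exact: (dP n).2.
Qed.

HB.instance Definition _ := Uniform_isComplete.Build l2sum l2_complete.

End Family.
End L2Sum.


Section Ultrapower.
Local Open Scope quotient_scope.
Variables (R : realType) (k : scalar_kind).
Local Notation K := (scalars R k).

Section BoundedFamilies.
Variables (I : Type) (X : completeNormedModType K).

Definition linf_mem : {pred I -> X} :=
  [pred f | `[< exists M : R, forall i, rnorm (f i) <= M >]].

Let linf_submod : submod_closed linf_mem.
Proof.
split; first by rewrite inE; exists 0 => i; rewrite rnorm0.
move=> a f g; rewrite !inE => -[M fM] [N gN]; exists (rnorm a * M + N) => i.
apply: le_trans (rnormD _ _) _; rewrite rnormZ lerD// ler_wpM2l ?rnorm_ge0//.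
Qed.

HB.instance Definition _ :=
  GRing.isSubmodClosed.Build K (I -> X) linf_mem linf_submod.

Record linf : Type := Linf { linf_fun : I -> X ; linfP : linf_fun \in linf_mem }.

HB.instance Definition _ := [isSub for linf_fun].
HB.instance Definition _ := [Choice of linf by <:].
HB.instance Definition _ := [SubChoice_isSubLmodule of linf by <:].

Lemma linf_funD (f g : linf) : linf_fun (f + g) = linf_fun f + linf_fun g.
Proof. exact: (raddfD val). Qed.

Lemma linf_funB (f g : linf) : linf_fun (f - g) = linf_fun f - linf_fun g.
Proof. exact: (raddfB val). Qed.

Lemma linf_funZ (a : K) (f : linf) : linf_fun (a *: f) = a *: linf_fun f.
Proof. exact: (linearZ_LR val). Qed.

Lemma linf_bounded (f : linf) : exists M : R, forall i, rnorm (linf_fun f i) <= M.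
Proof. by have := linfP f; rewrite inE. Qed.

End BoundedFamilies.

Variables (I : Type) (U : set_system I).

Lemma ultrafilter_cvg (FU : UltraFilter U) (a : I -> R) M :
  (forall i, 0 <= a i <= M) -> cvg (a @ U).
Proof.
move=> aM.
have [|p [_ pU]] := @segment_compact R 0 M (a @ U) _.
  by apply: (@filterE I U) => i; rewrite /= in_itv/=; exact: aM.
apply/cvg_ex; exists p => B Bp.
have [//|UB] := in_ultra_setVsetC (a @^-1` B) FU.
have UB' : (a @ U) (~` B) by [].
by have [x [/= nBx Bx]] := pU _ _ UB' Bp.
Qed.

Variables (FU : UltraFilter U) (X : completeNormedModType K).
Implicit Types f g : linf I X.

Definition ultra_null : {pred linf I X} :=
  [pred f | `[< rnorm (linf_fun f i) @[i --> U] --> (0 : R) >]].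

Let ultra_nullP f : f \in ultra_null <->
  forall e : R, 0 < e -> \forall i \near U, rnorm (linf_fun f i) < e.
Proof.
rewrite inE; split.
  move=> /cvgrPdist_lt h e e0; have := h e e0; apply: filterS => i.
  by rewrite sub0r normrN ger0_norm ?rnorm_ge0.
move=> h; apply/cvgrPdist_lt => e e0; have := h e e0; apply: filterS => i.
by rewrite sub0r normrN ger0_norm ?rnorm_ge0.
Qed.

Let ultra_null_submod : submod_closed ultra_null.
Proof.
split.
  by apply/ultra_nullP => e e0; apply: filterE => i; rewrite rnorm0.
move=> a f g /ultra_nullP f0 /ultra_nullP g0; apply/ultra_nullP => e e0.
have A0 : 0 < rnorm a + 1 by rewrite ltr_wpDl ?rnorm_ge0.
have e1 : 0 < e / 2 / (rnorm a + 1) by rewrite !divr_gt0.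
have e2 : 0 < e / 2 by rewrite divr_gt0.
apply: filterS2 (f0 _ e1) (g0 _ e2) => i fi gi.
rewrite linf_funD linf_funZ; apply: le_lt_trans (rnormD _ _) _.
rewrite rnormZ [ltRHS]splitr ler_ltD//.
have := ltW fi; rewrite ler_pdivlMr// mulrC; apply: le_trans.
by rewrite ler_wpM2r ?rnorm_ge0// lerDl.
Qed.

HB.instance Definition _ :=
  GRing.isSubmodClosed.Build K (linf I X) ultra_null ultra_null_submod.

Definition ultrapower : Type := Quotient.quot ultra_null.

HB.instance Definition _ := GRing.Zmodule.on ultrapower.

Definition ultra_class (f : linf I X) : ultrapower := \pi_(Quotient.quot ultra_null) f.

Lemma ultra_classE f g : ultra_class f = ultra_class g <-> f - g \in ultra_null.
Proof. by rewrite Quotient.idealrBE; split => [/eqP|/eqP]. Qed.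

Lemma ultra_class_surj (v : ultrapower) : exists f, ultra_class f = v.
Proof. by exists (repr v); exact: reprK. Qed.

Lemma ultra_classD f g : ultra_class (f + g) = ultra_class f + ultra_class g.
Proof. exact: (raddfD \pi_(Quotient.quot ultra_null)). Qed.

Lemma ultra_classB f g : ultra_class (f - g) = ultra_class f - ultra_class g.
Proof. exact: (raddfB \pi_(Quotient.quot ultra_null)). Qed.

Definition ultra_scale (a : K) (v : ultrapower) : ultrapower :=
  ultra_class (a *: (repr v : linf I X)).

Let ultra_scaleE a f : ultra_scale a (ultra_class f) = ultra_class (a *: f).
Proof.
apply/ultra_classE; rewrite -scalerBr rpredZ//.
by apply/ultra_classE; exact: reprK.
Qed.

Let ultra_scaleA a b v : ultra_scale a (ultra_scale b v) = ultra_scale (a * b) v.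
Proof. by have [f <-] := ultra_class_surj v; rewrite !ultra_scaleE scalerA. Qed.

Let ultra_scale1 : left_id 1 ultra_scale.
Proof.
by move=> v; have [f <-] := ultra_class_surj v; rewrite !ultra_scaleE scale1r.
Qed.

Let ultra_scaleDr : right_distributive ultra_scale +%R.
Proof.
move=> a v w; have [f <-] := ultra_class_surj v.
have [g <-] := ultra_class_surj w.
by rewrite -ultra_classD !ultra_scaleE scalerDr ultra_classD.
Qed.

Let ultra_scaleDl v : {morph ultra_scale^~ v : a b / a + b}.
Proof.
move=> a b; have [f <-] := ultra_class_surj v.
by rewrite !ultra_scaleE scalerDl ultra_classD.
Qed.

HB.instance Definition _ := GRing.Zmodule_isLmodule.Build K ultrapower
  ultra_scaleA ultra_scale1 ultra_scaleDr ultra_scaleDl.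

Lemma ultra_classZ a f : ultra_class (a *: f) = a *: ultra_class f.
Proof. by rewrite -ultra_scaleE. Qed.

Definition ultra_lim f : R := lim (rnorm (linf_fun f i) @[i --> U]).

Lemma ultra_lim_cvg f : rnorm (linf_fun f i) @[i --> U] --> ultra_lim f.
Proof.
have [M fM] := linf_bounded f.
by apply: (@ultrafilter_cvg FU _ M) => i; rewrite rnorm_ge0 fM.
Qed.

Let ultra_lim_unique f (l : R) :
  rnorm (linf_fun f i) @[i --> U] --> l -> ultra_lim f = l.
Proof. exact: cvg_lim. Qed.


Let ultra_lim_le f (M : R) :
  (\forall i \near U, rnorm (linf_fun f i) <= M) -> ultra_lim f <= M.
Proof.
by apply: limr_le; apply/cvg_ex; eexists; exact: ultra_lim_cvg.
Qed.

Let ultra_lim_null f : f \in ultra_null <-> ultra_lim f = 0.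
Proof.
rewrite inE; split; first exact: ultra_lim_unique.
by move=> <-; exact: ultra_lim_cvg.
Qed.

Let ultra_limD f g : ultra_lim (f + g) <= ultra_lim f + ultra_lim g.
Proof.
have h : rnorm (linf_fun f i) + rnorm (linf_fun g i) @[i --> U] -->
    ultra_lim f + ultra_lim g.
  exact: (@cvgD _ _ _ U _ _ _ _ _ (@ultra_lim_cvg f) (@ultra_lim_cvg g)).
have h2 := @cvgB _ _ _ U (@filter_filter _ _ (@ultra_proper _ _ FU)) _ _ _ _ h (@ultra_lim_cvg (f + g)).
rewrite -subr_ge0 -(cvg_lim _ h2)//; apply: limr_ge.
  by apply/cvg_ex; eexists; exact: h2.
apply: filterE => i; rewrite subr_ge0 linf_funD; exact: rnormD.
Qed.

Let ultra_limZ a f : ultra_lim (a *: f) = rnorm a * ultra_lim f.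
Proof.
apply: ultra_lim_unique.
under eq_fun do rewrite linf_funZ [X in rnorm X]/(a *: linf_fun f _) rnormZ.
exact: (@cvgMr _ _ U _ _ _ _ (@ultra_lim_cvg f)).
Qed.

Let ultra_lim_class f g : ultra_class f = ultra_class g -> ultra_lim f = ultra_lim g.
Proof.
have le u v : u - v \in ultra_null -> ultra_lim u <= ultra_lim v.
  move=> /ultra_lim_null uv; have := ultra_limD (u - v) v.
  by rewrite subrK uv add0r.
move=> fg; apply/eqP; rewrite eq_le !le//; apply/ultra_classE => //.
Qed.

(* By [rnorm_ultrapower] below, this is the quotient norm of the sup norm. *)
Definition ultra_norm (v : ultrapower) : K :=
  real_scalar k (ultra_lim (repr v : linf I X)).

Let ultra_normE f : ultra_norm (ultra_class f) = real_scalar k (ultra_lim f).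
Proof. by congr real_scalar; apply: ultra_lim_class; exact: reprK. Qed.

Let ultra_normD v w : ultra_norm (v + w) <= ultra_norm v + ultra_norm w.
Proof.
have [f <-] := ultra_class_surj v; have [g <-] := ultra_class_surj w.
by rewrite -ultra_classD !ultra_normE -real_scalarD ler_real_scalar.
Qed.

Let ultra_normZ a v : ultra_norm (a *: v) = `|a| * ultra_norm v.
Proof.
have [f <-] := ultra_class_surj v.
by rewrite -ultra_classZ !ultra_normE normr_rnorm -real_scalarM ultra_limZ.
Qed.

Let ultra_norm0_eq0 v : ultra_norm v = 0 -> v = 0.
Proof.
have [f <-] := ultra_class_surj v.
rewrite ultra_normE -{1}(real_scalar0 R k) => /(can_inj (@real_scalarK R k)).
move=> /ultra_lim_null f0.
have <- : ultra_class 0 = 0 by exact: (raddf0 \pi_(Quotient.quot ultra_null)).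
by apply/ultra_classE; rewrite subr0.
Qed.

HB.instance Definition _ := Lmodule_isNormed.Build K ultrapower
  ultra_normD ultra_normZ ultra_norm0_eq0.

Lemma rnorm_ultra_class f :
  rnorm (ultra_class f) = lim (rnorm (linf_fun f i) @[i --> U]).
Proof. by rewrite /rnorm [`|_|]ultra_normE real_scalarK. Qed.

Lemma ultra_class_bound f (M : R) : (forall i, rnorm (linf_fun f i) <= M) ->
  rnorm (ultra_class f) <= M.
Proof.
by move=> fM; rewrite rnorm_ultra_class; apply: ultra_lim_le; exact: filterE.
Qed.

Lemma ultra_class_trunc (v : ultrapower) (M : R) : rnorm v < M ->
  exists2 f, ultra_class f = v & forall i, rnorm (linf_fun f i) <= M.
Proof.
have [f <-] := ultra_class_surj v => fM.
have M0 : 0 <= M by rewrite (le_trans _ (ltW fM))// rnorm_ge0.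
pose g i := if rnorm (linf_fun f i) <= M then linf_fun f i else 0.
have gM i : rnorm (g i) <= M by rewrite /g; case: ifPn => // _; rewrite rnorm0.
have gP : g \in @linf_mem I X by rewrite inE; exists M.
exists (Linf gP) => //; apply/ultra_classE/ultra_nullP => e e0.
have d0 : 0 < M - rnorm (ultra_class f) by rewrite subr_gt0.
have /cvgrPdist_lt /(_ _ d0) := @ultra_lim_cvg f.
have -> : ultra_lim f = rnorm (ultra_class f) by rewrite rnorm_ultra_class.
apply: filterS => i fi.
have fiM : rnorm (linf_fun f i) <= M.
  move: fi; rewrite distrC => /(le_lt_trans (ler_norm _)).
  by rewrite ltrBDr subrK => /ltW.
have -> : linf_fun (Linf gP - f) i = g i - linf_fun f i by rewrite linf_funB.
by rewrite /g fiM subrr rnorm0.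
Qed.

Lemma rnorm_ultrapower (v : ultrapower) :
  rnorm v = inf [set M | exists2 f, ultra_class f = v &
                           forall i, rnorm (linf_fun f i) <= M].
Proof.
set A := [set M | _].
have Ae e : 0 < e -> A (rnorm v + e).
  by move=> e0; apply: ultra_class_trunc; rewrite ltrDl.
have lbA : lbound A (rnorm v).
  by move=> M [f <- fM]; exact: ultra_class_bound.
apply/eqP; rewrite eq_le; apply/andP; split.
  by apply: lb_le_inf => //; exists (rnorm v + 1); exact: Ae.
apply/ler_addgt0Pr => e e0; apply: ge_inf; last exact: Ae.
by exists (rnorm v).
Qed.

Let ultra_complete (F : set_system ultrapower) :
  ProperFilter F -> cauchy F -> cvg F.
Proof.
apply: fast_cauchy_complete => u uf.
have h0 n : 0 < 2^-1 ^+ n :> R by rewrite exprn_gt0.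
have dP n : exists g : linf I X, ultra_class g = u n.+2 - u n.+1 /\
    forall i, rnorm (linf_fun g i) <= 2^-1 ^+ n.
  have [|g gE gM] := @ultra_class_trunc (u n.+2 - u n.+1) (2^-1 ^+ n).
    apply: le_lt_trans (uf n.+1) _.
    by rewrite exprS gtr_pMl// invf_lt1// ltr1n.
  by exists g.
have [d /all_and2[dE dM]] := choice dP.
have [f0 f0E] := ultra_class_surj (u 1%N).
pose f n := f0 + \sum_(j < n) d j.
have fS n : f n.+1 - f n = d n.
  by rewrite /f big_ord_recr/= addrA [X in X - _]addrC addrK.
have fE n : ultra_class (f n) = u n.+1.
  elim: n => [|n IH]; first by rewrite /f big_ord0 addr0.
  have -> : f n.+1 = d n + f n by rewrite -fS subrK.
  by rewrite ultra_classD dE IH subrK.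
have fi i : fast_cauchy (fun n => linf_fun (f n) i).
  by move=> n; have := dM n i; rewrite -fS linf_funB.
have [l lP] := choice (fun i => fast_cauchy_cvg (fi i)).
have lB n : l - linf_fun (f n) \in @linf_mem I X.
  by rewrite inE; exists (2 * 2^-1 ^+ n) => i; exact: lP.
have lL : l \in @linf_mem I X.
  by rewrite -[l](subrK (linf_fun (f 0%N))) rpredD// linfP.
exists (ultra_class (Linf lL)), 4 => -[|n].
  have := lP; have -> : u 0%N = u 1%N - (u 1%N - u 0%N) by rewrite subKr.
  rewrite -fE => l0; apply: le_trans (rnormB_trans _ (ultra_class (f 0%N)) _) _.
  rewrite -ultra_classB subKr expr0 mulr1.
  have h1 : rnorm (ultra_class (Linf lL - f 0%N)) <= 2.
    apply: ultra_class_bound => i; rewrite linf_funB.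
    by have := l0 i 0%N; rewrite expr0 mulr1.
  have := uf 0%N; rewrite expr0 -fE => h2.
  by apply: le_trans (lerD h1 h2) _; lra.
rewrite -fE -ultra_classB exprS mulrA.
have -> : 4 * 2^-1 = 2 :> R by lra.
by apply: ultra_class_bound => i; rewrite linf_funB; exact: lP.
Qed.

HB.instance Definition _ := Uniform_isComplete.Build ultrapower ultra_complete.

End Ultrapower.

(* The [Vector] structure only records that a finite basis exists; every norm on
   a finite dimensional space is allowed. *)
#[short(type="finDimBanachType")]
HB.structure Definition FinDimBanach (K : numFieldType) :=
  {T of CompleteNormedModule K T & Vector K T}.

Section BanachSpaces.
Variables (R : realType) (k : scalar_kind).
Local Notation K := (scalars R k).
Implicit Types X Y Z H : completeNormedModType K.

Definition is_hilbert H : Prop :=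
  exists ip : {dot H for @scalar_conj R k}, forall x : H, `|x| ^+ 2 = ip x x.

Definition linear_isometry X Y (T : {linear X -> Y}) : Prop :=
  forall x : X, `|T x| = `|x|.

Definition linearly_isometric X Y : Prop :=
  exists T : {linear X -> Y}, linear_isometry T /\ range T = setT.

Definition elementarily_equivalent X Y : Prop :=
  exists (I J : Type) (U : set_system I) (V : set_system J)
    (FU : UltraFilter U) (FV : UltraFilter V),
    linearly_isometric (ultrapower FU X) (ultrapower FV Y).

(* Cardinals are represented by types. *)
Definition has_density_character X (kappa : Type) : Prop :=
  (exists D : set X, dense D /\ (D #= [set: kappa])%card) /\
  (forall D : set X, dense D -> ([set: kappa] #<= D)%card).

Definition finite_dimensional X : Prop :=
  exists (n : nat) (b : 'I_n -> X),
    forall x, exists c : 'I_n -> K, x = \sum_i c i *: b i.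

Definition uncountably_categorical X : Prop :=
  ~ finite_dimensional X /\
  exists kappa : Type, ~ countable [set: kappa] /\
    exists Y, [/\ elementarily_equivalent X Y, has_density_character Y kappa &
      forall Z, elementarily_equivalent X Z -> has_density_character Z kappa ->
        linearly_isometric Y Z].

End BanachSpaces.

(* Main.v *)
Require Import Defs.
From HB Require Import structures.
From mathcomp Require Import all_boot all_order all_algebra.
From mathcomp Require Import sesquilinear.
From mathcomp Require Import complex ring lra.
From mathcomp Require Import all_classical all_reals all_analysis.
Set Implicit Arguments.
Unset Strict Implicit.
Unset Printing Implicit Defensive.
Import Order.TTheory GRing.Theory Num.Theory.
Import numFieldNormedType.Exports.
Local Open Scope classical_set_scope.
Local Open Scope ring_scope.

(** For [x], [y] in a block [E n] as in (2), the sum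
    [|x + l y|^2 + |x - l y|^2] is [2 (1 + l^p)^(2/p)]. Jensen's inequality
    applied to (1) shows that, for small [l], images of [x] and [y] that have no
    coordinates in the blocks of exponent less than [p] can reach this value
    only if the image of [y] lies in the blocks of exponent exactly [p]. By
    induction on the exponent an isometry [T] maps each of these finite
    dimensional groups of blocks into, hence onto, itself; so [T] maps [E] onto
    [E] and, by orthogonality, [F] into [F + H], where the same argument with the
    inequalities reversed and the exponents decreasing gives [T F = F].

    Bounded sequences converge along an ultrafilter in the finite dimensional
    blocks, and the parallelogram law holds asymptotically along the blocks, so
    an ultrapower of [X = E + F] is [X] plus a space with the parallelogram law.

    If [Z] is elementarily equivalent to [X], it sits inside an ultrapower
    [W] of [X], and inside the ultrapower of [W] the diagonal copy of [X] and
    the copy coming from [Z] have the same range by rigidity; hence [Z] is [X]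
    plus a Hilbert space, which is determined by its density character. *)

(** * Linear algebra and isometries *)

(** The right sides of (1) and (3) are powers of sums of powers, so these inequalities do not add up
    over the blocks of an l2 sum. As functions of the squared norms the right sides are homogeneous
    of degree one, concave in (1) and convex in (3); replaced by a tangent plane they become
    additive. The plane is taken with the exponent of the block under study, and the same plane must
    serve all blocks not yet treated. The order of [E] and [F] is forced by the complements. The
    complement of [E] contains [F], about which only (5) is known from above, with a possibly large
    constant [C]; it is absorbed because [l^p] dominates [C^2 l^2] for small [l] when [p < 2]. Once
    [E] is settled, the complement of [F] is [H] alone, where the parallelogram law is exact.
    Hilbert summands are carried as families of projections with a parallelogram inequality up to an
    error [e], and are split off only at the end. Such data pass to an ultrapower, to an ultrapower
    of it, and to a subspace containing the copy of [X], which is what the last step of the argument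
    needs. *)

Section FiniteRank.
Variables (K : fieldType) (V : lmodType K).

(** The matrix of coefficients has [n.+1] rows and rank at most [n], so its left kernel contains a
    nonzero row. *)
Lemma spanned_dependent n (b : 'I_n -> V) (v : nat -> V) :
  (forall i, exists c : 'I_n -> K, v i = \sum_j c j *: b j) ->
  exists (a : nat -> K) (i : nat), [/\ (i < n.+1)%N, a i != 0 &
    \sum_(0 <= j < n.+1) a j *: v j = 0].
Proof.
move=> /choice[c cE].
pose M : 'M[K]_(n.+1, n) := \matrix_(i, j) c i j.
have : kermx M != 0.
  rewrite kermx_eq0 /row_free neq_ltn.
  by rewrite (leq_ltn_trans (rank_leq_col M)).
move=> /matrix0Pn[i0 [i ki]].
pose a j := \sum_(i : 'I_n.+1 | nat_of_ord i == j) kermx M i0 i.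
have aE (j : 'I_n.+1) : a j = kermx M i0 j.
  by rewrite /a (big_pred1 j) // => l; rewrite /= -val_eqE.
exists a, i; split => //; first by rewrite aE.
rewrite big_mkord; under eq_bigr do rewrite cE aE scaler_sumr.
rewrite exchange_big big1 // => j _.
under eq_bigr do rewrite scalerA.
rewrite -scaler_suml; have /matrixP/(_ i0 j) := mulmx_ker M.
rewrite !mxE => S0; rewrite (_ : \sum_i0 _ = 0) ?scale0r //.
by rewrite -[RHS]S0; apply: eq_bigr => l _; rewrite !mxE.
Qed.

(* The vectors [iter i f g] are dependent; cancelling the lowest power of [f]
   in a dependency exhibits [g] as a value of [f]. *)
Lemma linear_inj_onto n (b : 'I_n -> V) (S : set V) (f : V -> V) :
  linear f -> (forall a x y, S x -> S y -> S (a *: x + y)) ->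
  (forall x, S x -> exists c : 'I_n -> K, x = \sum_j c j *: b j) ->
  (forall x, S x -> S (f x)) -> (forall x, S x -> f x = 0 -> x = 0) ->
  forall g, S g -> exists2 g', S g' & f g' = g.
Proof.
move=> flin Slin Sb fS finj g Sg.
pose F := GRing.isLinear.Build K V V *:%R f flin.
pose f' : {linear V -> V} := HB.pack f F.
have fE x : f x = f' x by [].
have S0 : S 0 by rewrite -(addNr g) -scaleN1r; exact: Slin.
have Si i : S (iter i f g) by elim: i => //= i; exact: fS.
have Ssum (a : nat -> K) m : S (\sum_(0 <= j < m) a j *: iter j f g).
  elim: m => [|m IH]; first by rewrite big_nil.
  by rewrite big_nat_recr //= addrC; exact: Slin.
have [a [i [iltn ai]]] := spanned_dependent (fun i => Sb _ (Si i)).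
move: {iltn ai}(ex_intro2 (fun i => i < n.+1)%N (fun i => a i != 0) i iltn ai).
elim: (n.+1) a => [a [i'] //|m IH] a [l lm al].
rewrite big_nat_recl //=.
under eq_bigr do rewrite fE -linearZ.
rewrite -linear_sum -fE => a0.
have [a00|a0n] := eqVneq (a 0%N) 0.
  move: a0; rewrite a00 scale0r add0r => /finj-/(_ (Ssum (fun j => a j.+1) m)).
  apply: IH; case: l lm al => [|l lm al]; first by rewrite a00 eqxx.
  by exists l.
exists (- (a 0%N)^-1 *: \sum_(0 <= j < m) a j.+1 *: iter j f g).
  by have := Slin (- (a 0)^-1) _ _ (Ssum (fun j => a j.+1) m) S0; rewrite addr0.
rewrite fE linearZ -fE /= scaleNr.
move: a0 => /eqP; rewrite addrC addr_eq0 => /eqP ->.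
by rewrite scalerN opprK scalerA mulVf // scale1r.
Qed.

End FiniteRank.

Section Basics.
Variables (R : realType) (k : scalar_kind).
Local Notation K := (scalars R k).
Implicit Types X Y Z : completeNormedModType K.

Lemma real_scalar1 : real_scalar k (1 : R) = 1.
Proof. by rewrite /real_scalar; case: k. Qed.

Lemma real_scalarN (x : R) : real_scalar k (- x) = - real_scalar k x.
Proof.
by apply/eqP; rewrite -addr_eq0 -real_scalarD addNr real_scalar0.
Qed.

Lemma rnorm_abs (x : R) : rnorm (real_scalar k x) = `|x|.
Proof.
case: (leP 0 x) => x0; first by rewrite rnorm_real_scalar ?ger0_norm.
rewrite -[LHS]rnormN -real_scalarN rnorm_real_scalar; last by rewrite oppr_ge0 ltW.
by rewrite ltr0_norm.
Qed.

Lemma rnormZr X (a : R) (x : X) : rnorm (real_scalar k a *: x) = `|a| * rnorm x.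
Proof. by rewrite rnormZ rnorm_abs. Qed.

Lemma eq_sqr_rnorm X Y (x : X) (y : Y) : rnorm x ^+ 2 = rnorm y ^+ 2 -> rnorm x = rnorm y.
Proof.
by move=> /eqP; rewrite eqrXn2 ?rnorm_ge0 // => /eqP.
Qed.

Lemma rnorm_isometry X Y (T : X -> Y) :
  (forall x, `|T x| = `|x|) -> forall x, rnorm (T x) = rnorm x.
Proof. by move=> Ti x; rewrite /rnorm Ti. Qed.

Lemma isometry_rnorm X Y (T : X -> Y) :
  (forall x, rnorm (T x) = rnorm x) -> forall x, `|T x| = `|x|.
Proof. by move=> Ti x; rewrite !normr_rnorm Ti. Qed.

Lemma linear_pack X Y (f : X -> Y) : linear f ->
  exists T : {linear X -> Y}, forall x, T x = f x.
Proof.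
move=> flin; pose F := GRing.isLinear.Build K X Y *:%R f flin.
by pose T : {linear X -> Y} := HB.pack f F; exists T.
Qed.

(** Preimages of a sequence tending to [y] form a Cauchy sequence because distances are preserved,
    and the source is complete. *)
Lemma isometry_closed_range X Y (T : {linear X -> Y}) (y : Y) :
  linear_isometry T -> (forall e : R, 0 < e -> exists x, rnorm (y - T x) < e) ->
  exists x, T x = y.
Proof.
move=> /rnorm_isometry Ti Ty.
have h0 n : 0 < 2^-1 ^+ n.+1 / 2 :> R by rewrite divr_gt0 ?exprn_gt0 ?invr_gt0.
have [u uP] := choice (fun n => Ty _ (h0 n)).
have uf : fast_cauchy u.
  move=> n; rewrite -Ti linearB; apply: le_trans (rnormB_trans _ y _) _.
  rewrite rnormBC; apply: le_trans (lerD (ltW (uP _)) (ltW (uP _))) _.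
  rewrite !exprS; have : 0 <= 2^-1 ^+ n :> R by rewrite exprn_ge0.
  by lra.
have [l lP] := fast_cauchy_cvg uf; exists l.
apply/eqP; rewrite -subr_eq0; apply/eqP/rnorm_eq0/eqP.
rewrite eq_le rnorm_ge0 andbT; apply/ler_addgt0Pr => e e0; rewrite add0r.
have [n nP] := exp_half_small (divr_gt0 e0 (ltr0Sn R 3)).
apply: le_trans (rnormB_trans _ (T (u n)) _) _.
rewrite -linearB Ti; apply: le_trans (lerD (lP n) _) _.
  by rewrite rnormBC; exact: ltW (uP n).
have := nP _ (leqnn n); have := nP _ (leqnSn n); lra.
Qed.

(** The working form of [is_hilbert], equivalent to it by [hilbert_parallelogram] and
    [jordan_von_neumann]. As an equation between norms it needs no inner product to be
    transported. *)
Definition parallelogram X := forall x y : X,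
  rnorm (x + y) ^+ 2 + rnorm (x - y) ^+ 2 = 2 * (rnorm x ^+ 2 + rnorm y ^+ 2).

Lemma hilbert_parallelogram X : is_hilbert X -> parallelogram X.
Proof.
move=> [ip ipE] x y; apply: (can_inj (@real_scalarK R k)).
rewrite real_scalarM !real_scalarD real_scalar1 !expr2 !real_scalarM -!normr_rnorm -!expr2 !ipE.
have Bl (u v w : X) : ip (u - v) w = ip u w - ip v w.
  exact: (@zmod_morphisml_subproof _ _ _ _ _ _ ip w u v).
have Br (u v w : X) : ip w (u - v) = ip w u - ip w v.
  exact: (@zmod_morphismr_subproof _ _ _ _ _ _ ip w u v).
have l0 w : ip 0 w = 0 by rewrite -(subrr 0) Bl subrr.
have r0 w : ip w 0 = 0 by rewrite -(subrr 0) Br subrr.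
have -> : x + y = x - (0 - y) by rewrite sub0r opprK.
by rewrite !(Bl, Br) !l0 !r0; ring.
Qed.

End Basics.

(** * Power inequalities *)

Section PowerInequalities.
Variable R : realType.
Implicit Types (r w x y p s l : R).

(** Convexity of the power [r] for the weights [1/(1+w)] and [w/(1+w)], multiplied by [(1+w)^r]. *)
Lemma jensen_powR r w x y : 1 <= r -> 0 <= w -> 0 <= x -> 0 <= y ->
  (x + w * y) `^ r <= (1 + w) `^ (r - 1) * (x `^ r + w * y `^ r).
Proof.
move=> r1 w0 x0 y0.
have W0 : 0 < 1 + w by lra.
have t01 : 0 <= (1 + w)^-1 <= 1 by rewrite invr_ge0 ltW //= invf_le1 //; lra.
have /andP[t0 t1] := t01.
have := convex_powR r1 (Itv01 t0 t1) (x := x) (y := y).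
rewrite !inE /= !in_itv /= !andbT => /(_ x0 y0) H.
have {H} : ((1 + w)^-1 * x + (1 - (1 + w)^-1) * y) `^ r <=
    (1 + w)^-1 * x `^ r + (1 - (1 + w)^-1) * y `^ r by exact: H.
have -> : (1 + w)^-1 * x + (1 - (1 + w)^-1) * y = (x + w * y) / (1 + w).
  by field; rewrite gt_eqF.
have -> : (1 + w)^-1 * x `^ r + (1 - (1 + w)^-1) * y `^ r =
    (x `^ r + w * y `^ r) / (1 + w).
  by field; rewrite gt_eqF.
have xy0 : 0 <= x + w * y by rewrite addr_ge0 // mulr_ge0.
rewrite powRM ?invr_ge0 ?(ltW W0) // -(powR_inv1 (ltW W0)) -powRrM mulN1r.
rewrite powRN (powR_inv1 (ltW W0)) ler_pdivrMr ?powR_gt0 // => /le_trans; apply.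
rewrite powRB ?powRr1 ?(ltW W0) //; last by apply/implyP => _; rewrite gt_eqF.
by rewrite [leLHS]mulrC mulrA mulrAC.
Qed.

(** The preceding lemma with exponent [1/r], applied to the powers [x^r] and [y^r]. *)
Lemma jensen_powR_le1 r w x y : 0 < r <= 1 -> 0 <= w -> 0 <= x -> 0 <= y ->
  (1 + w) `^ (r - 1) * (x `^ r + w * y `^ r) <= (x + w * y) `^ r.
Proof.
move=> /andP[r0 r1] w0 x0 y0.
have W0 : 0 < 1 + w by lra.
have ri : 1 <= r^-1 by rewrite invf_ge1.
have := @jensen_powR r^-1 w (x `^ r) (y `^ r) ri w0 (powR_ge0 _ _) (powR_ge0 _ _).
rewrite -!powRrM mulfV ?gt_eqF // !powRr1 // => H.
have S0 : 0 <= x `^ r + w * y `^ r by rewrite addr_ge0 ?mulr_ge0 ?powR_ge0.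
have xy0 : 0 <= x + w * y by rewrite addr_ge0 // mulr_ge0.
have {}H : x `^ r + w * y `^ r <= (1 + w) `^ (1 - r) * (x + w * y) `^ r.
  have := ge0_ler_powR (ltW r0) _ _ H; rewrite -powRrM mulVf ?gt_eqF // powRr1 //.
  rewrite powRM ?powR_ge0 // -powRrM mulrBl mulVf ?gt_eqF // mul1r; apply.
    by rewrite nnegrE powR_ge0.
  by rewrite nnegrE mulr_ge0 ?powR_ge0.
apply: le_trans (ler_wpM2l (powR_ge0 _ _) H) _.
rewrite mulrA -powRD; last by apply/implyP => _; rewrite gt_eqF.
by rewrite addrC subrKA subrr powRr0 mul1r.
Qed.

(* The weights of Jensen's inequality are 1 and l^p. With p = s the bound is
   the tangent at (1, l). For s different from p the coefficient of b^2
   carries an extra factor that is strictly different from 1. *)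
Let split_power p s l (a b : R) : 0 < l -> 0 < s -> 0 <= a -> 0 <= b ->
  a `^ s + (l * b) `^ s = a `^ s + l `^ p * (l `^ (s - p) * b `^ s) /\
  (l `^ (s - p) * b `^ s) `^ (2 / s) = l `^ (2 * (1 - p / s)) * b ^+ 2.
Proof.
move=> l0 s0 a0 b0; split.
  rewrite mulrA -powRD; last by apply/implyP => _; rewrite gt_eqF.
  by rewrite subrKC powRM // ltW.
rewrite powRM ?powR_ge0 // -!powRrM -(powR_mulrn 2 b0); congr (_ `^ _ * _ `^ _).
  by field; rewrite gt_eqF.
by field; rewrite gt_eqF.
Qed.

Lemma power_sum_le p s l (a b : R) : 0 < l -> 0 < p -> p <= s -> s <= 2 ->
  0 <= a -> 0 <= b ->
  (a `^ s + (l * b) `^ s) `^ (2 / s) <=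
  (1 + l `^ p) `^ (2 / p - 1) *
    (a ^+ 2 + l `^ p * l `^ (2 * (1 - p / s)) * b ^+ 2).
Proof.
move=> l0 p0 ps s2 a0 b0.
have s0 := lt_le_trans p0 ps.
have [-> bE] := @split_power p s l a b l0 s0 a0 b0.
apply: le_trans (jensen_powR _ (powR_ge0 _ _) (powR_ge0 _ _) _) _.
- by rewrite ler_pdivlMr // mul1r.
- by rewrite mulr_ge0 ?powR_ge0.
rewrite bE -powRrM mulrA.
have -> : s * (2 / s) = 2 by field; rewrite gt_eqF.
rewrite (powR_mulrn 2) // -(mulrA _ _ (b ^+ 2)) ler_wpM2r //.
  by rewrite addr_ge0 ?sqr_ge0 // !mulr_ge0 ?powR_ge0 ?sqr_ge0.
(* Jensen yields the exponent [2/s - 1]; since the base is at least 1 and [p <= s], it may be raised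
   to [2/p - 1]. The constant then no longer depends on [s], so one expression serves all blocks. *)
rewrite ler_powR ?lerDl ?powR_ge0 // lerB // ler_wpM2l // lef_pV2 ?posrE //.
Qed.

Lemma power_sum_ge p s l (a b : R) : 0 < l -> s <= p -> 2 <= s ->
  0 <= a -> 0 <= b ->
  (1 + l `^ p) `^ (2 / p - 1) *
    (a ^+ 2 + l `^ p * l `^ (2 * (1 - p / s)) * b ^+ 2) <=
  (a `^ s + (l * b) `^ s) `^ (2 / s).
Proof.
move=> l0 sp s2 a0 b0.
have s0 : 0 < s by lra.
have [-> bE] := @split_power p s l a b l0 s0 a0 b0.
apply: le_trans (jensen_powR_le1 _ (powR_ge0 _ _) (powR_ge0 _ _) _); last 2 first.
- by rewrite divr_gt0 //= ler_pdivrMr // mul1r.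
- by rewrite mulr_ge0 ?powR_ge0.
rewrite bE -powRrM mulrA.
have -> : s * (2 / s) = 2 by field; rewrite gt_eqF.
rewrite (powR_mulrn 2) // -(mulrA _ _ (b ^+ 2)) ler_wpM2r //.
  by rewrite addr_ge0 ?sqr_ge0 // !mulr_ge0 ?powR_ge0 ?sqr_ge0.
rewrite ler_powR ?lerDl ?powR_ge0 // lerB // ler_wpM2l // lef_pV2 ?posrE //.
exact: lt_le_trans sp.
Qed.

Lemma powR_lt1 l s : 0 < l < 1 -> 0 < s -> l `^ s < 1.
Proof.
move=> /andP[l0 l1] s0.
by have := gt0_ltr_powR s0 _ _ l1; rewrite powR1; apply; rewrite nnegrE // ltW.
Qed.

Lemma powR_gt1 l s : 0 < l < 1 -> s < 0 -> 1 < l `^ s.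
Proof.
move=> l01 s0; rewrite -(opprK s) powRN invf_gt1; last first.
  by rewrite powR_gt0 //; case/andP: l01.
by rewrite powR_lt1 // oppr_gt0.
Qed.

End PowerInequalities.

(** * Quadratic expressions and l2 sums *)

Section FinSpan.
Variable K : fieldType.

(** The spanning vectors need not lie in [S], and they are indexed by [nat] so that two spanning
    lists can be concatenated without casts between ordinals. *)
Definition fin_span (V : lmodType K) (S : set V) := exists n (b : nat -> V),
  forall x, S x -> exists c : nat -> K, x = \sum_(0 <= i < n) c i *: b i.

Lemma fin_spanP (V : lmodType K) (S : set V) : fin_span S ->
  exists n (b : 'I_n -> V), forall x, S x -> exists c : 'I_n -> K, x = \sum_i c i *: b i.
Proof.
move=> [n [b bP]]; exists n, (fun i => b i) => x /bP[c ->].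
by exists (fun i => c i); rewrite big_mkord.
Qed.

Lemma fin_span_sub (V : lmodType K) (S S' : set V) : S `<=` S' ->
  fin_span S' -> fin_span S.
Proof. by move=> SS' [n [b bP]]; exists n, b => x /SS'; exact: bP. Qed.

Lemma fin_span_add (V : lmodType K) (S S' : set V) : fin_span S -> fin_span S' ->
  fin_span [set x | exists y z, [/\ S y, S' z & x = y + z]].
Proof.
move=> [n [b bP]] [m [d dP]].
exists (n + m)%N, (fun i => if (i < n)%N then b i else d (i - n)%N).
move=> x [y [z [/bP[c ->] /dP[e ->] ->]]].
exists (fun i => if (i < n)%N then c i else e (i - n)%N).
rewrite [RHS](big_cat_nat (n := n)) ?leq_addr //=; congr (_ + _).
  by rewrite !big_nat; apply: eq_bigr => i /andP[_ ->].
rewrite -[in RHS](add0n n) big_addn add0n addKn.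
by apply: eq_bigr => i _; rewrite ltnNge leq_addl /= addnK.
Qed.

Lemma fin_span_image (V W : lmodType K) (T : {linear V -> W}) (S : set V) :
  fin_span S -> fin_span (T @` S).
Proof.
move=> [n [b bP]]; exists n, (fun i => T (b i)) => _ [x /bP[c ->] <-].
by exists c; rewrite linear_sum; apply: eq_bigr => i _; rewrite linearZ.
Qed.

End FinSpan.

Section QuadForm.
Variables (R : realType) (k : scalar_kind).
Local Notation K := (scalars R k).

(* The inequalities (1) and (3), linearised by Jensen, say that such an expression
   is nonnegative; it is invariant under linear isometries and additive over
   l2 sums. *)
Definition quad (l k1 k2 k3 : R) (X : normedModType K) (u w : X) : R :=
  k1 * (rnorm (u + real_scalar k l *: w) ^+ 2 +
        rnorm (u - real_scalar k l *: w) ^+ 2) +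
  k2 * rnorm u ^+ 2 + k3 * rnorm w ^+ 2.

Lemma quad_isometry l k1 k2 k3 (X Y : completeNormedModType K)
    (T : {linear X -> Y}) (u w : X) : linear_isometry T ->
  quad l k1 k2 k3 (T u) (T w) = quad l k1 k2 k3 u w.
Proof.
by move=> /rnorm_isometry Ti; rewrite /quad -linearZ -linearD -linearB !Ti.
Qed.

Lemma sqr_rnorm_sum2 (X Y : completeNormedModType K) (z : sum2 X Y) :
  rnorm z ^+ 2 = rnorm z.1 ^+ 2 + rnorm z.2 ^+ 2.
Proof. by rewrite rnorm_sum2 sqr_sqrtr // addr_ge0 ?sqr_ge0. Qed.

Lemma quad_sum2 l k1 k2 k3 (X Y : completeNormedModType K) (u w : sum2 X Y) :
  quad l k1 k2 k3 u w = quad l k1 k2 k3 u.1 w.1 + quad l k1 k2 k3 u.2 w.2.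
Proof. by rewrite /quad !sqr_rnorm_sum2 /=; ring. Qed.

End QuadForm.

Section L2Facts.
Variables (R : realType) (k : scalar_kind).
Local Notation K := (scalars R k).
Variable V : nat -> completeNormedModType K.
Local Notation L := (l2sum V).
Implicit Types (x y : L) (D : pred nat).

Lemma l2funDE x y n : l2fun (x + y) n = l2fun x n + l2fun y n.
Proof. by rewrite l2funD. Qed.

Lemma l2funBE x y n : l2fun (x - y) n = l2fun x n - l2fun y n.
Proof. by rewrite l2funB. Qed.

Lemma l2funZE (a : K) x n : l2fun (a *: x) n = a *: l2fun x n.
Proof. by rewrite l2funZ. Qed.

Lemma l2fun0 n : l2fun (0 : L) n = 0.
Proof. by rewrite -(subrr (0 : L)) l2funBE subrr. Qed.

Lemma l2_norm_cvg x : series (fun n => rnorm (l2fun x n) ^+ 2) @ \oo --> rnorm x ^+ 2.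
Proof.
rewrite rnorm_l2sum sqr_sqrtr; first exact: l2sumP.
have := sum_le_limn_series (fun n => sqr_ge0 (rnorm (l2fun x n))) (@l2sumP _ _ _ x).
by move=> /(_ 0%N); rewrite big_nil.
Qed.

Lemma l2_norm_le x (M : R) :
  (forall N, \sum_(0 <= n < N) rnorm (l2fun x n) ^+ 2 <= M) -> rnorm x ^+ 2 <= M.
Proof.
move=> xM; rewrite -(cvg_lim _ (@l2_norm_cvg x)) //; apply: limr_le; first exact: l2sumP.
exact: nearW.
Qed.

Lemma l2_partial_le x N : \sum_(0 <= n < N) rnorm (l2fun x n) ^+ 2 <= rnorm x ^+ 2.
Proof. exact: l2_partial. Qed.

Lemma l2_ext x y : (forall m, l2fun x m = l2fun y m) -> x = y.
Proof. by move=> xy; apply/val_inj/functional_extensionality_dep. Qed.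

Lemma quad_l2_cvg l k1 k2 k3 x y :
  series (fun n => quad l k1 k2 k3 (l2fun x n) (l2fun y n)) @ \oo -->
    quad l k1 k2 k3 x y.
Proof.
have -> : series (fun n => quad l k1 k2 k3 (l2fun x n) (l2fun y n)) =
  (fun N => k1 * (series (fun n => rnorm (l2fun (x + real_scalar k l *: y) n) ^+ 2) N +
    series (fun n => rnorm (l2fun (x - real_scalar k l *: y) n) ^+ 2) N) +
    k2 * series (fun n => rnorm (l2fun x n) ^+ 2) N +
    k3 * series (fun n => rnorm (l2fun y n) ^+ 2) N).
  apply/funext => N; rewrite /series /= -big_split /= !mulr_sumr -!big_split /=.
  by apply: eq_bigr.
apply: cvgD; first apply: cvgD.
- by apply: cvgMr; apply: cvgD; exact: l2_norm_cvg.
- by apply: cvgMr; exact: l2_norm_cvg.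
- by apply: cvgMr; exact: l2_norm_cvg.
Qed.

Lemma quad_l2_ge l k1 k2 k3 x y m :
  (forall n, 0 <= quad l k1 k2 k3 (l2fun x n) (l2fun y n)) ->
  quad l k1 k2 k3 (l2fun x m) (l2fun y m) <= quad l k1 k2 k3 x y.
Proof.
move=> q0; rewrite -(cvg_lim _ (@quad_l2_cvg l k1 k2 k3 x y)) //.
apply: le_trans (sum_le_limn_series q0 _ m.+1).
  by rewrite big_nat_recr //= lerDr sumr_ge0.
by apply/cvg_ex; eexists; exact: quad_l2_cvg.
Qed.

Lemma quad_l2_ge0 l k1 k2 k3 x y :
  (forall n, 0 <= quad l k1 k2 k3 (l2fun x n) (l2fun y n)) ->
  0 <= quad l k1 k2 k3 x y.
Proof. by move=> q0; exact: le_trans (q0 0%N) (quad_l2_ge 0 q0). Qed.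

Lemma l2_restr_proof D x : (fun n => if D n then l2fun x n else 0) \in @l2_mem R k V.
Proof.
have [||c _] := @series_bounded_cvg _
    (fun n => rnorm (if D n then l2fun x n else 0) ^+ 2) (rnorm x ^+ 2).
- by move=> n; exact: sqr_ge0.
- move=> N; apply: le_trans (l2_partial_le x N); apply: ler_sum => n _.
  by case: ifP => // _; rewrite rnorm0 expr0n /= sqr_ge0.
by rewrite inE.
Qed.

Definition l2_restr D x : L := L2Sum (l2_restr_proof D x).

Lemma l2_restrE D x n : l2fun (l2_restr D x) n = if D n then l2fun x n else 0.
Proof. by []. Qed.

Lemma l2_restr_linear D : linear (l2_restr D).
Proof.
move=> a x y; apply: l2_ext => n.
rewrite l2funDE l2funZE !l2_restrE l2funDE l2funZE.
by case: (D n) => //; rewrite scaler0 addr0.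
Qed.

HB.instance Definition _ D := GRing.isLinear.Build K L L *:%R (l2_restr D)
  (l2_restr_linear D).

Lemma l2_restr_pythag D x :
  rnorm x ^+ 2 = rnorm (l2_restr D x) ^+ 2 + rnorm (x - l2_restr D x) ^+ 2.
Proof.
have xE n : rnorm (l2fun x n) ^+ 2 = rnorm (l2fun (l2_restr D x) n) ^+ 2 +
    rnorm (l2fun (x - l2_restr D x) n) ^+ 2.
  rewrite l2funBE l2_restrE; case: ifP => Dn.
    by rewrite subrr rnorm0 expr0n addr0.
  by rewrite subr0 rnorm0 expr0n add0r.
apply: cvg_unique (@l2_norm_cvg x) _ => //.
have -> : series (fun n => rnorm (l2fun x n) ^+ 2) = (fun N =>
    series (fun n => rnorm (l2fun (l2_restr D x) n) ^+ 2) N +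
    series (fun n => rnorm (l2fun (x - l2_restr D x) n) ^+ 2) N).
  apply/funext => N; rewrite /series /= -big_split.
  by apply: eq_bigr => n _; exact: xE.
by apply: cvgD; exact: l2_norm_cvg.
Qed.

Lemma l2_restr_id D x : (forall m, ~~ D m -> l2fun x m = 0) -> l2_restr D x = x.
Proof. by move=> xD; apply: l2_ext => m /=; case: ifPn => // /xD. Qed.

Lemma l2_restr0 D x : (forall m, D m -> l2fun x m = 0) -> l2_restr D x = 0.
Proof. by move=> xD; apply: l2_ext => m /=; case: ifPn => // /xD. Qed.

Definition l2_trunc N := l2_restr (fun m => (m < N)%N).

Lemma l2_trunc_cvg x (e : R) : 0 < e ->
  exists N, forall M, (N <= M)%N -> rnorm (x - l2_trunc M x) < e.
Proof.
move=> e0; have e2 : 0 < e ^+ 2 by rewrite exprn_gt0.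
have /cvgrPdist_lt /(_ _ e2)[N _ NP] := @l2_norm_cvg x.
exists N => M NM; rewrite -ltr_sqr ?nnegrE ?rnorm_ge0 ?ltW //.
have := l2_restr_pythag (fun m => (m < M)%N) x; rewrite -/(l2_trunc M) => xM.
have -> : rnorm (x - l2_trunc M x) ^+ 2 = rnorm x ^+ 2 - rnorm (l2_trunc M x) ^+ 2.
  by rewrite xM; lra.
apply: le_lt_trans (NP M NM); apply: le_trans (ler_norm _).
rewrite lerB //; apply: le_trans (l2_partial_le _ M).
by rewrite /series /= !big_nat; apply: ler_sum => n /andP[_ /= ->].
Qed.

(** The update [dfwith] respects the dependent type of the coordinates. The definition stays
    transparent, so coordinates are found by computation. *)
Definition l2_in n (v : V n) : L.
Proof.
apply: (@L2Sum _ _ _ (dfwith (fun m => 0 : V m) n v)).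
have [||c _] := @series_bounded_cvg _
    (fun m => rnorm (dfwith (fun m => 0 : V m) n v m) ^+ 2) (rnorm v ^+ 2).
- by move=> m; exact: sqr_ge0.
- move=> N; have [nN|Nn] := ltnP n N.
    rewrite (bigD1_seq n) /= ?mem_index_iota ?iota_uniq //= dfwithin.
    rewrite big1 ?addr0 // => m mn; rewrite dfwithout ?rnorm0 ?expr0n //.
    by rewrite eq_sym.
  rewrite big_nat big1 ?sqr_ge0 // => m /andP[_ mN].
  by rewrite dfwithout ?rnorm0 ?expr0n // gtn_eqF // (leq_trans mN).
by rewrite inE.
Defined.

Lemma l2_in_same n (v : V n) : l2fun (l2_in v) n = v.
Proof. exact: dfwithin. Qed.

Lemma l2_in_other n (v : V n) m : n != m -> l2fun (l2_in v) m = 0.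
Proof. by move=> nm; rewrite /l2_in /= dfwithout. Qed.

Lemma l2_in_linear n : linear (@l2_in n).
Proof.
move=> a x y; apply: l2_ext => m; rewrite l2funDE l2funZE /=.
have [<-|nm] := eqVneq n m; first by rewrite !dfwithin.
by rewrite !dfwithout // scaler0 addr0.
Qed.

HB.instance Definition _ n := GRing.isLinear.Build K (V n) L *:%R (@l2_in n)
  (@l2_in_linear n).

Lemma l2_quad_in l k1 k2 k3 n (u w : V n) :
  quad l k1 k2 k3 (l2_in u) (l2_in w) = quad l k1 k2 k3 u w.
Proof.
apply: cvg_unique (@quad_l2_cvg l k1 k2 k3 (l2_in u) (l2_in w)) _ => //.
apply: cvg_near_cst; exists n.+1 => // N /= nN.
rewrite /series /= (bigD1_seq n) /= ?mem_index_iota ?iota_uniq //=.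
rewrite !dfwithin big1 ?addr0 // => m; rewrite eq_sym => mn.
by rewrite !dfwithout // /quad scaler0 addr0 subr0 !rnorm0 expr0n /= !(mulr0, addr0).
Qed.

Lemma rnorm_l2_in n (v : V n) : rnorm (l2_in v) = rnorm v.
Proof.
(* With coefficients 0, 1, 0 the expression [quad] is the squared norm of its first argument. *)
apply: eq_sqr_rnorm; have := @l2_quad_in 0 0 1 0 n v v.
by rewrite /quad !mul0r !add0r !addr0 !mul1r.
Qed.

Lemma l2_trunc_sum N x : l2_trunc N x = \sum_(0 <= n < N) l2_in (l2fun x n).
Proof.
elim: N => [|N IH].
  by rewrite big_nil; apply: l2_ext => m; rewrite l2_restrE.
rewrite big_nat_recr //= -IH; apply: l2_ext => m; rewrite l2funDE !l2_restrE.
rewrite ltnS leq_eqVlt.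
have [->|mN] := eqVneq m N; first by rewrite ltnn /= dfwithin add0r.
by rewrite /= dfwithout ?addr0 // eq_sym.
Qed.

Lemma l2_trunc_span N : (forall n, fin_span [set: V n]) ->
  fin_span [set l2_trunc N x | x in [set: L]].
Proof.
move=> Vs; elim: N => [|N IH].
  exists 0%N, (fun=> 0) => _ [x _ <-]; exists (fun=> 0).
  by rewrite l2_trunc_sum !big_nil.
apply: fin_span_sub (fin_span_add IH (fin_span_image (@l2_in N : {linear _ -> _}) (Vs N))).
move=> _ [x _ <-]; exists (l2_trunc N x), (l2_in (l2fun x N)); split.
- by exists x.
- by exists (l2fun x N).
by rewrite !l2_trunc_sum big_nat_recr.
Qed.

End L2Facts.

(** * Rigidity of isometries between block sums *)

Lemma double_cancel (R : realFieldType) (a b : R) : a + (a + b) = b -> a = 0.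
Proof. lra. Qed.

Section BlockRigidity.
Variables (R : realType) (k : scalar_kind).
Local Notation K := (scalars R k).
Variables (V : nat -> completeNormedModType K) (M : completeNormedModType K).
Local Notation L := (l2sum V).
Variable T : {linear L -> sum2 L M}.
Hypothesis T_isom : linear_isometry T.
Hypothesis V_fin : forall n, fin_span [set: V n].

Let Tr (x : L) : rnorm (T x) = rnorm x := rnorm_isometry T_isom x.

Let supp (D : pred nat) := [set x : L | forall m, ~~ D m -> l2fun x m = 0].

(** This concerns the image of [x] only; the support of [x] itself is left free, so that the
    property can be summed over basis vectors. *)
Let preserves (D : pred nat) (x : L) := supp D (T x).1 /\ (T x).2 = 0.

Let suppZD D a x y : supp D x -> supp D y -> supp D (a *: x + y).
Proof.
by move=> xD yD m mD; rewrite l2funDE l2funZE xD // yD // scaler0 addr0.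
Qed.

Let supp0 D : supp D 0.
Proof. by move=> m _; exact: l2fun0. Qed.

Let preservesZD D a x y : preserves D x -> preserves D y -> preserves D (a *: x + y).
Proof.
move=> [x1 x2] [y1 y2]; rewrite /preserves linearP; split; first exact: suppZD.
by rewrite /= x2 y2 scaler0 addr0.
Qed.

Let preserves0 D : preserves D 0.
Proof. by rewrite /preserves linear0; split => //; exact: supp0. Qed.

Let preserves_sum D N (x : nat -> L) : (forall i, (i < N)%N -> preserves D (x i)) ->
  preserves D (\sum_(0 <= i < N) x i).
Proof.
elim: N => [|N IH] xD; first by rewrite big_nil; exact: preserves0.
rewrite big_nat_recr //= addrC -[x N]scale1r; apply: preservesZD; first exact: xD.
by apply: IH => i iN; apply: xD; exact: leq_trans iN _.
Qed.

Let preserves_blocks (D : pred nat) N : (forall m, D m -> (m < N)%N) ->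
  (forall m, D m -> forall v : V m, preserves D (l2_in v)) ->
  forall x, supp D x -> preserves D x.
Proof.
move=> DN DT x xD.
have -> : x = \sum_(0 <= n < N) l2_in (l2fun x n).
  rewrite -l2_trunc_sum; apply/esym/l2_restr_id => m mN; apply: xD.
  by apply: contra mN; exact: DN.
apply: preserves_sum => i _; have [Di|/xD->] := boolP (D i); first exact: DT.
by rewrite linear0; exact: preserves0.
Qed.

(** Vectors supported in the finite set [D] form a finite dimensional space, which [T] maps
    injectively into itself, hence onto itself. *)
Let onto_supp (D : pred nat) N : (forall m, D m -> (m < N)%N) ->
  (forall x, supp D x -> preserves D x) ->
  forall y, supp D y -> exists2 x, supp D x & T x = (y, 0).
Proof.
move=> DN DT y yD.
have [n [b bP]] := fin_spanP (l2_trunc_span N V_fin).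
pose f (x : L) := (T x).1.
have flin : linear f by move=> a u v; rewrite /f linearP.
have [| | ||x xD xE] := linear_inj_onto (b := b) (S := supp D) flin _ _ _ _ yD.
- by move=> a u v; exact: suppZD.
- move=> x xD; apply: bP; exists x => //; apply: l2_restr_id => m mN.
  by apply: xD; apply: contra mN; exact: DN.
- by move=> x /DT[].
- move=> x /DT[_ x2] x1; apply: rnorm_eq0; rewrite -Tr.
  by rewrite [T x]surjective_pairing x2 -/(f x) x1 [LHS]rnorm0.
exists x => //; have [_ x2] := DT x xD.
by rewrite [LHS]surjective_pairing x2 -/(f x) xE.
Qed.

(* Vectors with disjoint supports are Pythagorean, and this survives under T:
   subtracting from T x its part supported in D can only decrease the norm. *)
Let disjoint_supp (D : pred nat) :
  (forall y, supp D y -> exists2 x, supp D x & T x = (y, 0)) ->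
  forall x, supp (predC D) x -> supp (predC D) (T x).1.
Proof.
move=> DT x xD m /negPn Dm.
pose g := l2_restr D (T x).1.
have gD : supp D g by move=> n nD; rewrite l2_restrE (negbTE nD).
have [h hD hE] := DT g gD.
have gh : rnorm g = rnorm h.
  rewrite -(Tr h) hE; apply: eq_sqr_rnorm.
  by rewrite sqr_rnorm_sum2 /= rnorm0 expr0n addr0.
have xh : rnorm (x - h) ^+ 2 = rnorm x ^+ 2 + rnorm h ^+ 2.
  rewrite (l2_restr_pythag D (x - h)) linearB /=.
  rewrite (@l2_restr0 _ _ _ D x); last first.
    by move=> n Dn; apply: xD; rewrite /= Dn.
  rewrite (@l2_restr_id _ _ _ D h) // sub0r rnormN opprK subrK addrC //.
have := Tr (x - h); rewrite linearB => Txh.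
have := sqr_rnorm_sum2 (T x - T h); rewrite Txh xh hE /= subr0.
have := sqr_rnorm_sum2 (T x); rewrite Tr (l2_restr_pythag D (T x).1) -/g gh => -> E.
rewrite addrC -addrA in E; have /eqP := double_cancel E; rewrite sqrf_eq0 -gh => /eqP/rnorm_eq0 g0.
have := l2_restrE D (T x).1 m; rewrite -/g g0 Dm => <-.
exact: l2fun0.
Qed.

(** The rank of a block: [p] for [E] and [- q] for [F], so that both inductions run upwards.
    Sublevel sets are finite because the exponents converge to 2 while staying strictly on one side
    of it. *)
Variable kappa : nat -> R.
Hypothesis kappa_fin : forall n, exists N, forall m, kappa m <= kappa n -> (m < N)%N.
(** The expression is at most 0 at the pair [x], [b i], hence also at its image under [T], where it
    is a sum of nonnegative terms over the blocks and [M]. So every term vanishes, and definiteness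
    in [w] removes the components of the image of [b i] in [M] and in the blocks of higher rank. On
    blocks of equal rank only nonnegativity is asked, since components may remain there. *)
Hypothesis local_quad : forall n, exists r (b : nat -> V n),
  (forall v, exists c : nat -> K, v = \sum_(0 <= i < r) c i *: b i) /\
  forall i, (i < r)%N -> exists (x : V n) (l k1 k2 k3 : R),
    [/\ quad l k1 k2 k3 x (b i) <= 0,
      forall m, kappa n <= kappa m -> forall u w : V m, 0 <= quad l k1 k2 k3 u w,
      forall m, kappa n < kappa m -> forall u w : V m,
        quad l k1 k2 k3 u w = 0 -> w = 0 &
      forall u w : M, 0 <= quad l k1 k2 k3 u w /\
        (quad l k1 k2 k3 u w = 0 -> w = 0)].

Let level n := fun m => kappa m == kappa n.
Let below n := fun m => kappa m < kappa n.

Let level_step n :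
  (forall m, below n m -> forall v : V m, preserves (level m) (l2_in v)) ->
  forall v : V n, preserves (level n) (l2_in v).
Proof.
move=> IH.
have [N NP] := kappa_fin n.
have belowN m : below n m -> (m < N)%N by move=> /ltW; exact: NP.
(* Each lower level is mapped into itself by induction, so the finite dimensional sum of all blocks
   below [n] is mapped onto itself. *)
have onto_below y : supp (below n) y ->
    exists2 x, supp (below n) x & T x = (y, 0).
  apply: (onto_supp belowN); apply: (preserves_blocks belowN) => m mn v.
  have [v1 v2] := IH m mn v; split => // i ni; apply: v1.
  by apply: contra ni => /eqP; rewrite /below => ->.
(* Block [n] is disjoint from the blocks below it, hence so is its image. This is why nonnegativity
   of [quad] is only required from the rank of [n] upwards. *)
have above (v : V n) m : kappa m < kappa n -> l2fun (T (l2_in v)).1 m = 0.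
  move=> mn; apply: (disjoint_supp onto_below); last by rewrite /= negbK.
  move=> i /negPn ni; rewrite l2_in_other //.
  by apply: contraTneq ni => ->; rewrite /below ltxx.
have [r [b [bspan bP]]] := local_quad n.
move=> v; have [c ->] := bspan v.
rewrite linear_sum; apply: preserves_sum => i /bP[x [l [k1 [k2 [k3]]]]].
move=> [xb q0 qV qM]; rewrite linearZ /= -[X in preserves _ X]addr0.
apply: preservesZD; last exact: preserves0.
have Q0 m : 0 <= quad l k1 k2 k3 (l2fun (T (l2_in x)).1 m) (l2fun (T (l2_in (b i))).1 m).
  have [nm|mn] := leP (kappa n) (kappa m); first exact: q0.
  by rewrite !above // /quad scaler0 addr0 subr0 !rnorm0 expr0n /= !(mulr0, addr0).
have [M0 M1] := qM (T (l2_in x)).2 (T (l2_in (b i))).2.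
have := quad_isometry l k1 k2 k3 (l2_in x) (l2_in (b i)) T_isom.
rewrite l2_quad_in quad_sum2 => QE.
have QL := quad_l2_ge0 Q0.
split; last by apply: M1; apply/eqP; rewrite eq_le M0 andbT; lra.
move=> m; rewrite /level neq_lt => /orP[|nm]; first exact: above.
apply: (qV m nm (l2fun (T (l2_in x)).1 m)); apply/eqP; rewrite eq_le Q0 andbT.
have := quad_l2_ge m Q0; lra.
Qed.

Let level_preserved n (v : V n) : preserves (level n) (l2_in v).
Proof.
have [N NP] := kappa_fin n.
(* Ranks are real numbers, so the induction is on the number of blocks strictly below [n]. They are
   counted inside ['I_N] for an [N] that stays fixed while [n] decreases. *)
have [c] := ubnP #|[pred m : 'I_N | below n m]|.
elim: c n v NP => // c IH n v NP nc; apply: level_step => m mn w.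
apply: IH => [i im|]; first by apply: NP; exact: le_trans im (ltW mn).
rewrite -ltnS; apply: leq_trans nc; rewrite ltnS; apply: proper_card.
apply/properP; split.
  by apply/fintype.subsetP => i; rewrite !unfold_in => im; exact: lt_trans im mn.
exists (Ordinal (NP m (ltW mn))) => //.
by rewrite unfold_in /= /below ltxx.
Qed.

(** Every block lies in its level, a finite dimensional space that [T] maps onto itself. Truncations
    are dense and the range of an isometry is closed, so both claims extend to the whole sum. *)
Lemma block_rigidity : (forall x, (T x).2 = 0) /\ (forall y, exists x, T x = (y, 0)).
Proof.
split.
  move=> x; apply/rnorm_eq0/eqP; rewrite eq_le rnorm_ge0 andbT.
  apply/ler_addgt0Pr => e e0; rewrite add0r.
  have [N /(_ N (leqnn N)) NP] := l2_trunc_cvg x e0.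
  have T2 : (T (l2_trunc N x)).2 = 0.
    rewrite l2_trunc_sum; have [] // := @preserves_sum predT N
      (fun n => l2_in (l2fun x n)) _.
    by move=> i _; have [_ ?] := level_preserved (l2fun x i); split.
  have -> : (T x).2 = (T (x - l2_trunc N x)).2 by rewrite linearB /= T2 subr0.
  apply: le_trans (ltW NP); rewrite -Tr -ler_sqr ?nnegrE ?rnorm_ge0 //.
  by rewrite [leRHS]sqr_rnorm_sum2 lerDr sqr_ge0.
have onto_in n (v : V n) : exists x, T x = (l2_in v, 0).
  have [N NP] := kappa_fin n.
  have levelN m : level n m -> (m < N)%N by move=> /eqP mn; apply: NP; rewrite mn.
  have [||x _ xE] := onto_supp levelN _ (y := l2_in v).
  - apply: (preserves_blocks levelN) => m mn w.
    have [w1 w2] := level_preserved w; split => // i ni; apply: w1.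
    by apply: contra ni; rewrite /level (eqP mn).
  - by move=> m nm; rewrite l2_in_other //; apply: contra nm => /eqP->; rewrite /level.
  by exists x.
move=> y; apply: isometry_closed_range => // e e0.
have [N /(_ N (leqnn N)) NP] := l2_trunc_cvg y e0.
have /choice[x xE] := fun n => onto_in n (l2fun y n).
exists (\sum_(0 <= n < N) x n).
have TE : T (\sum_(0 <= n < N) x n) = (l2_trunc N y, 0).
  rewrite l2_trunc_sum; elim: N {NP} => [|N IH]; first by rewrite !big_nil linear0.
  rewrite !big_nat_recr //= linearD /= IH xE.
  by congr pair; rewrite /= addr0.
rewrite TE -ltr_sqr ?nnegrE ?rnorm_ge0 ?ltW // sqr_rnorm_sum2 /=.
by rewrite subrr rnorm0 expr0n addr0 ltr_sqr ?nnegrE ?rnorm_ge0 ?ltW.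
Qed.

End BlockRigidity.

(** * Tangent inequalities in one block and in the complement *)

Section ScalarInequalities.
Variable R : realType.
Implicit Types (p q l b : R).

Lemma sqr_powR_root (a b p : R) : 0 <= a -> 0 < p -> a `^ p = b -> a ^+ 2 = b `^ (2 / p).
Proof.
move=> a0 p0 <-; rewrite -powRrM -(powR_mulrn 2 a0); congr (_ `^ _).
by field; rewrite gt_eqF.
Qed.

(** The ratios [1/(1+l)] and [l/(1+l)] lie between 0 and 1, so their powers [p] do not exceed them,
    and they add up to 1. *)
Lemma one_add_powR_le p l : 1 <= p -> 0 <= l -> 1 + l `^ p <= (1 + l) `^ p.
Proof.
move=> p1 l0; have L0 : 0 < 1 + l by lra.
have le1 x : 0 <= x -> x <= 1 + l -> x `^ p <= (1 + l) `^ p * (x / (1 + l)).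
  rewrite le0r => /orP[/eqP->|x0] xl.
    by rewrite powR0 ?mul0r ?mulr0 // gt_eqF // (lt_le_trans _ p1).
  have xE : x `^ p = (1 + l) `^ p * (x / (1 + l)) `^ p.
    rewrite -powRM ?(ltW L0) //; last by rewrite divr_ge0 ?ltW.
    by rewrite mulrCA mulfV ?mulr1 // gt_eqF.
  rewrite xE ler_wpM2l ?powR_ge0 //; apply: ge1r_powR => //.
  by rewrite divr_gt0 //= ler_pdivrMr // mul1r.
have l1 := le1 1 ler01; have ll := le1 l l0.
rewrite powR1 in l1.
have -> : (1 + l) `^ p = (1 + l) `^ p * (1 / (1 + l)) + (1 + l) `^ p * (l / (1 + l)).
  by field; rewrite gt_eqF.
by rewrite lerD // ?l1 ?ll //; lra.
Qed.

Lemma one_add_root_le p l : 1 <= p -> 0 <= l -> (1 + l `^ p) `^ p^-1 <= 1 + l.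
Proof.
move=> p1 l0; have p0 : 0 < p by lra.
have L0 : 0 <= 1 + l by lra.
have := @ge0_ler_powR _ p^-1 _ _ _ _ _ (one_add_powR_le p1 l0).
rewrite -powRrM mulfV ?gt_eqF // powRr1 //; apply.
- by rewrite invr_ge0 ltW.
- by rewrite nnegrE addr_ge0 ?powR_ge0.
- by rewrite nnegrE powR_ge0.
Qed.

Lemma root_one_add_ge p l : 0 < p -> 0 <= l -> l <= (1 + l `^ p) `^ p^-1.
Proof.
move=> p0 l0; have lE : l = (l `^ p) `^ p^-1 by rewrite -powRrM mulfV ?gt_eqF // powRr1.
rewrite {1}lE.
apply: ge0_ler_powR; rewrite ?nnegrE ?powR_ge0 ?invr_ge0 ?(ltW p0) //.
- by rewrite addr_ge0 ?powR_ge0.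
- by rewrite lerDr.
Qed.

(** The witness solves [D l^2 = l^p / 2], and [1 <= D] keeps it below 1. *)
Lemma small_powR (D p : R) : 1 <= D -> p < 2 ->
  exists2 l : R, 0 < l < 1 & D * l ^+ 2 < l `^ p.
Proof.
move=> D1 p2; have s0 : 0 < 2 - p by lra.
have D0 : 0 < 2 * D by lra.
have D20 : 0 < (2 * D)^-1 by rewrite invr_gt0.
have D21 : (2 * D)^-1 < 1 by rewrite invf_lt1 //; lra.
have l0 : 0 < (2 * D)^-1 `^ (2 - p)^-1 by rewrite powR_gt0.
exists ((2 * D)^-1 `^ (2 - p)^-1).
  by rewrite l0 powR_lt1 ?D20 // invr_gt0.
set l := _ `^ _ in l0 *.
have lE : l `^ (2 - p) = (2 * D)^-1.
  by rewrite -powRrM mulVf ?gt_eqF // powRr1 ?ltW.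
have -> : l ^+ 2 = l `^ p * (2 * D)^-1.
  rewrite -lE -powRD; last by apply/implyP => _; rewrite gt_eqF.
  by rewrite subrKC powR_mulrn ?ltW.
rewrite mulrCA gtr_pMr ?powR_gt0 // invfM mulrCA mulfV ?mulr1 ?invf_lt1 ?ltr1n //.
by rewrite gt_eqF //; lra.
Qed.

(** Divide by [l] and let it grow. If [b > 1], the value [(|C|+1)/(b-1)] is already large enough for
    a contradiction. *)
Lemma le1_of_asymptotic b (C : R) : (forall l, 0 < l -> l * b <= C + l) -> b <= 1.
Proof.
move=> bP; rewrite leNgt; apply/negP => b1.
have d0 : 0 < b - 1 by lra.
have l0 : 0 < (`|C| + 1) / (b - 1) by rewrite divr_gt0 // ltr_wpDl.
have := bP _ l0.
have -> : (`|C| + 1) / (b - 1) * b = `|C| + 1 + (`|C| + 1) / (b - 1).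
  by field; rewrite gt_eqF.
rewrite lerD2r; have := ler_norm C; lra.
Qed.

Lemma ge1_of_asymptotic b (C : R) : (forall l, 0 < l -> l <= C + l * b) -> 1 <= b.
Proof.
move=> bP; rewrite leNgt; apply/negP => b1.
have d0 : 0 < 1 - b by lra.
have l0 : 0 < (`|C| + 1) / (1 - b) by rewrite divr_gt0 // ltr_wpDl.
have := bP _ l0.
have -> : (`|C| + 1) / (1 - b) * b = (`|C| + 1) / (1 - b) - (`|C| + 1).
  by field; rewrite gt_eqF.
have := ler_norm C; lra.
Qed.

Lemma lp_pair_up_aux (c t b : R) : 0 < c * t -> b <= 1 ->
  -1 * (2 * (c * (1 + t))) + 2 * c * 1 + 2 * (c * t) * b <= 0.
Proof. nra. Qed.

Lemma lp_pair_down_aux (c t b : R) : 0 < c * t -> 1 <= b ->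
  1 * (2 * (c * (1 + t))) + - (2 * c) * 1 + - (2 * (c * t)) * b <= 0.
Proof. nra. Qed.

End ScalarInequalities.

Section ModulusInequalities.
Variables (R : realType) (k : scalar_kind).
Local Notation K := (scalars R k).
Variable X : completeNormedModType K.
Implicit Types (x y u w : X) (p q s l : R).

(** In the variables [a^2] and [b^2], the function [(a^p + (l b)^p)^(2/p)] is homogeneous of degree
    one. Its partial derivatives at [a = b = 1] are [tangent p l] and [tangent p l * l^p], the
    coefficients of the next two definitions. *)
Let tangent p l : R := (1 + l `^ p) `^ (2 / p - 1).

Let tangent_gt0 p l : 0 < tangent p l.
Proof. by rewrite powR_gt0 // ltr_pwDl ?powR_ge0. Qed.

(** Nonnegativity is (1) with the right side replaced by its tangent plane; [quad_down] is the
    negative of this expression and plays the same role for (3). *)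
Definition quad_up p l := @quad R k l (-1) (2 * tangent p l) (2 * (tangent p l * l `^ p)).

Definition quad_down p l := @quad R k l 1 (- (2 * tangent p l)) (- (2 * (tangent p l * l `^ p))).

(** The bound of [power_sum_le] and the tangent plane agree in the term of [u] and differ in the
    term of [w] by the factor [l^(2(1-p/s))]. The left side is the difference, positive for [w != 0]
    as soon as [l < 1] and [p < s]. *)
Lemma quad_up_ge p s l u w : 0 < l -> 0 < p -> p <= s -> s <= 2 ->
  (forall x y, rnorm (x + y) ^+ 2 + rnorm (x - y) ^+ 2 <=
    2 * (rnorm x `^ s + rnorm y `^ s) `^ (2 / s)) ->
  2 * tangent p l * l `^ p * (1 - l `^ (2 * (1 - p / s))) * rnorm w ^+ 2 <=
  quad_up p l u w.
Proof.
move=> l0 p0 ps s2 /(_ u (real_scalar k l *: w)).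
rewrite rnormZr (ger0_norm (ltW l0)) /quad_up /quad.
have := power_sum_le l0 p0 ps s2 (rnorm_ge0 u) (rnorm_ge0 w); rewrite -/(tangent p l).
move: (rnorm u ^+ 2) (rnorm w ^+ 2) (rnorm (u + _) ^+ 2 + _) (_ `^ (2 / s)) (l `^ p) => a b S P t.
move: (tangent p l) (l `^ _) => c th; clear; nra.
Qed.

Lemma quad_down_ge p s l u w : 0 < l -> s <= p -> 2 <= s ->
  (forall x y, 2 * (rnorm x `^ s + rnorm y `^ s) `^ (2 / s) <=
    rnorm (x + y) ^+ 2 + rnorm (x - y) ^+ 2) ->
  2 * tangent p l * l `^ p * (l `^ (2 * (1 - p / s)) - 1) * rnorm w ^+ 2 <=
  quad_down p l u w.
Proof.
move=> l0 sp s2 /(_ u (real_scalar k l *: w)).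
rewrite rnormZr (ger0_norm (ltW l0)) /quad_down /quad.
have := power_sum_ge l0 sp s2 (rnorm_ge0 u) (rnorm_ge0 w); rewrite -/(tangent p l).
move: (rnorm u ^+ 2) (rnorm w ^+ 2) (rnorm (u + _) ^+ 2 + _) (_ `^ (2 / s)) (l `^ p) => a b S P t.
move: (tangent p l) (l `^ _) => c th; clear; nra.
Qed.

(** For [p < 2] the coefficient [tangent p l] is at least 1, so the assumed estimate, which has
    coefficient 1 at [u], leaves only the comparison of [l^p] with [D l^2]. *)
Lemma quad_up_flat p l (D : R) u w : 0 < p -> p < 2 ->
  0 <= quad l (-1) 2 (2 * (D * l ^+ 2)) u w ->
  2 * (l `^ p - D * l ^+ 2) * rnorm w ^+ 2 <= quad_up p l u w.
Proof.
move=> p0 p2; have c1 : 1 <= tangent p l.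
  rewrite /tangent -[leLHS](powRr0 (1 + l `^ p)) ler_powR ?lerDl ?powR_ge0 //.
  by rewrite subr_ge0 ler_pdivlMr // mul1r ltW.
rewrite /quad_up /quad.
have := powR_ge0 l p; have := sqr_ge0 (rnorm u); have := sqr_ge0 (rnorm w).
move: c1; move: (tangent p l) (l `^ p) (rnorm u ^+ 2) (rnorm w ^+ 2) => c t a b.
move: (_ + rnorm _ ^+ 2) (D * l ^+ 2) => S d c1 b0 a0 t0.
have c0 : 0 <= c - 1 by rewrite subr_ge0.
have := mulr_ge0 (mulr_ge0 c0 t0) b0; have := mulr_ge0 c0 a0; clear; lra.
Qed.

(** For [p > 2] the coefficient [tangent p l] is at most 1, and the exact parallelogram law leaves
    the comparison of [l^2] with [l^p]. *)
Lemma quad_down_flat p l u w : 2 < p -> parallelogram X ->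
  2 * (l ^+ 2 - l `^ p) * rnorm w ^+ 2 <= quad_down p l u w.
Proof.
move=> p2 /(_ u (real_scalar k l *: w)); rewrite rnormZr exprMn real_normK ?num_real //.
have c1 : tangent p l <= 1.
  rewrite /tangent -[leRHS](powRr0 (1 + l `^ p)) ler_powR ?lerDl ?powR_ge0 //.
  by rewrite subr_le0 ler_pdivrMr ?mul1r ?ltW //; lra.
rewrite /quad_down /quad => ->.
have := powR_ge0 l p; have := sqr_ge0 (rnorm u); have := sqr_ge0 (rnorm w).
move: c1; move: (tangent p l) (l `^ p) (rnorm u ^+ 2) (rnorm w ^+ 2) => c t a b.
move: (l ^+ 2) => d c1 b0 a0 t0.
have c0 : 0 <= 1 - c by rewrite subr_ge0.
have := mulr_ge0 (mulr_ge0 c0 t0) b0; have := mulr_ge0 c0 a0; clear; lra.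
Qed.

Lemma gap_ge0 (g Q : R) w : 0 <= g -> g * rnorm w ^+ 2 <= Q -> 0 <= Q.
Proof. by move=> g0; apply: le_trans; exact: mulr_ge0 g0 (sqr_ge0 _). Qed.

Lemma gap_eq0 (g Q : R) w : 0 < g -> g * rnorm w ^+ 2 <= Q -> Q = 0 -> w = 0.
Proof.
move=> g0 gQ Q0; move: gQ; rewrite Q0 (pmulr_rle0 _ g0) => w0; apply/rnorm_eq0/eqP.
by rewrite -sqrf_eq0 eq_le w0 sqr_ge0.
Qed.

Lemma quad_up_block p s l u w : 0 < l < 1 -> 0 < p -> p <= s -> s <= 2 ->
  (forall x y, rnorm (x + y) ^+ 2 + rnorm (x - y) ^+ 2 <=
    2 * (rnorm x `^ s + rnorm y `^ s) `^ (2 / s)) ->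
  0 <= quad_up p l u w /\ (p < s -> quad_up p l u w = 0 -> w = 0).
Proof.
move=> /andP[l0 l1] p0 ps s2 Xs.
have s0 : 0 < s := lt_le_trans p0 ps.
have Q := quad_up_ge u w l0 p0 ps s2 Xs.
have g0 : 0 < 2 * tangent p l * l `^ p.
  exact: mulr_gt0 (mulr_gt0 (ltr0Sn R 1) (tangent_gt0 p l)) (powR_gt0 p l0).
split.
  apply: gap_ge0 Q; apply: mulr_ge0 (ltW g0) _; rewrite subr_ge0.
  rewrite -[leRHS](powRr0 l); apply: ger_powR; first by rewrite l0 ltW.
  by rewrite pmulr_rge0 // subr_ge0 ler_pdivrMr // mul1r.
move=> sp; apply: gap_eq0 Q; apply: mulr_gt0 g0 _; rewrite subr_gt0.
apply: powR_lt1; first by rewrite l0.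
by rewrite pmulr_rgt0 // subr_gt0 ltr_pdivrMr // mul1r.
Qed.

Lemma quad_down_block p s l u w : 0 < l < 1 -> s <= p -> 2 <= s ->
  (forall x y, 2 * (rnorm x `^ s + rnorm y `^ s) `^ (2 / s) <=
    rnorm (x + y) ^+ 2 + rnorm (x - y) ^+ 2) ->
  0 <= quad_down p l u w /\ (s < p -> quad_down p l u w = 0 -> w = 0).
Proof.
move=> /andP[l0 l1] sp s2 Xs.
have s0 : 0 < s := lt_le_trans (ltr0Sn R 1) s2.
have Q := quad_down_ge u w l0 sp s2 Xs.
have g0 : 0 < 2 * tangent p l * l `^ p.
  exact: mulr_gt0 (mulr_gt0 (ltr0Sn R 1) (tangent_gt0 p l)) (powR_gt0 p l0).
split.
  apply: gap_ge0 Q; apply: mulr_ge0 (ltW g0) _; rewrite subr_ge0.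
  rewrite -[leLHS](powRr0 l); apply: ger_powR; first by rewrite l0 ltW.
  by rewrite pmulr_rle0 // subr_le0 ler_pdivlMr // mul1r.
move=> ps; apply: gap_eq0 Q; apply: mulr_gt0 g0 _; rewrite subr_gt0.
apply: powR_gt1; first by rewrite l0.
by rewrite pmulr_rlt0 // subr_lt0 ltr_pdivlMr // mul1r.
Qed.

Section LpPair.
Variables (p : R) (x y : X).
Hypothesis p1 : 1 <= p.
Hypothesis xy : forall l : R, rnorm (x + real_scalar k l *: y) `^ p = 1 + `|l| `^ p.

Let p0 : 0 < p. Proof. exact: lt_le_trans p1. Qed.

Let rnorm_x : rnorm x = 1.
Proof.
have := xy 0; rewrite real_scalar0 scale0r addr0 normr0 powR0 ?gt_eqF // addr0.
move=> /(sqr_powR_root (rnorm_ge0 x) p0); rewrite powR1 => /eqP.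
by rewrite -[1](expr1n _ 2) eqrXn2 ?rnorm_ge0 // expr1n => /eqP.
Qed.

Let sqr_xly l : rnorm (x + real_scalar k l *: y) ^+ 2 = (1 + `|l| `^ p) `^ (2 / p).
Proof. exact: sqr_powR_root (rnorm_ge0 _) p0 (xy l). Qed.

Let rnorm_xly l : 0 < l -> rnorm (x + real_scalar k l *: y) = (1 + l `^ p) `^ p^-1.
Proof.
move=> l0; have := xy l; rewrite (ger0_norm (ltW l0)) => <-.
by rewrite -powRrM (mulfV (lt0r_neq0 p0)) (powRr1 (rnorm_ge0 _)).
Qed.

(** The hypothesis on the pair gives the norm of [y] only through large [l]:
    [l |y| <= |x| + |x + l y| <= 2 + l]. *)
Lemma lp_pair_le1 : rnorm y <= 1.
Proof.
apply: (@le1_of_asymptotic _ _ 2) => l l0.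
rewrite -[l in l * _](ger0_norm (ltW l0)) -(rnormZr l y) -[_ *: y](addKr x) addrC.
apply: le_trans (rnormB _ _) _; rewrite rnorm_x rnorm_xly //.
have := one_add_root_le p1 (ltW l0); lra.
Qed.

Lemma lp_pair_ge1 : 1 <= rnorm y.
Proof.
apply: (@ge1_of_asymptotic _ _ 1) => l l0.
rewrite -[X in X * rnorm y](ger0_norm (ltW l0)) -(rnormZr l y).
apply: le_trans (root_one_add_ge p0 (ltW l0)) _.
by rewrite -rnorm_xly // -rnorm_x rnormD.
Qed.

Let sqr_pair l : 0 < l ->
  rnorm (x + real_scalar k l *: y) ^+ 2 + rnorm (x - real_scalar k l *: y) ^+ 2 =
  2 * (tangent p l * (1 + l `^ p)).
Proof.
move=> l0; rewrite -scaleNr -real_scalarN !sqr_xly normrN ger0_norm ?ltW //.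
have W : 0 <= 1 + l `^ p by rewrite addr_ge0 ?powR_ge0.
have := mulr_powRB1 W (divr_gt0 (ltr0Sn R 1) p0); rewrite /tangent mulrC => ->.
by rewrite [RHS]mulr_natl [RHS]mulr2n.
Qed.

(** The pair sits at the point of tangency, where the tangent plane takes the value of the
    function. *)
Lemma lp_pair_quad_up l : 0 < l -> quad_up p l x y <= 0.
Proof.
move=> l0; rewrite /quad_up /quad sqr_pair // rnorm_x expr1n.
apply: lp_pair_up_aux; first exact: mulr_gt0 (tangent_gt0 p l) (powR_gt0 p l0).
by rewrite expr_le1 ?rnorm_ge0 ?lp_pair_le1.
Qed.

Lemma lp_pair_quad_down l : 0 < l -> quad_down p l x y <= 0.
Proof.
move=> l0; rewrite /quad_down /quad sqr_pair // rnorm_x expr1n.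
apply: lp_pair_down_aux; first exact: mulr_gt0 (tangent_gt0 p l) (powR_gt0 p l0).
by rewrite expr_ge1 ?rnorm_ge0 ?lp_pair_ge1.
Qed.

End LpPair.
End ModulusInequalities.

Section SummandOrthogonality.
Variables (R : realType) (k : scalar_kind).
Local Notation K := (scalars R k).
Variables (A B H : completeNormedModType K).
Local Notation X := (sum2 A B).
Local Notation Y := (sum2 X H).

Let sqr_rnorm3 (z : Y) :
  rnorm z ^+ 2 = rnorm z.1.1 ^+ 2 + (rnorm z.1.2 ^+ 2 + rnorm z.2 ^+ 2).
Proof. by rewrite !sqr_rnorm_sum2 addrA. Qed.

(** Let [T (e, 0)] be the first component of [T (0, b)]. The squared norm of [T (0, b) - T (e, 0)]
    is [|b|^2 + |e|^2] in the source, but [|b|^2 - |e|^2] in the target, where the first component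
    has been removed. Hence [e = 0]. *)
Lemma sum2_orthogonal (T : {linear X -> Y}) : linear_isometry T ->
  (forall y, exists x, T (x, 0) = ((y, 0), 0)) -> forall b, (T (0, b)).1.1 = 0.
Proof.
move=> /rnorm_isometry Tr onto b; have [e eE] := onto (T (0, b)).1.1.
have E1 := sqr_rnorm3 (T (0, b)).
have E2 := sqr_rnorm3 (T (0, b) - T (e, 0)).
have E3 := sqr_rnorm3 (T (e, 0)).
rewrite -linearB !Tr !sqr_rnorm_sum2 !linearB eE /= in E1 E2 E3.
rewrite !(subrr, subr0, sub0r, rnorm0, rnormN, expr0n) /= in E1 E2 E3.
apply/rnorm_eq0/eqP; rewrite -sqrf_eq0; apply/eqP.
rewrite !(add0r, addr0) in E1 E2 E3; rewrite E3 E1 in E2.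
exact: double_cancel E2.
Qed.

End SummandOrthogonality.

Section Rigidity.
Variables (R : realType) (k : scalar_kind).
Local Notation K := (scalars R k).

Lemma basis_coef (V : vectType K) (B : seq V) : basis_of fullv B ->
  forall v, exists c : nat -> K, v = \sum_(0 <= i < size B) c i *: B`_i.
Proof.
move=> Bb v; have := coord_basis (X := in_tuple B) Bb (memvf v) => vE.
exists (fun i => if insub i is Some j then coord (in_tuple B) j v else 0).
rewrite big_mkord {1}vE; apply: eq_bigr => i _.
by rewrite valK.
Qed.

Lemma cvg_above_fin (p : nat -> R) (a b : R) : p @ \oo --> b -> a < b ->
  exists N, forall m, p m <= a -> (m < N)%N.
Proof.
move=> pb ab; have ab0 : 0 < b - a by rewrite subr_gt0.
have /cvgrPdist_lt /(_ _ ab0)[N _ NP] := pb.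
exists N => m pm; rewrite ltnNge; apply/negP => /NP /=.
by rewrite ltNge => /negP; apply; rewrite (le_trans _ (ler_norm _)) // lerB.
Qed.

Variables (E F : nat -> finDimBanachType K) (p q : nat -> R).
Hypothesis p_range : forall n, 1 <= p n < 2.
Hypothesis p_cvg : p @ \oo --> (2 : R).
Hypothesis q_range : forall n, 2 < q n.
Hypothesis q_cvg : q @ \oo --> (2 : R).
Hypothesis E_ineq : forall n (x y : E n),
  rnorm (x + y) ^+ 2 + rnorm (x - y) ^+ 2 <=
    2 * (rnorm x `^ p n + rnorm y `^ p n) `^ (2 / p n).
Hypothesis E_basis : forall n, exists B : seq (E n), basis_of fullv B /\
  forall y, y \in B -> exists2 x, x \in B &
    forall l : R, rnorm (x + real_scalar k l *: y) `^ p n = 1 + `|l| `^ p n.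
Hypothesis F_ineq : forall n (x y : F n),
  rnorm (x + y) ^+ 2 + rnorm (x - y) ^+ 2 >=
    2 * (rnorm x `^ q n + rnorm y `^ q n) `^ (2 / q n).
Hypothesis F_basis : forall n, exists B : seq (F n), basis_of fullv B /\
  forall y, y \in B -> exists2 x, x \in B &
    forall l : R, rnorm (x + real_scalar k l *: y) `^ q n = 1 + `|l| `^ q n.
Hypothesis F_bound : exists C : R, forall n (x y : F n),
  rnorm (x + y) ^+ 2 + rnorm (x - y) ^+ 2 <=
    2 * (rnorm x ^+ 2 + rnorm (real_scalar k C *: y) ^+ 2).

Local Notation l2E := (l2sum (fun n => E n : completeNormedModType K)).
Local Notation l2F := (l2sum (fun n => F n : completeNormedModType K)).

Lemma fin_span_finDim (V : finDimBanachType K) : fin_span [set: V].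
Proof.
have [c cP] := choice (basis_coef (vbasisP (fullv : {vspace V}))).
by exists (size (vbasis (fullv : {vspace V}))), (nth 0 (vbasis fullv)) => x _;
  exists (c x).
Qed.

Lemma E_rigid (H : completeNormedModType K) (T : {linear l2E -> sum2 l2E (sum2 l2F H)}) :
  parallelogram H -> linear_isometry T ->
  (forall x, (T x).2 = 0) /\ (forall y, exists x, T x = (y, 0)).
Proof.
move=> Hpar Ti; apply: (@block_rigidity _ _ _ _ T Ti _ p) => [n|n|n].
- exact: fin_span_finDim.
- by apply: cvg_above_fin p_cvg _; case/andP: (p_range n).
have /andP[pn1 pn2] := p_range n.
have pn0 : 0 < p n := lt_le_trans ltr01 pn1.
have [B [Bb BP]] := E_basis n.
exists (size B), (nth 0 B); split; first exact: basis_coef.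
move=> i iB; have [x _ xy] := BP _ (mem_nth 0 iB).
have [C CP] := F_bound.
(* The complement of [E] has two kinds of summands: the blocks of [F] satisfy the flat estimate with
   constant [C ^+ 2], and [H] with constant 1. *)
have D1 : 1 <= Num.max (C ^+ 2) 1 by rewrite le_max lexx orbT.
have [l l01 lD] := small_powR D1 pn2; have /andP[l0 _] := l01.
set D := Num.max _ _ in D1 lD.
have flat (X : completeNormedModType K) (d : R) : d <= D ->
    (forall x y : X, rnorm (x + y) ^+ 2 + rnorm (x - y) ^+ 2 <=
      2 * (rnorm x ^+ 2 + d * rnorm y ^+ 2)) ->
    forall u w : X, 0 <= quad l (-1) 2 (2 * (D * l ^+ 2)) u w.
  move=> dD XP u w; have := XP u (real_scalar k l *: w).
  rewrite rnormZr exprMn real_normK ?num_real // /quad.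
  have : d * (l ^+ 2 * rnorm w ^+ 2) <= D * (l ^+ 2 * rnorm w ^+ 2).
    by rewrite ler_wpM2r // mulr_ge0 ?sqr_ge0.
  move: (rnorm u ^+ 2) (l ^+ 2) (rnorm w ^+ 2) (rnorm (u + _) ^+ 2 + _).
  by move=> a t b S; nra.
exists x, l.
eexists (-1), _, _; split.
- exact: lp_pair_quad_up pn1 xy l l0.
- move=> m pm u w; have pm2 : p m <= 2 by apply: ltW; case/andP: (p_range m).
  by case: (quad_up_block u w l01 pn0 pm pm2 (@E_ineq m)).
- move=> m pm u w; have pm2 : p m <= 2 by apply: ltW; case/andP: (p_range m).
  by case: (quad_up_block u w l01 pn0 (ltW pm) pm2 (@E_ineq m)) => _; apply.
move=> u w.
have lower : 2 * (l `^ p n - D * l ^+ 2) * rnorm w ^+ 2 <= quad_up (p n) l u w.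
  apply: quad_up_flat => //; rewrite quad_sum2; apply: addr_ge0.
    apply: quad_l2_ge0 => m; apply: (flat _ (C ^+ 2)); first by rewrite le_max lexx.
    move=> a b; apply: le_trans (CP m a b) _.
    by rewrite rnormZr exprMn real_normK ?num_real.
  by apply: (flat _ 1) => // a b; rewrite mul1r Hpar.
have gap : 0 < 2 * (l `^ p n - D * l ^+ 2) by rewrite pmulr_rgt0 // subr_gt0.
by split; [exact: gap_ge0 (ltW gap) lower|exact: gap_eq0 gap lower].
Qed.

Lemma F_rigid (H : completeNormedModType K) (T : {linear l2F -> sum2 l2F H}) :
  parallelogram H -> linear_isometry T ->
  (forall x, (T x).2 = 0) /\ (forall y, exists x, T x = (y, 0)).
Proof.
move=> Hpar Ti; apply: (@block_rigidity _ _ _ _ T Ti _ (fun n => - q n)) => [n|n|n].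
- exact: fin_span_finDim.
- apply: (@cvg_above_fin _ _ (- 2)); first exact: cvgN.
  by rewrite ltrN2.
have qn0 : 0 < q n := lt_trans (ltr0Sn R 1) (q_range n).
have [B [Bb BP]] := F_basis n.
exists (size B), (nth 0 B); split; first exact: basis_coef.
move=> i iB; have [x _ xy] := BP _ (mem_nth 0 iB).
have q1 : 1 <= q n by apply: le_trans (ltW (q_range n)); rewrite ler1n.
(* Any value strictly between 0 and 1 would do: the complement satisfies the exact parallelogram
   law, and [q n > 2] gives [l^(q n) < l^2]. *)
pose l : R := 2^-1.
have l0 : 0 < l by rewrite invr_gt0.
have l01 : 0 < l < 1 by rewrite l0 invf_lt1 // ltr1n.
exists x, l.
eexists 1, _, _; split.
- exact: lp_pair_quad_down q1 xy l l0.
- move=> m; rewrite lerN2 => qm u w.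
  by case: (quad_down_block u w l01 qm (ltW (q_range m)) (@F_ineq m)).
- move=> m; rewrite ltrN2 => qm u w.
  by case: (quad_down_block u w l01 (ltW qm) (ltW (q_range m)) (@F_ineq m)) => _; apply.
move=> u w.
have lower := quad_down_flat l u w (q_range n) Hpar.
have gap : 0 < 2 * (l ^+ 2 - l `^ q n).
  rewrite pmulr_rgt0 // subr_gt0 -(subrKC 2 (q n)) powRD; last first.
    by apply/implyP => _; rewrite gt_eqF.
  rewrite (powR_mulrn 2 (ltW l0)) gtr_pMr ?exprn_gt0 //.
  by apply: powR_lt1 => //; rewrite subr_gt0.
by split; [exact: gap_ge0 (ltW gap) lower|exact: gap_eq0 gap lower].
Qed.

Local Notation X := (sum2 l2E l2F).

Lemma sum_rigid (H : completeNormedModType K) (T : {linear X -> sum2 X H}) :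
  parallelogram H -> linear_isometry T ->
  [/\ forall x, exists y, T (x, 0) = ((y, 0), 0),
      forall y, exists x, T (x, 0) = ((y, 0), 0),
      forall x, exists y, T (0, x) = ((0, y), 0) &
      forall y, exists x, T (0, x) = ((0, y), 0)].
Proof.
move=> Hpar Ti; have Tr := rnorm_isometry Ti.
(* The target is reassociated so that [F] and [H] together form the complement of [E]. *)
pose fE (x : l2E) : sum2 l2E (sum2 l2F H) :=
  ((T ((x, 0) : X)).1.1, ((T ((x, 0) : X)).1.2, (T ((x, 0) : X)).2)).
have fE_lin : linear fE.
  move=> a x y; rewrite /fE.
  have -> : ((a *: x + y, 0) : X) = a *: ((x, 0) : X) + (y, 0).
    by congr pair; rewrite /= scaler0 addr0.
  by rewrite linearP.
have [TE TEE] := linear_pack fE_lin.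
have TE_isom : linear_isometry TE.
  apply: isometry_rnorm => x; apply: eq_sqr_rnorm; rewrite TEE /fE.
  rewrite !sqr_rnorm_sum2 /= addrA -!sqr_rnorm_sum2 Tr sqr_rnorm_sum2 /=.
  by rewrite rnorm0 expr0n addr0.
have [E2 Eonto] := E_rigid Hpar TE_isom.
have TE0 x : T (x, 0) = (((T (x, 0)).1.1, 0), 0).
  have := E2 x; rewrite TEE => -[e2 e3].
  by rewrite [LHS]surjective_pairing e3 [(T _).1]surjective_pairing e2.
have TEonto y : exists x, T (x, 0) = ((y, 0), 0).
  by have [x] := Eonto y; rewrite TEE => -[e1 e2 e3]; exists x; rewrite TE0 e1.
(* The copy of [E] in the target is already filled by the image of [E]. Vectors of [F] therefore
   have no component there, and dropping it leaves an isometry into [F] plus [H]. *)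
have TF1 := sum2_orthogonal Ti TEonto.
pose fF (x : l2F) : sum2 l2F H := ((T ((0, x) : X)).1.2, (T ((0, x) : X)).2).
have fF_lin : linear fF.
  move=> a x y; rewrite /fF.
  have -> : ((0, a *: x + y) : X) = a *: ((0, x) : X) + (0, y).
    by congr pair; rewrite /= scaler0 addr0.
  by rewrite linearP.
have [TF TFE] := linear_pack fF_lin.
have TF_isom : linear_isometry TF.
  apply: isometry_rnorm => x; apply: eq_sqr_rnorm; rewrite TFE /fF.
  have := congr1 (fun a => a ^+ 2) (Tr (0, x)).
  by rewrite !sqr_rnorm_sum2 /= TF1 rnorm0 expr0n !add0r => <-.
have [F2 Fonto] := F_rigid Hpar TF_isom.
have TF0 x : T (0, x) = ((0, (T (0, x)).1.2), 0).
  have e2 : (T (0, x)).2 = 0 by have := F2 x; rewrite TFE.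
  by rewrite [LHS]surjective_pairing e2 [(T _).1]surjective_pairing TF1.
split=> //.
- by move=> x; exists (T (x, 0)).1.1.
- by move=> x; exists (T (0, x)).1.2.
- by move=> y; have [x] := Fonto y; rewrite TFE => -[e1 e2]; exists x; rewrite TF0 e1.
Qed.

End Rigidity.

(** * Parallelogram law and inner products *)

(** Since [g 1 = 0], the function has period 1 and is bounded everywhere; a nonzero value would have
    unbounded multiples. *)
Lemma additive_bounded_eq0 (R : realType) (g : R -> R) (B : R) :
  (forall s t, g (s + t) = g s + g t) -> g 1 = 0 ->
  (forall s, 0 <= s <= 1 -> `|g s| <= B) -> forall t, g t = 0.
Proof.
move=> gD g1 gB.
have g0 : g 0 = 0 by have := gD 0 0; rewrite addr0; set a := g 0; lra.
have gMn t n : g (t *+ n) = g t *+ n.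
  by elim: n => [|n IH]; rewrite ?mulr0n // !mulrS gD IH.
have gN t : g (- t) = - g t.
  by apply/eqP; rewrite -addr_eq0 -gD addNr g0.
have gpos t : 0 <= t -> `|g t| <= B.
  move=> t0; have /andP[t1 t2] := truncn_itv t0.
  rewrite -(subrKC (Num.truncn t)%:R t) gD gMn g1 mul0rn add0r; apply: gB.
  by rewrite subr_ge0 t1 lerBlDl natr1 ltW.
have gall t : `|g t| <= B.
  have [|t0] := leP 0 t; first exact: gpos.
  by rewrite -normrN -gN gpos // oppr_ge0 ltW.
move=> t; apply/eqP; rewrite -normr_le0 leNgt; apply/negP => gt0.
have := gall (t *+ (Num.truncn (B / `|g t|)).+1).
rewrite gMn normrMn -mulr_natr leNgt => /negP; apply.
by rewrite mulrC -ltr_pdivrMr // truncnS_gt.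
Qed.

Section JordanVonNeumann.
Variables (R : realType) (k : scalar_kind).
Local Notation K := (scalars R k).
Variable X : completeNormedModType K.
Hypothesis Xpar : parallelogram X.
Implicit Types x y z : X.

Definition re_ip x y : R := (rnorm (x + y) ^+ 2 - rnorm (x - y) ^+ 2) / 4.

Lemma re_ipC x y : re_ip x y = re_ip y x.
Proof. by rewrite /re_ip (addrC x) rnormBC. Qed.

Lemma re_ipNl x y : re_ip (- x) y = - re_ip x y.
Proof.
by rewrite /re_ip -opprD rnormN (addrC (- x)) rnormBC -[RHS]mulNr opprB.
Qed.

Let re_ip_aux (a b c d e f g h s t : R) : a + b = 2 * (s + t) -> a + c = 2 * (g + h) ->
  d + c = 2 * (e + t) -> d + b = 2 * (f + h) ->
  (a - d) / 4 = (s - e) / 4 + (g - f) / 4.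
Proof. lra. Qed.

(** In the four instances of the parallelogram law the norms of [x + z - y], [y + z - x], [x] and
    [y] cancel, and what remains is additivity. *)
Lemma re_ipDl x y z : re_ip (x + y) z = re_ip x z + re_ip y z.
Proof.
have P1 := Xpar (x + z) y; have P2 := Xpar (y + z) x.
have P3 := Xpar (x - z) y; have P4 := Xpar (y - z) x.
apply: (@re_ip_aux _ (rnorm (x + z - y) ^+ 2) (rnorm (y + z - x) ^+ 2) _ _ _ _
  (rnorm x ^+ 2) _ (rnorm y ^+ 2)).
- by rewrite -P1 addrAC.
- by rewrite -P2 [y + z + x]addrC addrA.
- by rewrite -P3 -(rnormN (x - z - y)) opprB opprB (addrA y z) (addrAC x y).
- by rewrite -P4 -(rnormN (y - z - x)) opprB opprB (addrA x z) (addrC (y - z)) (addrA x y).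
Qed.

Lemma re_ipDr x y z : re_ip x (y + z) = re_ip x y + re_ip x z.
Proof. by rewrite re_ipC re_ipDl !(re_ipC x). Qed.

Lemma re_ip_bound x y : `|re_ip x y| <= rnorm x * (rnorm x + rnorm y).
Proof.
rewrite /re_ip normrM (@ger0_norm _ 4^-1) // ler_pdivrMr // subr_sqr normrM.
rewrite [X in _ * X]ger0_norm ?addr_ge0 ?rnorm_ge0 //.
have -> : rnorm x * (rnorm x + rnorm y) * 4 =
  (2 * rnorm x) * ((rnorm x + rnorm y) + (rnorm x + rnorm y)) by ring.
apply: ler_pM => //; first by rewrite addr_ge0 ?rnorm_ge0.
  rewrite (rnormBC x) (addrC x); apply: le_trans (rnorm_lip _ _) _.
  have -> : y + x - (y - x) = x + x by rewrite opprB [LHS]addrC addrA subrK.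
  by rewrite mulr_natl mulr2n rnormD.
by rewrite lerD ?rnormD ?rnormB.
Qed.

(** The defect of homogeneity is additive in [t], vanishes at 1 and is bounded on the unit interval,
    hence it is zero. *)
Lemma re_ipZl (t : R) x y : re_ip (real_scalar k t *: x) y = t * re_ip x y.
Proof.
apply/eqP; rewrite -subr_eq0; apply/eqP.
apply: (@additive_bounded_eq0 R (fun t => re_ip (real_scalar k t *: x) y - t * re_ip x y)
  (rnorm x * (rnorm x + rnorm y) + `|re_ip x y|)).
- by move=> a b; rewrite real_scalarD scalerDl re_ipDl; ring.
- by rewrite real_scalar1 scale1r mul1r subrr.
move=> a /andP[a0 a1]; apply: le_trans (ler_normB _ _) _.
have ax : rnorm (real_scalar k a *: x) <= rnorm x.
  by rewrite rnormZr ger0_norm // ler_piMl ?rnorm_ge0.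
rewrite lerD //.
  apply: le_trans (re_ip_bound _ _) _; apply: ler_pM; rewrite ?addr_ge0 ?rnorm_ge0 //.
  by rewrite lerD2r.
by rewrite normrM ger0_norm // ler_piMl.
Qed.

Lemma re_ip_unit (a : K) x y : rnorm a = 1 -> re_ip (a *: x) (a *: y) = re_ip x y.
Proof. by move=> a1; rewrite /re_ip -scalerDr -scalerBr !rnormZ a1 !mul1r. Qed.

Lemma re_ip_rot (a : K) x y : rnorm a = 1 -> a *: (a *: x) = - x ->
  re_ip (a *: x) y = - re_ip x (a *: y).
Proof. by move=> a1 aa; rewrite -(re_ip_unit _ _ a1) aa re_ipNl. Qed.

Lemma re_ipxx x : re_ip x x = rnorm x ^+ 2.
Proof.
rewrite /re_ip subrr rnorm0 expr0n subr0.
have -> : x + x = real_scalar k (1 + 1) *: x.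
  by rewrite real_scalarD real_scalar1 scalerDl scale1r.
by rewrite rnormZr (@ger0_norm _ (1 + 1)) ?addr_ge0 // exprMn; field.
Qed.

Lemma is_hilbert_form (f : X -> X -> K) :
  (forall a x y z, f (a *: x + y) z = a * f x z + f y z) ->
  (forall x y, f x y = scalar_conj (f y x)) ->
  (forall x, f x x = `|x| ^+ 2) -> is_hilbert X.
Proof.
move=> fl fc fn.
have cD (a b : K) : scalar_conj (a + b) = scalar_conj a + scalar_conj b.
  by move: a b; rewrite /scalar_conj; case: (k) => //= a b; rewrite rmorphD.
have cM (a b : K) : scalar_conj (a * b) = scalar_conj a * scalar_conj b.
  by move: a b; rewrite /scalar_conj; case: (k) => //= a b; rewrite rmorphM.
have fr a x y z : f z (a *: x + y) = scalar_conj a * f z x + f z y.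
  by rewrite fc fl cD cM -!fc.
have b1 u : zmod_morphism (f ^~ u).
  by move=> x y; rewrite addrC -scaleN1r fl mulN1r addrC.
have b2 u : zmod_morphism (f u).
  move=> x y; rewrite fc b1 -[- f y u]mulN1r cD cM -!fc; congr (_ + _).
  have : scalar_conj (1 + (- 1)) = 0 :> K.
    have := cD 0 0; rewrite addr0 subrr => /eqP.
    by rewrite -subr_eq subrr eq_sym => /eqP.
  have c1 : scalar_conj 1 = 1 :> K.
    by rewrite /scalar_conj; case: (k) => //=; apply/eqP; rewrite eq_complex /= oppr0 !eqxx.
  by rewrite cD c1 => /eqP; rewrite addrC addr_eq0 => /eqP ->; rewrite mulN1r.
have b3 u : scalable_for *%R (f ^~ u).
  by move=> a x /=; have := fl a x 0 u; rewrite addr0 => ->; rewrite -(subrr x) b1 subrr addr0.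
have b4 u : scalable_for (@scalar_conj R k \; *%R) (f u).
  by move=> a x /=; have := fr a x 0 u; rewrite addr0 => ->; rewrite -(subrr x) b2 subrr addr0.
pose B := @isBilinear.Build K X X K *%R (@scalar_conj R k \; *%R) f b1 b2 b3 b4.
have h x y : f x y = (-1) ^+ false * scalar_conj (f y x) by rewrite expr0 mul1r.
pose He := @isHermitianSesquilinear.Build K X false (@scalar_conj R k) f h.
have d x : x != 0 -> 0 < f x x by move=> x0; rewrite fn exprn_gt0 // normr_gt0.
pose D := @isDotProduct.Build K X f d.
pose ip : {dot X for @scalar_conj R k} := HB.pack f B He D.
by exists ip.
Qed.

End JordanVonNeumann.

Lemma jordan_von_neumann (R : realType) (k : scalar_kind)
  (X : completeNormedModType (scalars R k)) : parallelogram X -> is_hilbert X.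
Proof.
case: k X => X Xpar.
  apply: (@is_hilbert_form R RealScalars X (@re_ip R RealScalars X)).
  - by move=> a x y z; rewrite re_ipDl // (@re_ipZl R RealScalars X Xpar).
  - by move=> x y; exact: re_ipC.
  - by move=> x; rewrite re_ipxx.
have i1 : rnorm (Complex 0 1 : scalars R ComplexScalars) = 1 :> R.
  by rewrite /rnorm /= expr0n expr1n add0r sqrtr1.
set i : scalars R ComplexScalars := Complex 0 1.
have ii (x : X) : i *: (i *: x) = - x.
  rewrite scalerA -scaleN1r; congr (_ *: _); apply/eqP.
  by rewrite eq_complex /= !(mulr0, mul0r, mulr1, addr0, subr0, sub0r, oppr0) !eqxx.
have ri x y : re_ip (i *: x) y = - re_ip x (i *: y) := re_ip_rot y i1 (ii x).
have aE (a : scalars R ComplexScalars) (x : X) :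
    a *: x = real_scalar _ (complex.Re a) *: x + real_scalar _ (complex.Im a) *: (i *: x).
  rewrite scalerA -scalerDl; congr (_ *: _); case: a => a b; apply/eqP.
  by rewrite eq_complex /= !(mulr0, mul0r, mulr1, addr0, subr0, sub0r, add0r) !eqxx.
(* The form is conjugate linear in its second argument, so the imaginary part of its value at [x],
   [y] is the real part of its value at [x], [i y]. *)
apply: (@is_hilbert_form R ComplexScalars X
  (fun x y => Complex (re_ip x y) (re_ip x (i *: y)))).
- move=> a x y z; rewrite (aE a x) !(re_ipDl Xpar) !(re_ipZl Xpar) !ri ii.
  rewrite (re_ipC x (- z)) re_ipNl (re_ipC z x); case: a => a b.
  by apply/eqP; rewrite eq_complex /=; apply/andP; split; apply/eqP; ring.
- move=> x y; apply/eqP; rewrite eq_complex /= (re_ipC x y) eqxx /=.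
  by rewrite (re_ipC x) ri.
move=> x; apply/eqP; rewrite normr_rnorm re_ipxx eq_complex /=.
have : re_ip x (i *: x) = - re_ip x (i *: x) by rewrite -ri re_ipC.
move=> /eqP; rewrite -addr_eq0 -mulr2n mulrn_eq0 /= => /eqP ->.
by rewrite !(mulr0, mul0r, subr0, addr0) expr2 !eqxx.
Qed.

(** * Asymptotically Hilbert spaces *)

Section ClosedSubspace.
Variables (R : realType) (k : scalar_kind).
Local Notation K := (scalars R k).
Variable W : completeNormedModType K.

Record closed_subspace := ClosedSubspace {
  cs_set : set W ;
  cs_lin : forall a x y, cs_set x -> cs_set y -> cs_set (a *: x + y) ;
  cs_0 : cs_set 0 ;
  cs_closed : forall x, (forall e : R, 0 < e -> exists2 y, cs_set y & rnorm (x - y) < e) ->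
    cs_set x }.

Variable S : closed_subspace.

Definition cs_pred (s : closed_subspace) : {pred W} := [pred x | `[< cs_set s x >]].

Let cs_submod (s : closed_subspace) : submod_closed (cs_pred s).
Proof.
split; first by rewrite inE; exact: cs_0.
by move=> a x y; rewrite !inE; exact: cs_lin.
Qed.

HB.instance Definition _ s := GRing.isSubmodClosed.Build K W (cs_pred s) (cs_submod s).

Record csub : Type := CSub { csub_val : W ; csub_valP : csub_val \in cs_pred S }.

HB.instance Definition _ := [isSub for csub_val].
HB.instance Definition _ := [Choice of csub by <:].
HB.instance Definition _ := [SubChoice_isSubLmodule of csub by <:].

Definition csub_norm (x : csub) : K := `|csub_val x|.

Lemma csub_valD (x y : csub) : csub_val (x + y) = csub_val x + csub_val y.
Proof. exact: (raddfD val). Qed.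

Lemma csub_valB (x y : csub) : csub_val (x - y) = csub_val x - csub_val y.
Proof. exact: (raddfB val). Qed.

Lemma csub_valZ (a : K) (x : csub) : csub_val (a *: x) = a *: csub_val x.
Proof. exact: (linearZ_LR val). Qed.

Let csub_normD (x y : csub) : csub_norm (x + y) <= csub_norm x + csub_norm y.
Proof. by rewrite /csub_norm csub_valD ler_normD. Qed.

Let csub_normZ (a : K) (x : csub) : csub_norm (a *: x) = `|a| * csub_norm x.
Proof. by rewrite /csub_norm csub_valZ normrZ. Qed.

Let csub_norm0_eq0 (x : csub) : csub_norm x = 0 -> x = 0.
Proof. by move=> /normr0_eq0 x0; apply: val_inj. Qed.

HB.instance Definition _ := Lmodule_isNormed.Build K csub
  csub_normD csub_normZ csub_norm0_eq0.

Lemma rnorm_csub (x : csub) : rnorm x = rnorm (csub_val x).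
Proof. by []. Qed.

Let csub_complete (F : set_system csub) : ProperFilter F -> cauchy F -> cvg F.
Proof.
apply: fast_cauchy_complete => u uf.
have vf : fast_cauchy (fun n => csub_val (u n)).
  by move=> n; rewrite -csub_valB; exact: uf.
have [l lP] := fast_cauchy_cvg vf.
have lS : l \in cs_pred S.
  rewrite inE; apply: cs_closed => e e0.
  have [n nP] := exp_half_small (divr_gt0 e0 (ltr0Sn R 1)).
  exists (csub_val (u n)); first by have := csub_valP (u n); rewrite inE.
  by apply: le_lt_trans (lP n) _; rewrite mulrC -ltr_pdivlMr // nP.
by exists (CSub lS), 2 => n; rewrite rnorm_csub csub_valB.
Qed.

HB.instance Definition _ := Uniform_isComplete.Build csub csub_complete.

End ClosedSubspace.

Lemma small_eq0 (R : realType) (x c : R) : 0 <= c ->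
  (forall e, 0 < e <= 1 -> `|x| <= e * c) -> x = 0.
Proof.
move=> c0 xc; apply/eqP; rewrite -normr_le0; apply/ler_addgt0Pr => d d0; rewrite add0r.
have c1 : 0 < c + 1 by lra.
have e0 : 0 < Num.min 1 (d / (c + 1)) by rewrite lt_min ltr01 divr_gt0.
apply: le_trans (xc (Num.min 1 (d / (c + 1))) _) _; first by rewrite e0 ge_min lexx.
apply: le_trans (_ : d / (c + 1) * (c + 1) <= _); last by rewrite divfK // gt_eqF.
by apply: ler_pM => //; [exact: ltW|rewrite ge_min lexx orbT|lra].
Qed.

Lemma pythag_error_le (R : realType) (a b c d e : R) :
  0 <= c -> 0 <= b -> 0 <= d -> 0 < e <= 1 -> b < e -> c <= d + b -> d <= c + b ->
  `|a + d ^+ 2 - (a + b ^+ 2 + c ^+ 2)| <= e * (2 + 2 * c).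
Proof. by move=> c0 b0 d0 /andP[e0 e1] be cd dc; rewrite ler_norml; apply/andP; split; nra. Qed.

Section AsymptoticallyHilbert.
Variables (R : realType) (k : scalar_kind).
Local Notation K := (scalars R k).
Implicit Types X W : completeNormedModType K.

(** The [Q N] are projections with increasing ranges, orthogonal in the Pythagorean sense. The last
    clause is the upper half of the parallelogram law with error [e] on the kernel of [Q N]. Apart
    from the choice of [N], every clause is a closed condition on one or two vectors. *)
Definition asymptotically_hilbert W (Q : nat -> W -> W) := [/\
  forall N, linear (Q N),
  forall N x, rnorm x ^+ 2 = rnorm (Q N x) ^+ 2 + rnorm (x - Q N x) ^+ 2,
  forall M N x, Q M (Q N x) = Q (minn M N) x &
  forall e : R, 0 < e -> exists N, forall x y, Q N x = 0 -> Q N y = 0 ->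
    0 <= quad 1 (-1) (2 + e) (2 + e) x y].

(** The upper inequality at [x + y] and [x - y], whose sum and difference are twice [x] and twice
    [y], is the lower inequality at [x] and [y]. *)
Lemma quad_le_parallelogram W (S : set W) :
  (forall x y, S x -> S y -> S (x + y) /\ S (x - y)) ->
  (forall e : R, 0 < e -> forall x y, S x -> S y -> 0 <= quad 1 (-1) (2 + e) (2 + e) x y) ->
  forall x y, S x -> S y ->
    rnorm (x + y) ^+ 2 + rnorm (x - y) ^+ 2 = 2 * (rnorm x ^+ 2 + rnorm y ^+ 2).
Proof.
move=> SD Sq.
have le x y : S x -> S y ->
    rnorm (x + y) ^+ 2 + rnorm (x - y) ^+ 2 <= 2 * (rnorm x ^+ 2 + rnorm y ^+ 2).
  move=> Sx Sy; apply/ler_addgt0Pr => e e0.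
  have A0 : 0 < rnorm x ^+ 2 + rnorm y ^+ 2 + 1.
    by rewrite ltr_wpDl // addr_ge0 ?sqr_ge0.
  have := Sq _ (divr_gt0 e0 A0) x y Sx Sy; rewrite /quad real_scalar1 !scale1r.
  have : e / (rnorm x ^+ 2 + rnorm y ^+ 2 + 1) * (rnorm x ^+ 2 + rnorm y ^+ 2) <= e.
    by rewrite mulrAC ler_pdivrMr // ler_wpM2l ?(ltW e0) // lerDl.
  move: (rnorm x ^+ 2) (rnorm y ^+ 2) (rnorm (x + y) ^+ 2) (rnorm (x - y) ^+ 2).
  by move=> a b c d; move: (e / _) => r; lra.
move=> x y Sx Sy; apply/eqP; rewrite eq_le le //=.
have [Sp Sm] := SD x y Sx Sy; have := le _ _ Sp Sm.
have two z : rnorm (z + z : W) ^+ 2 = 4 * rnorm z ^+ 2.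
  have -> : z + z = real_scalar k 2 *: z.
    by rewrite real_scalarD real_scalar1 scalerDl scale1r.
  by rewrite rnormZr ger0_norm // exprMn; congr (_ * _); ring.
have -> : x + y + (x - y) = x + x by rewrite addrACA subrr addr0.
have -> : x + y - (x - y) = y + y by rewrite opprB [LHS]addrC addrA subrK.
by rewrite !two; lra.
Qed.

Lemma linear_subr X W (f : X -> W) : linear f -> forall x y, f (x - y) = f x - f y.
Proof. by move=> /linear_pack[T TE] x y; rewrite -!TE linearB. Qed.

Lemma linear_zero X W (f : X -> W) : linear f -> f 0 = 0.
Proof. by move=> /linear_pack[T TE]; rewrite -TE linear0. Qed.

Section Projections.
Variables (W : completeNormedModType K) (Q : nat -> W -> W).
Hypothesis QA : asymptotically_hilbert Q.

Lemma proj_linear N : linear (Q N). Proof. by case: QA => h _ _ _; exact: h. Qed.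

Lemma proj_pythag N x : rnorm x ^+ 2 = rnorm (Q N x) ^+ 2 + rnorm (x - Q N x) ^+ 2.
Proof. by case: QA => _ h _ _; exact: h. Qed.

Lemma proj_comp M N x : Q M (Q N x) = Q (minn M N) x.
Proof. by case: QA => _ _ h _; exact: h. Qed.

Lemma proj_le N x : rnorm (Q N x) <= rnorm x.
Proof.
by rewrite -ler_sqr ?nnegrE ?rnorm_ge0 // (proj_pythag N x) lerDl sqr_ge0.
Qed.

Lemma proj_idem N x : Q N (Q N x) = Q N x.
Proof. by rewrite proj_comp minnn. Qed.

Lemma proj_distB N x y : rnorm (Q N x - Q N y) <= rnorm (x - y).
Proof. by rewrite -(linear_subr (@proj_linear N)) proj_le. Qed.

Lemma proj_closed N y (x : nat -> W) (l : W) :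
  (forall n, Q N (x n) = y) -> (forall e : R, 0 < e -> exists n, rnorm (l - x n) < e) ->
  Q N l = y.
Proof.
move=> xy lx; apply/eqP; rewrite -subr_eq0; apply/eqP/rnorm_eq0/eqP.
rewrite eq_le rnorm_ge0 andbT; apply/ler_addgt0Pr => e e0; rewrite add0r.
have [n /ltW ln] := lx e e0; apply: le_trans ln.
by rewrite -(xy n) proj_distB.
Qed.

Lemma proj_kernel_parallelogram x y :
  (forall N, Q N x = 0) -> (forall N, Q N y = 0) ->
  rnorm (x + y) ^+ 2 + rnorm (x - y) ^+ 2 = 2 * (rnorm x ^+ 2 + rnorm y ^+ 2).
Proof.
apply: (@quad_le_parallelogram W [set x | forall N, Q N x = 0]).
  move=> u v u0 v0; split=> N; have [T TE] := linear_pack (@proj_linear N).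
    by rewrite -TE linearD /= !TE u0 v0 addr0.
  by rewrite -TE linearB /= !TE u0 v0 subr0.
move=> e e0 u v u0 v0; have [_ _ _ /(_ e e0)[N NP]] := QA.
exact: NP.
Qed.

(** The squared norms of [Q N w] increase and are bounded by that of [w]; by orthogonality their
    increments are the squared distances. *)
Lemma proj_cvg w : exists l, forall e : R, 0 < e ->
  exists N, forall M, (N <= M)%N -> rnorm (l - Q M w) < e.
Proof.
have h0 n : 0 < 2^-1 ^+ n :> R by rewrite exprn_gt0 ?invr_gt0.
have mono M N : (M <= N)%N -> rnorm (Q N w - Q M w) ^+ 2 =
    rnorm (Q N w) ^+ 2 - rnorm (Q M w) ^+ 2.
  move=> MN; rewrite (proj_pythag M (Q N w)) proj_comp (minn_idPl MN).
  by rewrite addrAC subrr add0r.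
have nd : nondecreasing_seq (fun N => rnorm (Q N w) ^+ 2).
  by move=> M N MN; rewrite -subr_ge0 -mono // sqr_ge0.
have cv : cvgn (fun N => rnorm (Q N w) ^+ 2).
  apply: nondecreasing_is_cvgn => //; exists (rnorm w ^+ 2) => _ [N _ <-].
  by rewrite ler_sqr ?nnegrE ?rnorm_ge0 // proj_le.
have sP n : exists N, forall M M', (N <= M <= M')%N ->
    rnorm (Q M' w - Q M w) <= 2^-1 ^+ n.
  have h2 : 0 < (2^-1 ^+ n) ^+ 2 :> R by rewrite exprn_gt0.
  have /cvgrPdist_lt /(_ _ h2)[N _ NP] := cv.
  exists N => M M' /andP[NM MM']; rewrite -ler_sqr ?nnegrE ?rnorm_ge0 ?(ltW (h0 n)) //.
  rewrite mono //; apply: le_trans (ltW (NP M NM)).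
  apply: le_trans (ler_norm _); rewrite lerB //.
  exact: (nondecreasing_cvgn_le (u_ := fun N => rnorm (Q N w) ^+ 2) nd cv).
have [s0 s0P] := choice sP.
(* A running maximum makes the indices monotone, as the bound on the increments requires. *)
pose s := fix s n := if n is m.+1 then maxn (s0 n) (s m) else s0 0%N.
have ss0 n : (s0 n <= s n)%N by case: n => //= n; rewrite leq_maxl.
have sS n : (s n <= s n.+1)%N by rewrite /= leq_maxr.
have uf : fast_cauchy (fun n => Q (s n) w).
  by move=> n; apply: s0P; rewrite ss0 sS.
have [l lP] := fast_cauchy_cvg uf; exists l => e e0.
have e3 : 0 < e / 3 by rewrite divr_gt0.
have [n /(_ n (leqnn n)) nP] := exp_half_small e3.
exists (s n) => M nM; apply: le_lt_trans (rnormB_trans _ (Q (s n) w) _) _.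
apply: le_lt_trans (lerD (lP n) _) _.
  by rewrite rnormBC; apply: (s0P n); rewrite ss0 nM.
by move: nP; move: (2^-1 ^+ n) => h; lra.
Qed.

End Projections.

Section Extensions.
Variables (X : completeNormedModType K) (P : nat -> X -> X).
Hypothesis PA : asymptotically_hilbert P.
Hypothesis P_cvg : forall x (e : R), 0 < e -> exists N, rnorm (x - P N x) < e.

(** A description of [W] as [X] plus a Hilbert space that names no complement. The ranges of the
    [Q N] stay inside the copy of [X]; the complement is recovered as their common kernel in
    [extension_decomposition]. *)
Definition hilbert_extension W (j : {linear X -> W}) := linear_isometry j /\
  exists Q : nat -> W -> W, [/\ asymptotically_hilbert Q,
    forall N x, Q N (j x) = j (P N x) & forall N w, exists x, Q N w = j (P N x)].

Section Decomposition.
Variables (W : completeNormedModType K) (j : {linear X -> W}) (Q : nat -> W -> W).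
Hypothesis j_isom : linear_isometry j.
Hypothesis QA : asymptotically_hilbert Q.
Hypothesis Qj : forall N x, Q N (j x) = j (P N x).
Hypothesis Q_range : forall N w, exists x, Q N w = j (P N x).

Let jr x : rnorm (j x) = rnorm x := rnorm_isometry j_isom x.

Lemma extension_component w : exists x, forall N, Q N (w - j x) = 0.
Proof.
have [l lP] := proj_cvg QA w.
have [x xl] : exists x, j x = l.
  apply: isometry_closed_range j_isom _ => e /lP[N /(_ N (leqnn N)) NP].
  by have [x xE] := Q_range N w; exists (P N x); rewrite -xE.
exists x => N; rewrite (linear_subr (proj_linear QA N)) xl.
apply/eqP; rewrite subr_eq0; apply/eqP/esym.
(* Starting the sequence at [N] makes [Q N] constant along it. *)
apply: (proj_closed QA (x := fun n => Q (maxn N n) w)).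
  by move=> n; rewrite (proj_comp QA) (minn_idPl (leq_maxl _ _)).
by move=> e /lP[M MP]; exists M; apply: MP; rewrite leq_maxr.
Qed.

Lemma extension_component_unique x : (forall N, Q N (j x) = 0) -> x = 0.
Proof.
move=> x0; apply/rnorm_eq0/eqP; rewrite eq_le rnorm_ge0 andbT.
apply/ler_addgt0Pr => e /(P_cvg x)[N /ltW NP]; rewrite add0r; apply: le_trans NP.
have Px : P N x = 0 by apply: rnorm_eq0; rewrite -jr -Qj x0 rnorm0.
by rewrite Px subr0.
Qed.

(** The map [Q N] sends [j x + v] to [j (P N x)], and its Pythagorean identity is the claim up to
    the replacement of [x] by [P N x]; that error tends to 0. *)
Lemma extension_pythag x v : (forall N, Q N v = 0) ->
  rnorm (j x + v) ^+ 2 = rnorm x ^+ 2 + rnorm v ^+ 2.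
Proof.
move=> v0; apply/eqP; rewrite -subr_eq0; apply/eqP.
apply: (@small_eq0 R _ (2 + 2 * rnorm v)) => [|e e01].
  by rewrite addr_ge0 // mulr_ge0 ?rnorm_ge0.
have /andP[e0 e1] := e01.
have [N NP] := P_cvg x e0.
have PE := proj_pythag PA N x.
have QE := proj_pythag QA N (j x + v).
have [T TE] := linear_pack (proj_linear QA N).
have QN : Q N (j x + v) = j (P N x) by rewrite -TE linearD /= !TE Qj v0 addr0.
have rE : j x + v - j (P N x) = v + j (x - P N x) by rewrite linearB addrAC addrC.
rewrite QN jr rE in QE; rewrite QE PE.
have := rnormD v (j (x - P N x)); have := rnormB (v + j (x - P N x)) (j (x - P N x)).
rewrite addrK jr.
move: (rnorm_ge0 v) (rnorm_ge0 (x - P N x)) (rnorm_ge0 (v + j (x - P N x))) NP.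
move: (rnorm (P N x) ^+ 2) (rnorm (x - P N x)) (rnorm v) (rnorm (v + _)) => a b c d.
by move=> c0 b0 d0 be h1 h2; exact: pythag_error_le.
Qed.

Let kernel := [set v | forall N, Q N v = 0].

Let kernel_lin a x y : kernel x -> kernel y -> kernel (a *: x + y).
Proof.
move=> x0 y0 N; have [T TE] := linear_pack (proj_linear QA N).
by rewrite -TE linearP !TE x0 y0 scaler0 addr0.
Qed.

Let kernel_0 : kernel 0.
Proof. by move=> N; exact: linear_zero (proj_linear QA N). Qed.

Let kernel_closed x : (forall e : R, 0 < e -> exists2 y, kernel y & rnorm (x - y) < e) ->
  kernel x.
Proof.
move=> xP N.
have /choice[y yP] : forall n : nat, exists y, kernel y /\ rnorm (x - y) < n.+1%:R^-1.
  by move=> n; have [|y y0 yx] := xP n.+1%:R^-1; [rewrite invr_gt0|exists y].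
apply: (proj_closed QA (x := y)) => [n|e e0]; first by case: (yP n) => y0 _; exact: y0.
have [n ne] := ltr_add_invr e0; rewrite add0r in ne.
by exists n; apply: lt_trans ne; case: (yP n).
Qed.

Let hilbert_part : closed_subspace W := ClosedSubspace kernel_lin kernel_0 kernel_closed.

(** The Hilbert summand is the common kernel of the projections, where the errors [e] disappear and
    the parallelogram law is exact. The component in [X] is unique, which makes it linear in [w]. *)
Lemma extension_decomposition : exists (H : completeNormedModType K)
  (T : {linear W -> sum2 X H}), [/\ is_hilbert H, linear_isometry T,
    range T = setT & forall x, T (j x) = (x, 0)].
Proof.
pose H : completeNormedModType K := csub hilbert_part.
have /choice[p pP] := extension_component.
have vP w : w - j (p w) \in cs_pred hilbert_part by rewrite inE; exact: pP.
pose f w : sum2 X H := (p w, CSub (vP w)).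
have p_lin : linear p.
  move=> a x y; apply/eqP; rewrite -subr_eq0; apply/eqP/extension_component_unique => N.
  have [T TE] := linear_pack (proj_linear QA N).
  have E z : T (j (p z)) = T z.
    by apply/esym/eqP; rewrite -subr_eq0 -!linearB TE pP.
  have -> : j (p (a *: x + y) - (a *: p x + p y)) =
      j (p (a *: x + y)) - (a *: j (p x) + j (p y)) by rewrite linearB linearP.
  by rewrite -TE linearB linearP !E linearP subrr.
have f_lin : linear f.
  move=> a x y; congr pair; first exact: p_lin.
  apply: val_inj; rewrite [RHS]csub_valD csub_valZ /= p_lin linearP.
  by rewrite scalerBr opprD addrACA.
have [T TE] := linear_pack f_lin.
have T_isom w : rnorm (T w) = rnorm w.
  apply: eq_sqr_rnorm; rewrite TE sqr_rnorm_sum2 /= rnorm_csub /=.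
  by rewrite -extension_pythag ?subrKC //; exact: pP.
have pj x : p (j x) = x.
  apply/eqP; rewrite eq_sym -subr_eq0; apply/eqP/extension_component_unique => N.
  by rewrite linearB; exact: pP.
exists H, T; split.
- apply: jordan_von_neumann => x y.
  rewrite !rnorm_csub csub_valD csub_valB; apply: (proj_kernel_parallelogram QA).
    by have := csub_valP x; rewrite inE.
  by have := csub_valP y; rewrite inE.
- exact: isometry_rnorm.
- apply/seteqP; split => // -[x h] _; exists (j x + csub_val h) => //.
  have h0 : forall N, Q N (csub_val h) = 0 by have := csub_valP h; rewrite inE.
  have px : p (j x + csub_val h) = x.
    rewrite -[RHS](pj x); apply/eqP; rewrite eq_sym -subr_eq0.
    apply/eqP/extension_component_unique => N; rewrite linearB pj.
    have [S SE] := linear_pack (proj_linear QA N).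
    have := pP (j x + csub_val h) N; rewrite -!SE [X in S (X - _)]addrC -addrA linearD /=.
    by rewrite !SE h0 add0r.
  rewrite TE; congr pair => //; apply: val_inj => /=; rewrite px.
  by rewrite addrAC subrr add0r.
move=> x; rewrite TE; congr pair; first exact: pj.
by apply: val_inj => /=; rewrite pj subrr.
Qed.

End Decomposition.
End Extensions.
End AsymptoticallyHilbert.

(** * Ultralimits and ultrapowers *)

Lemma rnorm_complex_le (R : realType) (z : R[i]) :
  rnorm (z : scalars R ComplexScalars) <= `|complex.Re z| + `|complex.Im z|.
Proof.
case: z => a b; rewrite /rnorm /= -[leRHS]ger0_norm ?addr_ge0 // -sqrtr_sqr.
rewrite ler_sqrt ?sqr_ge0 // sqrrD !real_normK ?num_real // lerD2r lerDl.
by rewrite mulrn_wge0 // mulr_ge0.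
Qed.

Section Ultralimits.
Variables (R : realType) (k : scalar_kind).
Local Notation K := (scalars R k).
Variables (I : Type) (U : set_system I) (FU : UltraFilter U).

Let PU : ProperFilter U := @ultra_proper _ _ FU.

Lemma ultra_or (A : set I) : (\forall i \near U, A i) \/ (\forall i \near U, ~ A i).
Proof. by have [|] := in_ultra_setVsetC A FU; [left|right]. Qed.

Lemma real_ultralimit (c : I -> R) (M : R) : (\forall i \near U, `|c i| <= M) ->
  exists l, forall e : R, 0 < e -> \forall i \near U, `|l - c i| < e.
Proof.
(* The values are shifted by [M], and set to 0 where the bound fails, to land in an interval
   starting at 0 as [ultrafilter_cvg] demands. *)
move=> cM; pose a i := if `|c i| <= M then c i + M else 0.
have aM i : 0 <= a i <= `|M| + `|M|.
  rewrite /a; case: ifPn => [|_]; last by rewrite lexx addr_ge0.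
  rewrite ler_norml => /andP[c1 c2]; have MM := ler_norm M; apply/andP; split; lra.
have /cvg_ex[l al] := ultrafilter_cvg FU aM.
exists (l - M) => e e0; move/cvgrPdist_lt: al => /(_ e e0) al.
by apply: filterS2 cM al => i ciM; rewrite /a ciM opprD addrA addrAC.
Qed.

Lemma scalar_ultralimit (c : I -> K) (M : R) : (\forall i \near U, rnorm (c i) <= M) ->
  exists l : K, forall e : R, 0 < e -> \forall i \near U, rnorm (l - c i) < e.
Proof.
move: c; case: (k) => c cM; first exact: real_ultralimit cM.
have norm_re (z : R[i]) : `|complex.Re z| <= rnorm (z : scalars R ComplexScalars).
  case: z => a b; rewrite /rnorm /= -sqrtr_sqr ler_sqrt ?lerDl ?addr_ge0 ?sqr_ge0 //.
have norm_im (z : R[i]) : `|complex.Im z| <= rnorm (z : scalars R ComplexScalars).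
  case: z => a b; rewrite /rnorm /= -sqrtr_sqr ler_sqrt ?lerDr ?addr_ge0 ?sqr_ge0 //.
have [a aP] : exists l, forall e, 0 < e -> \forall i \near U, `|l - complex.Re (c i)| < e.
  by apply: (@real_ultralimit _ M); apply: filterS cM => i; exact: le_trans.
have [b bP] : exists l, forall e, 0 < e -> \forall i \near U, `|l - complex.Im (c i)| < e.
  by apply: (@real_ultralimit _ M); apply: filterS cM => i; exact: le_trans.
exists (Complex a b) => e e0; have e2 : 0 < e / 2 by rewrite divr_gt0.
apply: filterS2 (aP _ e2) (bP _ e2) => i ai bi.
apply: le_lt_trans (rnorm_complex_le _) _; rewrite [ltRHS]splitr.
by case: (c i) ai bi => u v /= ai bi; apply: ltrD.
Qed.

Definition spanned (V : lmodType K) n (b : nat -> V) (x : V) :=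
  exists c : nat -> K, x = \sum_(0 <= j < n) c j *: b j.

Lemma spannedZD (V : lmodType K) n (b : nat -> V) a x y :
  spanned n b x -> spanned n b y -> spanned n b (a *: x + y).
Proof.
move=> [c ->] [d ->]; exists (fun j => a * c j + d j).
rewrite scaler_sumr -big_split /=; apply: eq_bigr => j _.
by rewrite scalerDl scalerA.
Qed.

(** Compactness of bounded sets in a finite dimensional space, by induction on the spanning list,
    which may be linearly dependent. If the last coefficient is bounded along [U], both parts
    converge. Otherwise [b n] is redundant. *)
Lemma spanned_ultralimit (W : completeNormedModType K) n (b : nat -> W) (x : I -> W) (M : R) :
  (forall i, spanned n b (x i)) -> (\forall i \near U, rnorm (x i) <= M) ->
  exists2 l, spanned n b l & forall e : R, 0 < e -> \forall i \near U, rnorm (l - x i) < e.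
Proof.
elim: n x M => [|n IH] x M xb xM.
  exists 0; first by exists (fun=> 0); rewrite big_nil.
  move=> e e0; apply: filterE => i; have [c ->] := xb i.
  by rewrite big_nil subr0 rnorm0.
have [c cP] := choice xb.
pose y i := \sum_(0 <= j < n) c i j *: b j.
have yb i : spanned n b (y i) by exists (c i).
have xE i : x i = y i + c i n *: b n by rewrite cP big_nat_recr.
have spanS v : spanned n b v -> spanned n.+1 b v.
  move=> [d ->]; exists (fun j => if (j < n)%N then d j else 0).
  rewrite big_nat_recr //= ltnn scale0r addr0 !big_nat.
  by apply: eq_bigr => j /andP[_ ->].
have [[N cN]|cinf] := pselect (exists N, \forall i \near U, rnorm (c i n) <= N).
  have yM : \forall i \near U, rnorm (y i) <= M + N * rnorm (b n).
    apply: filterS2 xM cN => i xi ci; have -> : y i = x i - c i n *: b n.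
      by rewrite xE addrK.
    by apply: le_trans (rnormB _ _) _; rewrite rnormZ lerD // ler_wpM2r ?rnorm_ge0.
  have [l lb lP] := IH y _ yb yM.
  have [d dP] := scalar_ultralimit cN.
  exists (d *: b n + l).
    apply: spannedZD; last exact: spanS.
    exists (fun j => (j == n)%:R); rewrite big_nat_recr //= eqxx scale1r.
    rewrite big_nat big1 ?add0r // => j /andP[_ jn].
    by rewrite ltn_eqF ?scale0r.
  move=> e e0; have e2 : 0 < e / 2 by rewrite divr_gt0.
  have B0 : 0 < rnorm (b n) + 1 by rewrite ltr_wpDl ?rnorm_ge0.
  have e3 : 0 < e / 2 / (rnorm (b n) + 1) by rewrite divr_gt0.
  apply: filterS2 (lP _ e2) (dP _ e3) => i li di.
  have -> : d *: b n + l - x i = (l - y i) + (d - c i n) *: b n.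
    by rewrite xE scalerBl opprD (addrC (d *: b n) l) addrACA.
  apply: le_lt_trans (rnormD _ _) _; rewrite [ltRHS]splitr.
  apply: ltr_leD => //; rewrite rnormZ; move: di; rewrite ltr_pdivlMr // => /ltW.
  by apply: le_trans; rewrite ler_wpM2l ?rnorm_ge0 // lerDl.
(* The last coefficient now tends to infinity. Dividing the bounded vectors [x i] by it gives 0 in
   the limit, so [- b n] is a limit of combinations of the earlier vectors and lies in their
   span. *)
have cbig N : \forall i \near U, N < rnorm (c i n).
  have [cN|] := ultra_or [set i | rnorm (c i n) <= N].
    by exfalso; apply: cinf; exists N.
  by apply: filterS => i /= /negP; rewrite -ltNge.
have zb i : spanned n b ((c i n)^-1 *: y i).
  have [d dE] := yb i; exists (fun j => (c i n)^-1 * d j).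
  by rewrite dE scaler_sumr; apply: eq_bigr => j _; rewrite scalerA.
have cV i : 0 < rnorm (c i n) -> (c i n)^-1 *: y i = (c i n)^-1 *: x i - b n /\
    rnorm ((c i n)^-1) = (rnorm (c i n))^-1.
  move=> c0; have cn0 : c i n != 0.
    by apply: contraTneq c0 => ->; rewrite rnorm0 ltxx.
  rewrite xE scalerDr scalerA mulVf // scale1r addrK; split => //.
  apply: (mulIf (lt0r_neq0 c0)); rewrite mulVf ?lt0r_neq0 //.
  have := @rnormZ R k K^o (c i n)^-1 (c i n); rewrite [_ *: _]mulVf // => <-.
  by rewrite -real_scalar1 rnorm_real_scalar.
have M0 : 0 <= M by have [i xi] := filter_ex xM; exact: le_trans (rnorm_ge0 _) xi.
have zsmall e : 0 < e -> \forall i \near U, rnorm ((c i n)^-1 *: x i) < e.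
  move=> e0; apply: filterS2 xM (cbig (`|M| / e)) => i xi ci.
  have c0 : 0 < rnorm (c i n) by apply: le_lt_trans ci; rewrite divr_ge0 // ltW.
  rewrite rnormZ (cV i c0).2 mulrC ltr_pdivrMr //; apply: le_lt_trans xi _.
  by rewrite mulrC -ltr_pdivrMr // (le_lt_trans _ ci) // ler_wpM2r ?invr_ge0 ?(ltW e0) // ler_norm.
have zM : \forall i \near U, rnorm ((c i n)^-1 *: y i) <= 1 + rnorm (b n).
  apply: filterS2 (zsmall 1 ltr01) (cbig 0) => i zi c0.
  by rewrite (cV i c0).1; apply: le_trans (rnormB _ _) _; rewrite lerD2r ltW.
have [l lb lP] := IH _ _ zb zM.
have lE : l = - b n.
  apply/eqP; rewrite -addr_eq0; apply/eqP/rnorm_eq0/eqP.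
  rewrite eq_le rnorm_ge0 andbT; apply/ler_addgt0Pr => e e0; rewrite add0r.
  have e2 : 0 < e / 2 by rewrite divr_gt0.
  have [i [[li zi] c0]] := filter_ex (filterI (filterI (lP _ e2) (zsmall _ e2)) (cbig 0)).
  rewrite (cV i c0).1 in li.
  have -> : l + b n = (l - ((c i n)^-1 *: x i - b n)) + (c i n)^-1 *: x i.
    by rewrite opprB addrA subrK.
  by apply: le_trans (rnormD _ _) _; rewrite [leRHS]splitr lerD // ltW.
have bn : spanned n b (b n).
  have := spannedZD (-1) lb (ex_intro _ (fun=> 0) erefl : spanned n b (\sum_(0 <= j < n) 0 *: b j)).
  by rewrite lE scaleN1r opprK big1 ?addr0 // => j _; rewrite scale0r.
have [|l' lb' lP'] := IH x M _ xM; last by exists l' => //; exact: spanS.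
by move=> i; rewrite xE addrC; exact: spannedZD.
Qed.

End Ultralimits.

Section UltraMaps.
Variables (R : realType) (k : scalar_kind).
Local Notation K := (scalars R k).
Variables (I : Type) (U : set_system I) (FU : UltraFilter U).
Implicit Types X Y W : completeNormedModType K.

Let PU : ProperFilter U := @ultra_proper _ _ FU.
Local Existing Instance PU.

Lemma linf_ex X (f : I -> X) (M : R) : (forall i, rnorm (f i) <= M) ->
  exists g : linf I X, forall i, linf_fun g i = f i.
Proof.
move=> fM; have fP : f \in @linf_mem R k I X by rewrite inE; exists M.
by exists (Linf fP).
Qed.

Lemma linf_funP X a (f g : linf I X) i :
  linf_fun (a *: f + g) i = a *: linf_fun f i + linf_fun g i.
Proof. by rewrite linf_funD linf_funZ. Qed.

Lemma linf_funBE X (f g : linf I X) i :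
  linf_fun (f - g) i = linf_fun f i - linf_fun g i.
Proof. by rewrite linf_funB. Qed.

Lemma ultra_norm_cvg X (f : linf I X) :
  rnorm (linf_fun f i) @[i --> U] --> rnorm (ultra_class FU f).
Proof. by rewrite rnorm_ultra_class; exact: ultra_lim_cvg. Qed.

Lemma ultra_sqr_cvg X (f : linf I X) :
  rnorm (linf_fun f i) ^+ 2 @[i --> U] --> rnorm (ultra_class FU f) ^+ 2.
Proof.
have h := @ultra_norm_cvg X f.
rewrite expr2; under eq_fun do rewrite expr2.
exact: (@cvgM _ _ U _ _ _ _ _ h h).
Qed.

Lemma ultra_class_dist X (f g : linf I X) :
  (forall e : R, 0 < e -> \forall i \near U, rnorm (linf_fun f i - linf_fun g i) < e) <->
  ultra_class FU f = ultra_class FU g.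
Proof.
split=> [fg|].
  apply/eqP; rewrite -subr_eq0 -ultra_classB; apply/eqP/rnorm_eq0/eqP.
  rewrite eq_le rnorm_ge0 andbT; apply/ler_addgt0Pr => e e0; rewrite add0r.
  have c := @ultra_norm_cvg X (f - g).
  rewrite -(cvg_lim _ c) //; apply: limr_le; first by apply/cvg_ex; eexists; exact: c.
  by apply: filterS (fg e e0) => i /ltW; rewrite linf_funB.
move=> fg e e0; have := @ultra_norm_cvg X (f - g).
rewrite ultra_classB fg subrr rnorm0 => /cvgrPdist_lt /(_ e e0).
by apply: filterS => i; rewrite sub0r normrN linf_funB ger0_norm ?rnorm_ge0.
Qed.

(** The value is specified on every pair of representatives, so that later arguments can choose the
    convenient one. Independence of the choice follows from the norm bound. *)
Lemma ultra_map X Y (T : {linear X -> Y}) : (forall x, rnorm (T x) <= rnorm x) ->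
  exists S : {linear ultrapower FU X -> ultrapower FU Y},
    forall (f : linf I X) (g : linf I Y), (forall i, linf_fun g i = T (linf_fun f i)) ->
      S (ultra_class FU f) = ultra_class FU g.
Proof.
move=> TM.
have /choice[t tP] (f : linf I X) :
    exists g : linf I Y, forall i, linf_fun g i = T (linf_fun f i).
  have [M fM] := linf_bounded f; apply: (@linf_ex _ _ M) => i.
  exact: le_trans (TM _) (fM i).
have tE (f : linf I X) (g : linf I Y) (h : linf I X) :
    (forall i, linf_fun g i = T (linf_fun f i)) ->
    ultra_class FU f = ultra_class FU h -> ultra_class FU (t h) = ultra_class FU g.
  move=> gf /ultra_class_dist fh; apply/ultra_class_dist => e e0.
  apply: filterS (fh e e0) => i; apply: le_lt_trans.
  by rewrite tP gf -linearB rnormBC; apply: le_trans (TM _) _.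
have /choice[r rP] := ultra_class_surj (FU := FU) (X := X).
have S_lin : linear (fun v => ultra_class FU (t (r v)) : ultrapower FU Y).
  move=> a v w; rewrite -ultra_classZ -ultra_classD.
  apply: (tE (a *: r v + r w)).
    by move=> i; rewrite linf_funP !tP linf_funP linearP.
  by rewrite rP ultra_classD ultra_classZ !rP.
have [S SE] := linear_pack S_lin.
by exists S => f g gf; rewrite SE; apply: tE gf _; rewrite rP.
Qed.

Lemma ultra_map_isometry X Y (T : {linear X -> Y})
    (S : {linear ultrapower FU X -> ultrapower FU Y}) : linear_isometry T ->
  (forall (f : linf I X) (g : linf I Y), (forall i, linf_fun g i = T (linf_fun f i)) ->
      S (ultra_class FU f) = ultra_class FU g) ->
  linear_isometry S.
Proof.
move=> /rnorm_isometry Ti SE; apply: isometry_rnorm => v.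
have [f <-] := ultra_class_surj v; have [M fM] := linf_bounded f.
have [|g gE] := @linf_ex Y (fun i => T (linf_fun f i)) M.
  by move=> i; rewrite Ti.
rewrite (SE f g gE) !rnorm_ultra_class; congr (lim (_ @ U)).
by apply/funext => i; rewrite gE Ti.
Qed.

Lemma ultra_diagonal X : exists d : {linear X -> ultrapower FU X}, linear_isometry d /\
  forall x (f : linf I X), (forall i, linf_fun f i = x) -> d x = ultra_class FU f.
Proof.
have /choice[c cP] (x : X) : exists g : linf I X, forall i, linf_fun g i = x.
  exact: (@linf_ex _ _ (rnorm x)).
have class_ext (f g : linf I X) : (forall i, linf_fun f i = linf_fun g i) ->
    ultra_class FU f = ultra_class FU g.
  move=> fg; apply/ultra_class_dist => e e0; apply: filterE => i.
  by rewrite fg subrr rnorm0.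
have d_lin : linear (fun x => ultra_class FU (c x) : ultrapower FU X).
  move=> a x y; rewrite -ultra_classZ -ultra_classD; apply: class_ext => i.
  by rewrite linf_funP !cP.
have [d dE] := linear_pack d_lin; exists d; split.
  apply: isometry_rnorm => x; rewrite dE rnorm_ultra_class.
  under eq_fun do rewrite cP; exact: lim_cst.
by move=> x f fx; rewrite dE; apply: class_ext => i; rewrite cP fx.
Qed.

End UltraMaps.

Section ExtensionUltrapower.
Variables (R : realType) (k : scalar_kind).
Local Notation K := (scalars R k).
Variables (I : Type) (U : set_system I) (FU : UltraFilter U).
Variables (X : completeNormedModType K) (P : nat -> X -> X).
Hypothesis P_fin : forall N, fin_span (range (P N)).

Let PU : ProperFilter U := @ultra_proper _ _ FU.
Local Existing Instance PU.

Variables (W : completeNormedModType K) (j : {linear X -> W}).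
Variable d : {linear W -> ultrapower FU W}.
Hypothesis d_isom : linear_isometry d.
Hypothesis dE : forall w (f : linf I W), (forall i, linf_fun f i = w) -> d w = ultra_class FU f.

Lemma quad_ultra_ge0 (l k1 k2 k3 : R) (f g : linf I W) :
  (forall i, 0 <= quad l k1 k2 k3 (linf_fun f i) (linf_fun g i)) ->
  0 <= quad l k1 k2 k3 (ultra_class FU f) (ultra_class FU g).
Proof.
move=> q0.
have c : quad l k1 k2 k3 (linf_fun f i) (linf_fun g i) @[i --> U] -->
    quad l k1 k2 k3 (ultra_class FU f) (ultra_class FU g).
  rewrite /quad -ultra_classZ -ultra_classD -ultra_classB.
  have h1 := @ultra_sqr_cvg _ _ _ _ FU W (f + real_scalar k l *: g).
  have h2 := @ultra_sqr_cvg _ _ _ _ FU W (f - real_scalar k l *: g).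
  have h3 := @ultra_sqr_cvg _ _ _ _ FU W f.
  have h4 := @ultra_sqr_cvg _ _ _ _ FU W g.
  rewrite linf_funD linf_funB linf_funZ in h1 h2.
  apply: cvgD; first apply: cvgD.
  - by apply: cvgMr; apply: cvgD; [exact: h1|exact: h2].
  - by apply: cvgMr; exact: h3.
  - by apply: cvgMr; exact: h4.
rewrite -(cvg_lim _ c) //; apply: limr_ge; first by apply/cvg_ex; eexists; exact: c.
exact: filterE.
Qed.

(** The projections are the ultrapowers of the [Q N]. Finite rank is what keeps their ranges inside
    the diagonal copy of [X]. *)
Lemma extension_ultrapower : hilbert_extension P j ->
  exists2 j' : {linear X -> ultrapower FU W}, (forall x, j' x = d (j x)) &
    hilbert_extension P j'.
Proof.
move=> [j_isom [Q [QA Qj Q_range]]].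
have [j' j'E] : exists j' : {linear X -> ultrapower FU W}, forall x, j' x = d (j x).
  by apply: linear_pack => a x y; rewrite !linearP.
exists j' => //; split; first by move=> x; rewrite j'E d_isom j_isom.
have /choice[T TP] N : exists T : {linear ultrapower FU W -> ultrapower FU W},
    forall f g : linf I W, (forall i, linf_fun g i = Q N (linf_fun f i)) ->
      T (ultra_class FU f) = ultra_class FU g.
  have [S SE] := linear_pack (proj_linear QA N).
  have [|T TE] := @ultra_map _ _ _ _ FU _ _ S; first by move=> x; rewrite SE proj_le.
  by exists T => f g fg; apply: TE => i; rewrite fg SE.
have /choice[q qP] (Nf : nat * linf I W) :
    exists g : linf I W, forall i, linf_fun g i = Q Nf.1 (linf_fun Nf.2 i).
  have [M fM] := linf_bounded Nf.2; apply: (@linf_ex _ _ _ _ _ M) => i.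
  exact: le_trans (proj_le QA _ _) (fM i).
have TE N f : T N (ultra_class FU f) = ultra_class FU (q (N, f)).
  by apply: TP => i; rewrite qP.
exists (fun N => T N); split.
- split.
  + by move=> N a v w; rewrite linearP.
  + move=> N v; have [f <-] := ultra_class_surj v; rewrite TE -ultra_classB.
    have h1 := @ultra_sqr_cvg _ _ _ _ FU W f.
    have h2 := @ultra_sqr_cvg _ _ _ _ FU W (q (N, f)).
    have h3 := @ultra_sqr_cvg _ _ _ _ FU W (f - q (N, f)).
    apply: cvg_unique h1 _ => //.
    have -> : (fun i => rnorm (linf_fun f i) ^+ 2) = (fun i =>
        rnorm (linf_fun (q (N, f)) i) ^+ 2 + rnorm (linf_fun (f - q (N, f)) i) ^+ 2).
      by apply/funext => i; rewrite linf_funBE qP (proj_pythag QA N (linf_fun f i)).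
    exact: cvgD h2 h3.
  + move=> M N v; have [f <-] := ultra_class_surj v; rewrite !TE; apply/esym.
    apply/ultra_class_dist => e e0; apply: filterE => i.
    by rewrite !qP /= (proj_comp QA) subrr rnorm0.
  move=> e e0; have [_ _ _ /(_ e e0)[N NP]] := QA; exists N => v w.
  have [f <-] := ultra_class_surj v; have [g <-] := ultra_class_surj w.
  (* A class killed by [T N] is represented by a family lying in the kernel of [Q N] at every
     index. *)
  have Qsub f' : T N (ultra_class FU f') = 0 ->
      ultra_class FU f' = ultra_class FU (f' - q (N, f')).
    by move=> f0; rewrite ultra_classB -TE f0 subr0.
  move=> /Qsub -> /Qsub ->; apply: quad_ultra_ge0 => i.
  rewrite !linf_funBE; apply: NP.
    by rewrite (linear_subr (proj_linear QA N)) qP /= (proj_idem QA) subrr.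
  by rewrite (linear_subr (proj_linear QA N)) qP /= (proj_idem QA) subrr.
- move=> N x; rewrite !j'E.
  have [f fP] := @linf_ex _ _ I _ (fun=> j x) (rnorm (j x)) (fun=> lexx _).
  by rewrite (dE fP) TE; apply/esym/dE => i; rewrite qP /= fP Qj.
move=> N v; have [f <-] := ultra_class_surj v; have [M fM] := linf_bounded f.
(* The family [Q N (f i)] is bounded in a finite dimensional space, so it has a limit [l] in [W]
   along [U] and its class is the diagonal image of [l]. *)
have [n [b bP]] := fin_span_image j (P_fin N).
have qb i : spanned n b (linf_fun (q (N, f)) i).
  by rewrite qP /=; have [x ->] := Q_range N (linf_fun f i); apply: bP; exists (P N x).
have qM : \forall i \near U, rnorm (linf_fun (q (N, f)) i) <= M.
  by apply: filterE => i; rewrite qP; apply: le_trans (proj_le QA _ _) (fM i).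
have [l _ lP] := spanned_ultralimit FU qb qM.
have Ql : Q N l = l.
  apply/eqP; rewrite -subr_eq0; apply/eqP/rnorm_eq0/eqP.
  rewrite eq_le rnorm_ge0 andbT; apply/ler_addgt0Pr => e e0; rewrite add0r.
  have e2 : 0 < e / 2 by rewrite divr_gt0.
  have [i li] := filter_ex (lP _ e2).
  apply: le_trans (rnormB_trans _ (linf_fun (q (N, f)) i) _) _.
  rewrite [leRHS]splitr lerD //; last by rewrite rnormBC ltW.
  apply: le_trans (ltW li); rewrite -{1}(_ : Q N (linf_fun (q (N, f)) i) = linf_fun (q (N, f)) i).
    exact: proj_distB.
  by rewrite qP (proj_idem QA).
have [x xE] := Q_range N l; exists x; rewrite j'E -xE Ql TE.
have [g gP] := @linf_ex _ _ I _ (fun=> l) (rnorm l) (fun=> lexx _).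
rewrite (dE gP); apply/ultra_class_dist => e e0; apply: filterS (lP e e0) => i.
by rewrite gP rnormBC.
Qed.

End ExtensionUltrapower.

(** * Truncations of l2 sums as asymptotic projections *)

Section AsymptoticSums.
Variables (R : realType) (k : scalar_kind).
Local Notation K := (scalars R k).

Lemma l2_trunc_trunc (V : nat -> completeNormedModType K) M N (x : l2sum V) :
  l2_trunc M (l2_trunc N x) = l2_trunc (minn M N) x.
Proof.
by apply: l2_ext => n; rewrite !l2_restrE leq_min; case: (n < M)%N.
Qed.

Lemma l2_asymptotically_hilbert (V : nat -> completeNormedModType K) :
  (forall e : R, 0 < e -> exists N, forall n, (N <= n)%N -> forall x y : V n,
    0 <= quad 1 (-1) (2 + e) (2 + e) x y) ->
  asymptotically_hilbert (@l2_trunc R k V).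
Proof.
move=> Ve; split.
- by move=> N; exact: l2_restr_linear.
- by move=> N x; exact: l2_restr_pythag.
- by move=> M N x; exact: l2_trunc_trunc.
move=> e /Ve[N NP]; exists N => x y x0 y0; apply: quad_l2_ge0 => n.
have [Nn|nN] := leqP N n; first exact: NP.
have coord0 (z : l2sum V) : l2_trunc N z = 0 -> l2fun z n = 0.
  move=> /(congr1 (fun z : l2sum V => l2fun z n)).
  by rewrite l2_restrE nN l2fun0.
rewrite (coord0 x x0) (coord0 y y0) /quad scaler0 addr0 subr0 !rnorm0 expr0n /=.
by rewrite !(mulr0, addr0).
Qed.

Lemma sum2_asymptotically_hilbert (A B : completeNormedModType K)
    (P : nat -> A -> A) (Q : nat -> B -> B) :
  asymptotically_hilbert P -> asymptotically_hilbert Q ->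
  asymptotically_hilbert (fun N (z : sum2 A B) => (P N z.1, Q N z.2) : sum2 A B).
Proof.
move=> PA QA; split.
- move=> N a x y; congr pair; [exact: proj_linear PA _ _ _ _|exact: proj_linear QA _ _ _ _].
- move=> N x; rewrite !sqr_rnorm_sum2 /= (proj_pythag PA N x.1) (proj_pythag QA N x.2).
  by rewrite addrACA.
- by move=> M N x; rewrite /= (proj_comp PA) (proj_comp QA).
move=> e e0; have [_ _ _ /(_ e e0)[N NP]] := PA.
have [_ _ _ /(_ e e0)[M MP]] := QA.
exists (maxn N M) => x y [x1 x2] [y1 y2]; rewrite quad_sum2; apply: addr_ge0.
  have P0 z : P (maxn N M) z = 0 -> P N z = 0.
    move=> z0; rewrite -(minn_idPl (leq_maxl N M)) -(proj_comp PA) z0.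
    exact: linear_zero (proj_linear PA N).
  by apply: NP; exact: P0.
have Q0 z : Q (maxn N M) z = 0 -> Q M z = 0.
  move=> z0; rewrite -(minn_idPl (leq_maxr N M)) -(proj_comp QA) z0.
  exact: linear_zero (proj_linear QA M).
by apply: MP; exact: Q0.
Qed.

(** The quantity is the tangent coefficient at [l = 1]. At that point the tangent inequality becomes
    the parallelogram inequality with a factor tending to 1. *)
Lemma cvg_tangent1 (p : nat -> R) (e : R) : p @ \oo --> (2 : R) -> 0 < e ->
  exists N, forall n, (N <= n)%N -> `|1 - (1 + 1) `^ (2 / p n - 1)| < e.
Proof.
move=> p2 e0.
have two0 : (1 + 1 : R) == 0 = false by rewrite gt_eqF.
have : (fun n => (1 + 1) `^ (2 / p n - 1)) @ \oo --> (1 + 1 : R) `^ (2 / 2 - 1).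
  rewrite /powR two0; apply: continuous_cvg; first exact: continuous_expR.
  apply: cvgM; last exact: cvg_cst.
  apply: cvgB; last exact: cvg_cst.
  by apply: cvgM; [exact: cvg_cst|apply: cvgV].
rewrite divff // subrr powRr0 => /cvgrPdist_lt /(_ e e0)[N _ NP].
by exists N => n; exact: NP.
Qed.

Lemma quad_mono (X : completeNormedModType K) (c d : R) (x y : X) : c <= d ->
  0 <= quad 1 (-1) c c x y -> 0 <= quad 1 (-1) d d x y.
Proof.
move=> cd; rewrite /quad; move: (_ + rnorm _ ^+ 2) => S.
have := sqr_ge0 (rnorm x); have := sqr_ge0 (rnorm y).
by move: (rnorm x ^+ 2) (rnorm y ^+ 2) => a b; nra.
Qed.

Lemma upper_asymptotic (V : nat -> completeNormedModType K) (p : nat -> R) :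
  (forall n, 1 <= p n < 2) -> p @ \oo --> (2 : R) ->
  (forall n (x y : V n), rnorm (x + y) ^+ 2 + rnorm (x - y) ^+ 2 <=
    2 * (rnorm x `^ p n + rnorm y `^ p n) `^ (2 / p n)) ->
  forall e : R, 0 < e -> exists N, forall n, (N <= n)%N -> forall x y : V n,
    0 <= quad 1 (-1) (2 + e) (2 + e) x y.
Proof.
move=> p_range p2 Vp e e0; have e2 : 0 < e / 2 by rewrite divr_gt0.
have [N NP] := cvg_tangent1 p2 e2; exists N => n Nn x y.
have /andP[p1 pn2] := p_range n; have p0 : 0 < p n := lt_le_trans ltr01 p1.
have := quad_up_ge x y ltr01 p0 (lexx _) (ltW pn2) (@Vp n).
rewrite /quad_up !powR1 subrr mulr0 mul0r mulr1; apply: quad_mono.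
have := NP n Nn; rewrite ltr_norml => /andP[h _].
by move: h; move: ((1 + 1) `^ _) => t; lra.
Qed.

Lemma lower_asymptotic (V : nat -> completeNormedModType K) (q : nat -> R) :
  (forall n, 2 < q n) -> q @ \oo --> (2 : R) ->
  (forall n (x y : V n), 2 * (rnorm x `^ q n + rnorm y `^ q n) `^ (2 / q n) <=
    rnorm (x + y) ^+ 2 + rnorm (x - y) ^+ 2) ->
  forall e : R, 0 < e -> exists N, forall n, (N <= n)%N -> forall x y : V n,
    0 <= quad 1 (-1) (2 + e) (2 + e) x y.
Proof.
(* The tolerance satisfies [1 - e/(2+e) = 2/(2+e)], so a factor [t] above it has [2/t <= 2 + e].
   Below, (3) is used at [x + y] and [x - y], where a lower estimate turns into an upper one for [x]
   and [y]. *)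
move=> q_range q2 Vq e e0; have e2 : 0 < e / (2 + e) by rewrite divr_gt0 // addr_gt0.
have [N NP] := cvg_tangent1 q2 e2; exists N => n Nn x y.
have := quad_down_ge (x + y) (x - y) ltr01 (lexx _) (ltW (q_range n)) (@Vq n).
rewrite /quad_down !powR1 subrr mulr0 mul0r mulr1 /quad real_scalar1 !scale1r.
have two (z : V n) : rnorm (z + z) ^+ 2 = 4 * rnorm z ^+ 2.
  have -> : z + z = real_scalar k 2 *: z.
    by rewrite real_scalarD real_scalar1 scalerDl scale1r.
  by rewrite rnormZr ger0_norm // exprMn; congr (_ * _); ring.
have -> : x + y + (x - y) = x + x by rewrite addrACA subrr addr0.
have -> : x + y - (x - y) = y + y by rewrite opprB [LHS]addrC addrA subrK.
rewrite !two.
have : 2 <= (2 + e) * (1 + 1) `^ (2 / q n - 1).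
  have := NP n Nn; rewrite ltr_norml => /andP[_ h].
  have : (2 + e) * (1 - (1 + 1) `^ (2 / q n - 1)) <= e.
    rewrite mulrC -ler_pdivlMr ?addr_gt0 //; exact: ltW.
  by move: ((1 + 1) `^ _) => t; lra.
have := sqr_ge0 (rnorm (x + y)); have := sqr_ge0 (rnorm (x - y)).
move: (rnorm (x + y) ^+ 2) (rnorm (x - y) ^+ 2) (rnorm x ^+ 2) (rnorm y ^+ 2).
move: ((1 + 1) `^ _) => t a b c d a0 b0 h1 h2; nra.
Qed.

End AsymptoticSums.

(** * Infinite cardinals *)

Section Comparability.
Variables (T : Type) (t0 : T).

(** A maximal partial injection from [A] to [B] exhausts one of the two sets, for otherwise one more
    pair could be added. The point [t0] is the value outside the domain. *)
Lemma set_comparable (A B : set T) :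
  (exists f : T -> T, (forall x, A x -> B (f x)) /\
    forall x y, A x -> A y -> f x = f y -> x = y) \/
  (exists f : T -> T, (forall x, B x -> A (f x)) /\
    forall x y, B x -> B y -> f x = f y -> x = y).
Proof.
pose P (G : set (T * T)) := [/\ forall a b, G (a, b) -> A a /\ B b,
  forall a b b', G (a, b) -> G (a, b') -> b = b' &
  forall a a' b, G (a, b) -> G (a', b) -> a = a'].
have [|G [[G1 G2 G3] Gmax]] := @Zorn_bigcup _ P.
  move=> F FP Ftot.
  have two g h : (\bigcup_(X in F) X) g -> (\bigcup_(X in F) X) h ->
      exists2 X, F X & X g /\ X h.
    move=> [X FX Xg] [Y FY Yh]; have [XY|YX] := Ftot X Y FX FY.
      by exists Y => //; split => //; exact: XY.
    by exists X => //; split => //; exact: YX.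
  split.
  - by move=> a b [X /FP[X1 _ _]]; exact: X1.
  - by move=> a b b' g h; have [X /FP[_ X2 _] [Xg Xh]] := two _ _ g h; exact: X2 Xg Xh.
  - by move=> a a' b g h; have [X /FP[_ _ X3] [Xg Xh]] := two _ _ g h; exact: X3 Xg Xh.
have [[a [Aa Ga]]|Adom] := pselect (exists a, A a /\ forall b, ~ G (a, b)); last first.
  have /choice[f fP] : forall a, exists b, A a -> G (a, b).
    move=> a; have [[b Gb]|nb] := pselect (exists b, G (a, b)); first by exists b.
    exists t0 => Aa; exfalso; apply: Adom; exists a; split => // b Gb.
    by apply: nb; exists b.
  left; exists f; split; first by move=> x /fP/G1[].
  by move=> x y /fP Gx /fP Gy xy; rewrite xy in Gx; exact: G3 Gx Gy.
have [[b [Bb Gb]]|Bdom] := pselect (exists b, B b /\ forall a, ~ G (a, b)); last first.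
  have /choice[f fP] : forall b, exists a, B b -> G (a, b).
    move=> b; have [[c Gc]|nc] := pselect (exists a, G (a, b)); first by exists c.
    exists t0 => Bb; exfalso; apply: Bdom; exists b; split => // c Gc.
    by apply: nc; exists c.
  right; exists f; split; first by move=> x /fP/G1[].
  by move=> x y /fP Gx /fP Gy xy; rewrite xy in Gx; exact: G2 Gx Gy.
exfalso; apply: (Gmax (G `|` [set (a, b)])).
  split; first by move=> x Gx; left.
  by move=> GG; apply: (Ga b); apply: GG; right.
split.
- by move=> c d [/G1//|[-> ->]].
- move=> c d d' [g|[E1 E2]] [h|[E3 E4]]; [exact: G2 g h| | |by rewrite E2 E4].
  + by move: g; rewrite E3 => /Ga.
  + by move: h; rewrite E1 => /Ga.
- move=> c c' d [g|[E1 E2]] [h|[E3 E4]]; [exact: G3 g h| | |by rewrite E1 E3].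
  + by move: g; rewrite E4 => /Gb.
  + by move: h; rewrite E2 => /Gb.
Qed.

End Comparability.

Section Pairing.
Variables (T : Type) (num : nat -> T).
Hypothesis num_inj : injective num.

(** The underlying set of a partial pairing is read off its diagonal entries, so that one relation
    carries both the set and the injection of its square into it. *)
Let dom (G : set (T * T * T)) := [set x | exists c, G (x, x, c)].

Let pairing (G : set (T * T * T)) := [/\
  forall a b c, G (a, b, c) -> [/\ dom G a, dom G b & dom G c],
  forall a b, dom G a -> dom G b -> exists c, G (a, b, c),
  forall a b c c', G (a, b, c) -> G (a, b, c') -> c = c' &
  forall a b a' b' c, G (a, b, c) -> G (a', b', c) -> a = a' /\ b = b'].

Let G0 : set (T * T * T) := [set g | exists m n, g = (num m, num n, num (pickle (m, n)))].

Let dom_G0 n : dom G0 (num n).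
Proof. by exists (num (pickle (n, n))), n, n. Qed.

Let pairing_G0 : pairing G0.
Proof.
split.
- by move=> a b c [m [n [-> -> ->]]]; split; exact: dom_G0.
- move=> a b [c [m [_ [-> _ _]]]] [d [n [_ [-> _ _]]]].
  by exists (num (pickle (m, n))), m, n.
- by move=> a b c c' [m [n [-> -> ->]]] [m' [n' [/num_inj-> /num_inj-> ->]]].
- move=> a b a' b' c [m [n [-> -> ->]]] [m' [n' [-> -> /num_inj E]]].
  by have [-> ->] : (m, n) = (m', n') by exact: (pcan_inj pickleK).
Qed.

(** Joining [G0] to every relation takes care of the empty chain and forces the maximal pairing to
    contain the numerals. *)
Let pairing_chain (F : set (set (T * T * T))) :
  F `<=` [set G | pairing (G `|` G0)] -> total_on F subset ->
  pairing ((\bigcup_(X in F) X) `|` G0).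
Proof.
move=> FP Ftot; set H := _ `|` _.
have two g h : H g -> H h -> exists X, [/\ pairing X, X `<=` H, X g & X h].
  have FX X : F X -> X `|` G0 `<=` H.
    by move=> FX x [Xx|]; [left; exists X|right].
  move=> [[X FXX Xg]|Gg] [[Y FY Yh]|Gh].
  - have [XY|YX] := Ftot X Y FXX FY.
      exists (Y `|` G0); split; [exact: FP|exact: FX|left; exact: XY|by left].
    exists (X `|` G0); split; [exact: FP|exact: FX|by left|left; exact: YX].
  - exists (X `|` G0); split; [exact: FP|exact: FX|by left|by right].
  - exists (Y `|` G0); split; [exact: FP|exact: FX|by right|by left].
  - by exists G0; split => // x; right.
split.
- move=> a b c g; have [X [[X1 _ _ _] XH Xg _]] := two _ _ g g.
  by have [[u Xu] [v Xv] [w Xw]] := X1 _ _ _ Xg; split; [exists u|exists v|exists w]; exact: XH.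
- move=> a b [c g] [d h]; have [X [[_ X2 _ _] XH Xg Xh]] := two _ _ g h.
  by have [|| e Xe] := X2 a b; [exists c|exists d|exists e; exact: XH].
- by move=> a b c c' g h; have [X [[_ _ X3 _] _ Xg Xh]] := two _ _ g h; exact: X3 Xg Xh.
- by move=> a b a' b' c g h; have [X [[_ _ _ X4] _ Xg Xh]] := two _ _ g h; exact: X4 Xg Xh.
Qed.

Let pairing_fun (G : set (T * T * T)) : pairing G -> exists f : T -> T -> T,
  (forall a b, dom G a -> dom G b -> G (a, b, f a b)) /\
  forall a b a' b', dom G a -> dom G b -> dom G a' -> dom G b' ->
    f a b = f a' b' -> a = a' /\ b = b'.
Proof.
move=> [_ G2 _ G4].
have /choice[f fP] : forall ab : T * T, exists c, dom G ab.1 -> dom G ab.2 -> G (ab.1, ab.2, c).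
  move=> [a b]; have [Da|nDa] := pselect (dom G a); last by exists a => /nDa.
  have [Db|nDb] := pselect (dom G b); last by exists a => _ /nDb.
  by have [c] := G2 a b Da Db; exists c.
exists (fun a b => f (a, b)); split; first by move=> a b; exact: (fP (a, b)).
move=> a b a' b' Da Db Da' Db' E.
have := fP (a, b) Da Db; rewrite E => g; exact: G4 g (fP (a', b') Da' Db').
Qed.

(** A maximal pairing lives on some set [D]. If the complement of [D] embeds in [D], then [T] embeds
    in [D] and inherits the pairing; by comparability the alternative is that [D] embeds in its
    complement, which contradicts maximality. *)
Lemma infinite_square : exists f : T -> T -> T,
  forall a b a' b', f a b = f a' b' -> a = a' /\ b = b'.
Proof.
have [G [PG Gmax]] := @Zorn_bigcup _ [set G | pairing (G `|` G0)] pairing_chain.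
set M := G `|` G0 in PG; set D := dom M.
have [f [fM f_inj]] := pairing_fun PG.
have [M1 M2 M3 M4] := PG.
have D_num n : D (num n) by have [c Gc] := dom_G0 n; exists c; right.
have fD a b : D a -> D b -> D (f a b) by move=> Da Db; have [] := M1 _ _ _ (fM a b Da Db).
(* [code] embeds D together with a set that [h] embeds in D into D *)
pose code (h : T -> T) x := if `[< D x >] then f (num 0) x else f (num 1) (h x).
have code_D h x : (~ D x -> D (h x)) -> D (code h x).
  by rewrite /code; case: asboolP => Dx hD; apply: fD => //; exact: hD.
have code_inj (h : T -> T) (E : set T) : (forall x, E x -> ~ D x -> D (h x)) ->
    (forall x y, E x -> E y -> ~ D x -> ~ D y -> h x = h y -> x = y) ->
    forall x y, E x -> E y -> code h x = code h y -> x = y.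
  move=> hD h_inj x y Ex Ey; rewrite /code.
  case: asboolP => Dx; case: asboolP => Dy /f_inj.
  - by move=> H; have [] := H (D_num _) Dx (D_num _) Dy.
  - move=> H; have [] := H (D_num _) Dx (D_num _) (hD _ Ey Dy).
    by move=> /num_inj.
  - move=> H; have [] := H (D_num _) (hD _ Ex Dx) (D_num _) Dy.
    by move=> /num_inj.
  - move=> H; have [] := H (D_num _) (hD _ Ex Dx) (D_num _) (hD _ Ey Dy).
    by move=> _; exact: h_inj.
have [[g [gD g_inj]]|[h [hD h_inj]]] := set_comparable (num 0) D (~` D); last first.
  exists (fun a b => f (code h a) (code h b)) => a b a' b' /f_inj[].
  - by apply: code_D; exact: hD.
  - by apply: code_D; exact: hD.
  - by apply: code_D; exact: hD.
  - by apply: code_D; exact: hD.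
  have c_inj x y : code h x = code h y -> x = y.
    apply: (@code_inj h setT) => //; first by move=> z _; exact: hD.
    by move=> u v _ _; exact: h_inj.
  by move=> /c_inj -> /c_inj ->.
(* Here [g] embeds [D] in its complement, and the pairing will be extended to [E], the union of [D]
   and its copy under [g]. *)
exfalso.
have /choice[h hP] : forall y, exists x, (exists2 x, D x & g x = y) -> D x /\ g x = y.
  move=> y; have [[x Dx xy]|n] := pselect (exists2 x, D x & g x = y); first by exists x.
  by exists y => /n.
pose E := [set y | D y \/ exists2 x, D x & g x = y].
have hD x : E x -> ~ D x -> D (h x).
  by move=> [//|/hP[]].
have h_inj x y : E x -> E y -> ~ D x -> ~ D y -> h x = h y -> x = y.
  move=> [//|/hP[_ hx]] [//|/hP[_ hy]] _ _ xy.
  exact: etrans (esym hx) (etrans (congr1 g xy) hy).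
have codeE x : E x -> D (code h x) by move=> Ex; apply: code_D; exact: hD.
pose c x := code h x.
have c_inj x y : E x -> E y -> c x = c y -> x = y by exact: code_inj.
(* A pair from [E] not contained in [D] is moved into [D] by [c], paired there by [f], and sent by
   [g] to the fresh copy, so its value cannot collide with an old one. *)
pose N := [set t : T * T * T | [/\ E t.1.1, E t.1.2, ~ (D t.1.1 /\ D t.1.2) &
  t.2 = g (f (c t.1.1) (c t.1.2))]].
have ND a b d : N (a, b, d) -> E d /\ ~ D d.
  move=> [/= /codeE ca /codeE cb _ ->]; have D' := fD _ _ ca cb.
  by split; [right; exists (f (c a) (c b))|exact: gD].
have domMN x : dom (M `|` N) x <-> E x.
  split; first by move=> [d [Mx|[]//]]; left; exists d.
  move=> Ex; have [[d Md]|nDx] := pselect (D x); first by exists d; left.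
  by exists (g (f (c x) (c x))); right; split => //= -[].
have MNab a b d : (M `|` N) (a, b, d) -> [/\ E a, E b & E d].
  move=> [/M1[Da Db Dd]|/[dup] /ND[Ed _] [Ea Eb _ _]] //.
  by split; left.
apply: (Gmax (M `|` N)).
  split; first by move=> x Gx; left; left.
  move=> /(_ (g (num 0), g (num 0), g (f (c (g (num 0))) (c (g (num 0))))))H.
  have nD : ~ D (g (num 0)) by exact: gD.
  have Eg : E (g (num 0)) by right; exists (num 0).
  have /M1[] : M (g (num 0), g (num 0), g (f (c (g (num 0))) (c (g (num 0))))).
    by left; apply: H; right; split => //= -[].
  by move=> /nD.
suff : pairing (M `|` N `|` G0) by [].
have -> : M `|` N `|` G0 = M `|` N.
  by apply/seteqP; split => x; [case=> // Gx; left; right|left].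
split.
- by move=> a b d /MNab[Ea Eb Ed]; split; apply/domMN.
- move=> a b /domMN Ea /domMN Eb.
  have [[Da Db]|nD] := pselect (D a /\ D b); first by exists (f a b); left; exact: fM.
  by exists (g (f (c a) (c b))); right.
- move=> a b d d' [Mg|Ng] [Mh|Nh].
  + exact: M3 Mg Mh.
  + by have [Da Db _] := M1 _ _ _ Mg; have [_ _ []] := Nh.
  + by have [Da Db _] := M1 _ _ _ Mh; have [_ _ []] := Ng.
  + by case: Ng Nh => [_ _ _ /= ->] [_ _ _ /= ->].
move=> a b a' b' d [Mg|Ng] [Mh|Nh].
- exact: M4 Mg Mh.
- by have [_ _ Dd] := M1 _ _ _ Mg; have [_ []] := ND _ _ _ Nh.
- by have [_ _ Dd] := M1 _ _ _ Mh; have [_ []] := ND _ _ _ Ng.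
case: Ng => [/= Ea Eb _ dE]; case: Nh => [/= Ea' Eb' _]; rewrite dE => /g_inj H.
have /f_inj [] := H (fD _ _ (codeE _ Ea) (codeE _ Eb)) (fD _ _ (codeE _ Ea') (codeE _ Eb')).
- exact: codeE.
- exact: codeE.
- exact: codeE.
- exact: codeE.
by move=> /c_inj -> // /c_inj ->.
Qed.

(** These lists encode finite combinations: a number for the approximate coefficient, then either a
    number for a vector spanning the separable part or an index into the orthonormal basis. *)
Lemma infinite_seq : exists f : seq (nat * (nat + T)) -> T, injective f.
Proof.
have [f f_inj] := infinite_square.
pose s (x : nat + T) := match x with inl n => f (num 0) (num n) | inr t => f (num 1) t end.
have s_inj : injective s.
  move=> [m|t] [n|u] /= /f_inj[].
  - by move=> _ /num_inj ->.
  - by move=> /num_inj.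
  - by move=> /num_inj.
  - by move=> _ ->.
pose e (x : nat * (nat + T)) := f (num x.1) (s x.2).
have e_inj : injective e.
  by move=> [m x] [n y] /f_inj /= [/num_inj -> /s_inj ->].
pose F (l : seq (nat * (nat + T))) := foldr (fun x t => f (e x) t) (num 0) l.
(* The length is stored as well because the fold does not mark where a list ends. *)
exists (fun l => f (num (size l)) (F l)) => l l' /f_inj[/num_inj].
elim: l l' => [|x l IH] [|y l'] //= [ll'] /f_inj[/e_inj -> /(IH _ ll') ->] //.
Qed.

End Pairing.

(** * Orthonormal families and density characters *)

Section FormalSums.
Variables (R : realType) (k : scalar_kind).
Local Notation K := (scalars R k).

Definition combination (W : lmodType K) (J : Type) (e : J -> W) (l : seq (K * J)) : W :=
  \sum_(p <- l) p.1 *: e p.2.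

Definition dense_span (W : completeNormedModType K) (J : Type) (e : J -> W) :=
  forall x (d : R), 0 < d -> exists l, rnorm (x - combination e l) < d.

Definition formal_add J (a : K) (l l' : seq (K * J)) : seq (K * J) :=
  [seq (a * p.1, p.2) | p <- l] ++ l'.

Lemma combination_add (W : lmodType K) J (e : J -> W) a l l' :
  combination e (formal_add a l l') = a *: combination e l + combination e l'.
Proof.
rewrite /combination big_cat big_map scaler_sumr /=; congr (_ + _).
by apply: eq_bigr => p _; rewrite scalerA.
Qed.

Lemma linear_correspondence (V W : completeNormedModType K) (J : Type)
    (e : J -> V) (f : J -> W) :
  dense_span e -> dense_span f ->
  (forall l, rnorm (combination e l) = rnorm (combination f l)) ->
  linearly_isometric V W.
Proof.
move=> eD fD ef.
(* This closure of the set of pairs of combinations with equal lists is shown to be the graph of an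
   isometry. *)
pose rel x y := forall d : R, 0 < d -> exists l,
  rnorm (x - combination e l) < d /\ rnorm (y - combination f l) < d.
have comb_sub (Y : lmodType K) (g : J -> Y) l l' :
    combination g l - combination g l' = combination g (formal_add (- 1) l' l).
  by rewrite combination_add scaleN1r addrC.
have rel_ex x : exists y, rel x y.
  have h0 n : 0 < 2^-1 ^+ n.+1 / 2 :> R by rewrite divr_gt0 ?exprn_gt0 ?invr_gt0.
  have [l lP] := choice (fun n => eD x _ (h0 n)).
  have lf : fast_cauchy (fun n => combination f (l n)).
    move=> n; rewrite comb_sub -ef -comb_sub.
    apply: le_trans (rnormB_trans _ x _) _; rewrite rnormBC.
    apply: le_trans (lerD (ltW (lP _)) (ltW (lP _))) _.
    rewrite !exprS; have : 0 <= 2^-1 ^+ n :> R by rewrite exprn_ge0.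
    by move: (2^-1 ^+ n) => h; lra.
  have [y yP] := fast_cauchy_cvg lf; exists y => d d0.
  have [n nP] := exp_half_small (divr_gt0 d0 (ltr0Sn R 1)).
  exists (l n); split.
    apply: lt_trans (lP n) _; have := nP _ (leqnSn n).
    have : 0 < 2^-1 ^+ n.+1 :> R by rewrite exprn_gt0 ?invr_gt0.
    by move: (2^-1 ^+ n.+1) => h; lra.
  by apply: le_lt_trans (yP n) _; have := nP _ (leqnn n); move: (2^-1 ^+ n) => h; lra.
have rel_lin a x y x' y' : rel x y -> rel x' y' -> rel (a *: x + x') (a *: y + y').
  move=> xy xy' d d0; have A0 : 0 < rnorm a + 1 by rewrite ltr_wpDl ?rnorm_ge0.
  have d1 : 0 < d / 2 / (rnorm a + 1) by rewrite !divr_gt0.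
  have d2 : 0 < d / 2 by rewrite divr_gt0.
  have [l [xl yl]] := xy _ d1; have [l' [xl' yl']] := xy' _ d2.
  have close (Y : completeNormedModType K) (g : J -> Y) u u' :
      rnorm (u - combination g l) < d / 2 / (rnorm a + 1) ->
      rnorm (u' - combination g l') < d / 2 ->
      rnorm (a *: u + u' - combination g (formal_add a l l')) < d.
    move=> ul ul'; rewrite combination_add opprD addrACA -scalerBr.
    apply: le_lt_trans (rnormD _ _) _; rewrite [ltRHS]splitr ler_ltD //.
    rewrite rnormZ; move: ul; rewrite ltr_pdivlMr // => /ltW; apply: le_trans.
    by rewrite mulrC ler_wpM2l ?rnorm_ge0 // lerDl.
  by exists (formal_add a l l'); split; exact: close.
have rel_norm x y : rel x y -> rnorm x = rnorm y.
  move=> xy; apply/eqP; rewrite -subr_eq0 -normr_le0; apply/ler_addgt0Pr => d d0.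
  have d2 : 0 < d / 2 by rewrite divr_gt0.
  rewrite add0r; have [l [xl yl]] := xy _ d2.
  apply: le_trans (ler_distD (rnorm (combination e l)) _ _) _; rewrite [leRHS]splitr lerD //.
    by apply: le_trans (rnorm_lip _ _) (ltW xl).
  by rewrite ef; apply: le_trans (rnorm_lip _ _) _; rewrite rnormBC ltW.
have [t tP] := choice rel_ex.
have rel_fun x y y' : rel x y -> rel x y' -> y = y'.
  move=> xy xy'; apply/eqP; rewrite -subr_eq0; apply/eqP/rnorm_eq0.
  have := rel_norm _ _ (rel_lin (- 1) _ _ _ _ xy' xy).
  by rewrite !scaleN1r addNr rnorm0 [_ + y]addrC => <-.
have t_lin : linear t.
  by move=> a x y; apply: rel_fun (tP _) (rel_lin _ _ _ _ _ (tP x) (tP y)).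
have [T TE] := linear_pack t_lin; exists T; split.
  by apply: isometry_rnorm => x; rewrite TE; apply/esym; exact: rel_norm.
apply/seteqP; split => // y _.
have T_isom : linear_isometry T.
  by apply: isometry_rnorm => x; rewrite TE; apply/esym; exact: rel_norm.
have [|x xE] := isometry_closed_range T_isom (y := y); last by exists x.
move=> d d0; have [l yl] := fD y d d0; exists (combination e l).
rewrite TE (rel_fun _ _ (combination f l) (tP _)) // => c c0.
by exists l; rewrite !subrr !rnorm0.
Qed.

Section OrthonormalFamilies.
Implicit Types H : completeNormedModType K.

(** Quantifying over the scalars [a] and [b] expresses complex orthogonality by the real part alone,
    so both scalar fields are treated together. *)
Definition orthonormal_family H (J : Type) (e : J -> H) :=
  (forall i, rnorm (e i) = 1) /\
  forall i j, i <> j -> forall a b : K, re_ip (a *: e i) (b *: e j) = 0.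

Lemma re_ip_suml H (Hpar : parallelogram H) (A : Type) (l : seq A) (F : A -> H) y :
  re_ip (\sum_(p <- l) F p) y = \sum_(p <- l) re_ip (F p) y.
Proof.
elim: l => [|p l IH]; last by rewrite !big_cons re_ipDl // IH.
by rewrite !big_nil /re_ip add0r sub0r rnormN subrr mul0r.
Qed.

Lemma rnorm_combination H H' (J : Type) (e : J -> H) (f : J -> H') l :
  parallelogram H -> parallelogram H' ->
  orthonormal_family e -> orthonormal_family f ->
  rnorm (combination e l) = rnorm (combination f l).
Proof.
move=> Hpar Hpar' [e1 eo] [f1 fo]; apply: eq_sqr_rnorm.
have gram (X : completeNormedModType K) (g : J -> X) : parallelogram X ->
    rnorm (combination g l) ^+ 2 =
    \sum_(p <- l) \sum_(q <- l) re_ip (p.1 *: g p.2) (q.1 *: g q.2).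
  move=> Xpar; rewrite -re_ipxx // re_ip_suml //; apply: eq_bigr => p _.
  by rewrite re_ipC re_ip_suml //; apply: eq_bigr => q _; rewrite re_ipC.
rewrite !gram //; apply: eq_bigr => p _; apply: eq_bigr => q _.
have [->|pq] := pselect (p.2 = q.2); last by rewrite eo // fo.
by rewrite /re_ip -!scalerDl -!scalerBl !rnormZ e1 f1.
Qed.

Lemma hilbert_isometric H H' (J : Type) (e : J -> H) (f : J -> H') :
  parallelogram H -> parallelogram H' ->
  orthonormal_family e -> orthonormal_family f -> dense_span e -> dense_span f ->
  linearly_isometric H H'.
Proof.
move=> Hpar Hpar' eo fo eD fD; apply: linear_correspondence eD fD _ => l.
exact: rnorm_combination.
Qed.

Section Basis.
Variable H : completeNormedModType K.
Hypothesis Hpar : parallelogram H.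

Let re_ip_closest (v y : H) : (forall t : R, rnorm v <= rnorm (v - real_scalar k t *: y)) ->
  re_ip y v = 0.
Proof.
move=> vy; apply: (@small_eq0 R _ (rnorm y ^+ 2)) => [|t /andP[t0 _]]; first exact: sqr_ge0.
have expand (s : R) : rnorm (v - real_scalar k s *: y) ^+ 2 =
    rnorm v ^+ 2 - 2 * s * re_ip y v + s ^+ 2 * rnorm y ^+ 2.
  rewrite -!re_ipxx // -scaleNr -real_scalarN re_ipDl // !re_ipDr // !re_ipZl //.
  by rewrite (re_ipC v) (re_ipC y (_ *: _)) !re_ipZl //; ring.
have bound (s : R) : 2 * s * re_ip y v <= s ^+ 2 * rnorm y ^+ 2.
  have : rnorm v ^+ 2 <= rnorm (v - real_scalar k s *: y) ^+ 2.
    by rewrite ler_sqr ?nnegrE ?rnorm_ge0.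
  by rewrite expand; move: (re_ip y v) (rnorm v ^+ 2) => r a; lra.
have b1 := bound t; have b2 := bound (- t).
rewrite ler_norml; move: b1 b2; rewrite sqrrN.
move: (re_ip y v) (rnorm y ^+ 2) (sqr_ge0 (rnorm y)) => r a a0 b1 b2.
apply/andP; split; rewrite -(ler_pM2l t0); nra.
Qed.

(** The set [S] is not assumed closed, so the limit [m] of a minimising sequence lies in its
    closure. The parallelogram law makes that sequence Cauchy. *)
Lemma closest_point (S : set H) (x : H) :
  (forall a y z, S y -> S z -> S (a *: y + z)) -> S 0 ->
  exists m, (forall d : R, 0 < d -> exists2 y, S y & rnorm (m - y) < d) /\
    forall y, S y -> re_ip y (x - m) = 0.
Proof.
move=> Slin S0.
pose A := [set rnorm (x - y) | y in S].
have A_inf : has_inf A.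
  split; first by exists (rnorm (x - 0)), 0.
  by exists 0 => _ [y _ <-]; exact: rnorm_ge0.
pose r := inf A.
have r0 : 0 <= r by apply: lb_le_inf; [case: A_inf|move=> _ [y _ <-]; exact: rnorm_ge0].
have r_le y : S y -> r <= rnorm (x - y).
  by move=> Sy; apply: (ge_inf A_inf.2); exists y.
have D_le y : S y -> r ^+ 2 <= rnorm (x - y) ^+ 2.
  by move=> /r_le; rewrite ler_sqr ?nnegrE ?rnorm_ge0.
have c0 : 0 < 2 * r + 1 by rewrite ltr_wpDl ?mulr_ge0.
(* Since [eps n <= 1], the square of [r + eps n] exceeds [r ^+ 2] by at most [eps n * (2 * r + 1)],
   a quarter of the square of [2^-1 ^+ n]. The factor 4 in [dist] then gives the rate of
   [fast_cauchy]. *)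
pose eps n : R := (2^-1 ^+ n) ^+ 2 / 4 / (2 * r + 1).
have eps0 n : 0 < eps n by rewrite !divr_gt0 ?exprn_gt0 ?invr_gt0.
have half_le1 n : 0 <= (2^-1 ^+ n : R) <= 1.
  by rewrite exprn_ge0 ?invr_ge0 //= exprn_ile1 ?invr_ge0 // invf_le1 // ler1n.
have eps_le n : eps n <= 2^-1 ^+ n.
  have /andP[h0 h1] := half_le1 n.
  rewrite !ler_pdivrMr //; move: (2^-1 ^+ n) h0 h1 => h h0 h1.
  by have := mulr_ge0 h0 r0; nra.
have /choice[u uP] n : exists y, S y /\ rnorm (x - y) < r + eps n.
  have [_ [y Sy <-] yD] := inf_adherent (eps0 n) A_inf.
  by exists y.
have uD n : rnorm (x - u n) ^+ 2 <= r ^+ 2 + (2^-1 ^+ n) ^+ 2 / 4.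
  have -> : (2^-1 ^+ n) ^+ 2 / 4 = eps n * (2 * r + 1) by rewrite divfK ?gt_eqF.
  have A0 : 0 <= r + eps n := addr_ge0 r0 (ltW (eps0 n)).
  have := ltW (uP n).2; rewrite -ler_sqr ?nnegrE ?rnorm_ge0 //.
  have : eps n <= 1 by apply: le_trans (eps_le n) _; case/andP: (half_le1 n).
  by move: (eps n) (eps0 n) (rnorm (x - u n) ^+ 2) => t t0 a t1; nra.
have S_half y z : S y -> S z -> S (real_scalar k 2^-1 *: (y + z)).
  move=> Sy Sz; have := Slin 1 y z Sy Sz; rewrite scale1r => Syz.
  by have := Slin (real_scalar k 2^-1) _ _ Syz S0; rewrite addr0.
have dist y z d : S y -> S z -> rnorm (x - y) ^+ 2 <= r ^+ 2 + d ->
    rnorm (x - z) ^+ 2 <= r ^+ 2 + d ->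
    rnorm (y - z) ^+ 2 <= 4 * d.
  move=> Sy Sz yD zD; have := Hpar (x - y) (x - z).
  have -> : x - y + (x - z) = real_scalar k 2 *: (x - real_scalar k 2^-1 *: (y + z)).
    rewrite scalerBr scalerA -real_scalarM mulfV // real_scalar1 scale1r.
    by rewrite real_scalarD real_scalar1 scalerDl scale1r opprD addrACA.
  have -> : x - y - (x - z) = z - y by rewrite opprB addrC addrA subrK.
  rewrite rnormZr ger0_norm // exprMn (rnormBC z).
  have := D_le _ (S_half y z Sy Sz).
  move: yD zD; move: (rnorm (x - _) ^+ 2) (rnorm (x - y) ^+ 2) (rnorm (x - z) ^+ 2).
  by move: (rnorm (y - z) ^+ 2) => a b c e; lra.
have uf : fast_cauchy u.
  move=> n; rewrite -ler_sqr ?nnegrE ?rnorm_ge0 ?exprn_ge0 ?invr_ge0 //.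
  have := dist _ _ ((2^-1 ^+ n) ^+ 2 / 4) (uP n.+1).1 (uP n).1 _ (uD n).
  have -> : 4 * ((2^-1 ^+ n) ^+ 2 / 4) = (2^-1 ^+ n) ^+ 2 :> R by field.
  apply; apply: le_trans (uD n.+1) _; rewrite lerD2l ler_pM2r ?invr_gt0 //.
  rewrite ler_sqr ?nnegrE ?exprn_ge0 ?invr_ge0 //.
  by rewrite exprS ler_piMl ?exprn_ge0 ?invr_ge0 // invf_le1 // ler1n.
have [m mP] := fast_cauchy_cvg uf; exists m.
have mS (d : R) : 0 < d -> exists n, rnorm (m - u n) < d /\ eps n < d.
  move=> d0; have [n /(_ n (leqnn n)) nP] := exp_half_small (divr_gt0 d0 (ltr0Sn R 1)).
  exists n; split.
    by apply: le_lt_trans (mP n) _; move: (2^-1 ^+ n) nP => h; lra.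
  apply: le_lt_trans (eps_le n) _; have /andP[h0 _] := half_le1 n.
  by move: (2^-1 ^+ n) h0 nP => h; lra.
split; first by move=> d /mS[n [mn _]]; exists (u n) => //; case: (uP n).
move=> y Sy; apply: re_ip_closest => t; apply: (@le_trans _ _ r).
  apply/ler_addgt0Pr => d d0; have d2 : 0 < d / 2 by rewrite divr_gt0.
  have [n [mn nd]] := mS _ d2; apply: le_trans (rnormB_trans _ (u n) _) _.
  have := ltW (uP n).2; rewrite (rnormBC (u n)); move: mn nd.
  move: (rnorm (m - u n)) (rnorm (x - u n)) (eps n) => a b c; lra.
apply/ler_addgt0Pr => d /mS[n [mn _]].
have Sn : S (real_scalar k t *: y + u n) by apply: Slin => //; case: (uP n).
apply: le_trans (r_le _ Sn) _.
have -> : x - (real_scalar k t *: y + u n) = (x - m - real_scalar k t *: y) + (m - u n).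
  by rewrite opprD addrA [RHS]addrA addrAC (addrAC _ _ m) subrK addrAC.
by apply: le_trans (rnormD _ _) _; rewrite lerD2l ltW.
Qed.

End Basis.
End OrthonormalFamilies.
End FormalSums.

Section OrthonormalBasis.
Variables (R : realType) (k : scalar_kind).
Local Notation K := (scalars R k).
Variable H : completeNormedModType K.
Hypothesis Hpar : parallelogram H.

Lemma rnormM_scalar (a b : K) : rnorm (a * b) = rnorm a * rnorm b.
Proof.
by apply: (can_inj (@real_scalarK R k)); rewrite real_scalarM -!normr_rnorm normrM.
Qed.

(** A nonzero scalar is a positive real times one of modulus 1. The former leaves the real inner
    product as a factor, and the latter is moved to [y], which stays in [S]. *)
Let orthogonal_scale (S : set H) (v : H) : (forall (a : K) y, S y -> S (a *: y)) ->
  (forall y, S y -> re_ip y v = 0) -> forall (a : K) y, S y -> re_ip y (a *: v) = 0.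
Proof.
move=> Sscale Sv a y Sy.
have [->|a0] := eqVneq a 0.
  by rewrite scale0r /re_ip addr0 subr0 subrr mul0r.
have r0 : 0 < rnorm a.
  by rewrite lt_def rnorm_ge0 andbT; apply: contra a0 => /eqP/rnorm_eq0->.
pose u := real_scalar k (rnorm a)^-1 * a.
have u1 : rnorm u = 1.
  by rewrite rnormM_scalar rnorm_real_scalar ?invr_ge0 ?rnorm_ge0 // mulVf ?gt_eqF.
have un0 : u != 0 by apply/eqP => u0; move: u1; rewrite u0 rnorm0 => /eqP; rewrite eq_sym oner_eq0.
have -> : a *: v = real_scalar k (rnorm a) *: (u *: v).
  by rewrite scalerA mulrA -real_scalarM mulfV ?gt_eqF // real_scalar1 mul1r.
rewrite re_ipC re_ipZl // re_ipC -[y](scalerKV un0) re_ip_unit //.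
by rewrite Sv ?mulr0 //; exact: Sscale.
Qed.

(** If the span of a maximal orthonormal set were not dense, the residual of a point at its closest
    point would, after normalisation, enlarge the set. *)
Lemma orthonormal_basis : exists B : set H,
  orthonormal_family (fun b : set_type B => val b) /\
  dense_span (fun b : set_type B => val b).
Proof.
pose P (B : set H) := (forall b, B b -> rnorm b = 1) /\
  forall b c, B b -> B c -> b <> c -> forall a a' : K, re_ip (a *: b) (a' *: c) = 0.
have [|B [[B1 Bo] Bmax]] := @Zorn_bigcup _ P.
  move=> F FP Ftot; split; first by move=> b [X /FP[X1 _]]; exact: X1.
  move=> b c [X FX Xb] [Y FY Yc].
  have [XY|YX] := Ftot X Y FX FY.
    by have [_ Yo] := FP Y FY; apply: Yo => //; exact: XY.
  by have [_ Xo] := FP X FX; apply: Xo => //; exact: YX.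
exists B; split.
  split; first by move=> b; apply: B1; exact: set_valP.
  move=> b c bc; apply: Bo; [exact: set_valP|exact: set_valP|].
  by move=> E; apply: bc; exact: val_inj.
apply: contrapT => /existsNP[x /existsNP[d /not_implyP[d0 /forallNP xd]]].
pose S := range (combination (fun b : set_type B => val b)).
have Slin a y z : S y -> S z -> S (a *: y + z).
  by move=> [l _ <-] [l' _ <-]; exists (formal_add a l l') => //; rewrite combination_add.
have S0 : S 0 by exists [::] => //; rewrite /combination big_nil.
have SB b (Bb : B b) : S b.
  exists [:: (1, SigSub (mem_set Bb) : set_type B)] => //.
  by rewrite /combination big_seq1 scale1r.
have Sscale (a : K) y : S y -> S (a *: y).
  by move=> Sy; rewrite -[a *: y]addr0; exact: Slin.
have [m [mS mo]] := closest_point Hpar x Slin S0.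
pose v := x - m.
have vn0 : rnorm v != 0.
  apply/eqP => /rnorm_eq0 /subr0_eq xm; have [_ [l _ <-]] := mS d d0.
  by rewrite -xm; exact: xd.
have v0 : 0 < rnorm v by rewrite lt_def vn0 rnorm_ge0.
pose w := real_scalar k (rnorm v)^-1 *: v.
have w1 : rnorm w = 1.
  by rewrite rnormZr ger0_norm ?invr_ge0 ?rnorm_ge0 // mulVf.
have wo y (a : K) : S y -> re_ip y (a *: w) = 0.
  by move=> Sy; rewrite scalerA; exact: orthogonal_scale Sscale mo _ _ Sy.
have nBw : ~ B w.
  move=> /SB/(wo _ 1); rewrite scale1r re_ipxx // w1 expr1n => /eqP.
  by rewrite oner_eq0.
apply: (Bmax (B `|` [set w])).
  split; first by move=> b Bb; left.
  by move=> BB; apply: nBw; apply: BB; right.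
split; first by move=> b [/B1//|->].
move=> b c [Bb|->] [Bc|->] bc a a'.
- exact: Bo.
- by apply: wo; apply: Sscale; exact: SB.
- by rewrite re_ipC; apply: wo; apply: Sscale; exact: SB.
- by [].
Qed.

End OrthonormalBasis.

(** * Density characters *)

Section Density.
Variables (R : realType) (k : scalar_kind).
Local Notation K := (scalars R k).
Implicit Types W X H : completeNormedModType K.

Lemma dense_rnormP W (D : set W) :
  dense D <-> forall x (d : R), 0 < d -> exists2 y, D y & rnorm (x - y) < d.
Proof.
split=> [dD x d d0|dD O [x Ox] Oo].
  have d0' : 0 < real_scalar k d by rewrite -(real_scalar0 R k) ltr_real_scalar.
  have [||y [xy Dy]] := dD (ball x (real_scalar k d)).
  - by exists x; exact: ballxx.
  - exact: ball_open.
  exists y => //; move: xy; rewrite -ball_normE /= normr_rnorm ltr_real_scalar //.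
have /nbhs_ballP[e /= e0 eO] : nbhs x O by apply: open_nbhs_nbhs; split.
have re0 : 0 < scalar_re e.
  by rewrite -(ltr_real_scalar k) scalar_reK ?real_scalar0 // ltW.
have [y Dy xy] := dD x _ re0; exists y; split => //; apply: eO.
by rewrite -ball_normE /= normr_rnorm -(scalar_reK (ltW e0)) ltr_real_scalar.
Qed.

Lemma card_le_inj (T U : Type) (A : set T) (B : set U) (f : T -> U) :
  (forall x, A x -> B (f x)) -> (forall x y, A x -> A y -> f x = f y -> x = y) ->
  (A #<= B)%card.
Proof.
move=> fB f_inj.
have /card_eqPle[_ AfA] : (f @` A #= A)%card.
  by apply: inj_card_eq => x y /set_mem Ax /set_mem Ay; exact: f_inj.
by apply: card_le_trans AfA _; apply: subset_card_le => _ [x Ax <-]; exact: fB.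
Qed.

Lemma card_le_fun (T U : Type) (A : set T) (B : set U) : (A #<= B)%card ->
  exists f : set_type A -> U, (forall x, B (f x)) /\ injective f.
Proof.
move=> /card_leP[f].
exists (fun x => val (f x)); split; first by move=> x; exact: set_valP.
by move=> x y /val_inj; apply: inj; rewrite inE.
Qed.

Lemma scalar_dense : exists q : nat -> K, forall a (d : R), 0 < d ->
  exists n, rnorm (a - q n) < d.
Proof.
have real_dense (a d : R) : 0 < d -> exists r : rat, `|a - ratr r| < d.
  move=> d0; have /rat_in_itvoo[r] : a - d < a + d by rewrite ltrBlDr -addrA ltrDl addr_gt0.
  rewrite in_itv /= => /andP[r1 r2]; exists r; rewrite ltr_norml; apply/andP; split; lra.
case: (k).
  exists (fun n => if unpickle n is Some r then ratr r else 0 : R) => a d /(real_dense a)[r rP].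
  by exists (pickle r); rewrite pickleK.
exists (fun n => if unpickle n is Some rs then Complex (ratr rs.1) (ratr rs.2) : R[i] else 0).
move=> [a b] d d0; have d2 : 0 < d / 2 by rewrite divr_gt0.
have [r rP] := real_dense a _ d2; have [s sP] := real_dense b _ d2.
exists (pickle (r, s)); rewrite pickleK; apply: le_lt_trans (rnorm_complex_le _) _.
by rewrite [ltRHS]splitr; apply: ltrD.
Qed.

Lemma dense_of_span W (J : Type) (e : J -> W) : dense_span e ->
  exists g : seq (nat * J) -> W, dense (range g).
Proof.
move=> eD; have [q qP] := scalar_dense.
pose g (l : seq (nat * J)) := combination e [seq (q p.1, p.2) | p <- l].
exists g; apply/dense_rnormP => x d d0; have d2 : 0 < d / 2 by rewrite divr_gt0.
have [l lx] := eD x _ d2.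
have [l' ll'] : exists l', rnorm (combination e l - g l') < d / 2.
  elim: l (d / 2) d2 {lx} => [|[a j] l IH] c c0.
    by exists [::]; rewrite /g /combination !big_nil subrr rnorm0.
  have c2 : 0 < c / 2 by rewrite divr_gt0.
  have [l' ll'] := IH _ c2.
  have A0 : 0 < rnorm (e j) + 1 by rewrite ltr_wpDl ?rnorm_ge0.
  have [n an] := qP a _ (divr_gt0 c2 A0).
  exists ((n, j) :: l'); rewrite /g /combination /= !big_cons /= opprD addrACA -scalerBl.
  apply: le_lt_trans (rnormD _ _) _; rewrite [ltRHS]splitr; apply: ler_ltD ll'.
  rewrite rnormZ; move: an; rewrite ltr_pdivlMr // => /ltW; apply: le_trans.
  by rewrite ler_wpM2l ?rnorm_ge0 // lerDl.
exists (g l'); first by exists l'.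
apply: le_lt_trans (rnormB_trans _ (combination e l) _) _.
by rewrite [ltRHS]splitr ltrD.
Qed.

(** Orthonormal vectors are at distance [sqrt 2], so points of [D] within [1/2] of distinct ones are
    distinct. *)
Lemma orthonormal_card_le X H W (T : {linear W -> sum2 X H}) (J : Type) (e : J -> H)
    (D : set W) : parallelogram H -> linear_isometry T -> range T = setT ->
  orthonormal_family e -> dense D -> ([set: J] #<= D)%card.
Proof.
move=> Hpar Ti Tonto [e1 eo] /dense_rnormP dD.
have /choice[w wP] j : exists w, T w = (0, e j).
  by have [w _ wE] : range T (0, e j); [rewrite Tonto|exists w].
  have h0 : 0 < 2^-1 :> R by rewrite invr_gt0.
have /choice[f fP] j : exists y, D y /\ rnorm (w j - y) < 2^-1.
  by have [y Dy yw] := dD (w j) _ h0; exists y.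
apply: (@card_le_inj _ _ _ _ f) => [j _|i j _ _ fij]; first by case: (fP j).
apply: contrapT => ij.
have wij : rnorm (w i - w j) < 1.
  apply: le_lt_trans (rnormB_trans _ (f i) _) _; rewrite [ltRHS]splitr div1r.
  by rewrite ltrD //; [case: (fP i)|rewrite fij rnormBC; case: (fP j)].
have : rnorm (w i - w j) ^+ 2 = 2.
  rewrite -(rnorm_isometry Ti) linearB !wP sqr_rnorm_sum2 /= subrr rnorm0 expr0n add0r.
  have := eo i j ij 1 1; rewrite !scale1r /re_ip => /eqP.
  rewrite mulf_eq0 invr_eq0 (_ : 4 == 0 = false) ?orbF; last by rewrite pnatr_eq0.
  rewrite subr_eq0 => /eqP E; have := Hpar (e i) (e j).
  by rewrite E !e1 expr1n; move: (rnorm _ ^+ 2) => a; lra.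
have : rnorm (w i - w j) ^+ 2 < 1 by rewrite expr_lt1 ?rnorm_ge0.
by move=> h1 h2; move: h1; rewrite h2 ltrn1.
Qed.

Lemma dense_span_sum2 X H (I J : Type) (g : I -> X) (e : J -> H) :
  dense_span g -> dense_span e ->
  dense_span (fun x : I + J => match x with
    inl i => (g i, 0) | inr j => (0, e j) end : sum2 X H).
Proof.
move=> gD eD [x y] d d0; have d2 : 0 < d / 2 by rewrite divr_gt0.
have [l lx] := gD x _ d2; have [l' ly] := eD y _ d2.
exists ([seq (p.1, inl p.2) | p <- l] ++ [seq (p.1, inr p.2) | p <- l']).
set f := fun x : I + J => _.
have -> : combination f ([seq (p.1, inl p.2) | p <- l] ++ [seq (p.1, inr p.2) | p <- l']) =
    ((combination g l, combination e l') : sum2 X H).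
  rewrite /combination big_cat !big_map /=.
  have -> : \sum_(p <- l) p.1 *: ((g p.2, 0) : sum2 X H) =
      ((\sum_(p <- l) p.1 *: g p.2, 0) : sum2 X H).
    elim: l {lx} => [|p l IH]; first by rewrite !big_nil.
    by rewrite !big_cons IH; congr pair; rewrite /= scaler0 addr0.
  have -> : \sum_(p <- l') p.1 *: ((0, e p.2) : sum2 X H) =
      ((0, \sum_(p <- l') p.1 *: e p.2) : sum2 X H).
    elim: l' {ly} => [|p l' IH]; first by rewrite !big_nil.
    by rewrite !big_cons IH; congr pair; rewrite /= scaler0 addr0.
  by congr pair; rewrite /= ?addr0 ?add0r.
apply: (@le_lt_trans _ _ (rnorm (x - combination g l) + rnorm (y - combination e l'))).
  rewrite -ler_sqr ?nnegrE ?rnorm_ge0 ?addr_ge0 ?rnorm_ge0 // sqr_rnorm_sum2 /= sqrrD.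
  by rewrite lerD2r lerDl mulrn_wge0 // mulr_ge0 ?rnorm_ge0.
by rewrite [ltRHS]splitr ltrD.
Qed.

Lemma small_dense_set X H W (T : {linear W -> sum2 X H}) (J : Type)
    (g : nat -> X) (e : J -> H) :
  linear_isometry T -> range T = setT -> dense_span g -> dense_span e ->
  exists D : set W, dense D /\ (D #<= [set: seq (nat * (nat + J))])%card.
Proof.
move=> Ti Tonto gD eD.
have [f /dense_rnormP fD] := dense_of_span (dense_span_sum2 gD eD).
have /choice[h hP] l : exists w, T w = f l.
  by have [w _ wE] : range T (f l); [rewrite Tonto|exists w].
exists (range h); split; last exact: card_image_le.
apply/dense_rnormP => x d /(fD (T x))[_ [l _ <-] xl]; exists (h l); first by exists l.
by rewrite -(rnorm_isometry Ti) linearB hP.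
Qed.

Lemma infinite_seq_card (J : Type) : ~ countable [set: J] ->
  ([set: seq (nat * (nat + J))] #<= [set: J])%card.
Proof.
move=> Jn; have Jinf : infinite_set [set: J].
  by move=> /finite_set_countable.
have [f [_ f_inj]] := card_le_fun ((infiniteP _).1 Jinf).
pose num n := f (SigSub (mem_set (I : [set: nat] n))).
have num_inj : injective num by move=> m n /f_inj/(congr1 val).
have [h h_inj] := infinite_seq num_inj.
by apply: (@card_le_inj _ _ _ _ h) => // x y _ _; exact: h_inj.
Qed.

Lemma countable_seq_card (J : Type) : countable [set: J] ->
  countable [set: seq (nat * (nat + J))].
Proof.
move=> /card_le_fun[f [_ f_inj]].
pose h (x : nat * (nat + J)) : nat * (nat + nat) :=
  (x.1, match x.2 with inl n => inl n | inr j => inr (f (SigSub (mem_set (I : [set: J] j)))) end).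
have h_inj : injective h.
  move=> [m [n|i]] [m' [n'|j]] // [-> ]; first by move=> ->.
  by move=> /f_inj/(congr1 val) /= ->.
apply: (@card_le_inj _ _ _ _ (fun l => pickle [seq h x | x <- l])) => // x y _ _.
by move=> /(pcan_inj pickleK)/(inj_map h_inj).
Qed.

Lemma density_character_basis X H W (T : {linear W -> sum2 X H}) (J : Type)
    (g : nat -> X) (e : J -> H) : parallelogram H ->
  linear_isometry T -> range T = setT -> dense_span g ->
  orthonormal_family e -> dense_span e -> ~ countable [set: J] ->
  has_density_character W J.
Proof.
move=> Hpar Ti Tonto gD eo eD Jn; split; last first.
  by move=> D; exact: orthonormal_card_le Hpar Ti Tonto eo.
have [D [dD DJ]] := small_dense_set Ti Tonto gD eD.
exists D; split => //; apply/card_eqPle; split.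
  exact: card_le_trans DJ (infinite_seq_card Jn).
exact: orthonormal_card_le Hpar Ti Tonto eo dD.
Qed.

End Density.

(** * Categoricity *)

Section IsometryInverse.
Variables (R : realType) (k : scalar_kind).
Local Notation K := (scalars R k).
Implicit Types X Y Z W : completeNormedModType K.

Lemma isometry_inj X Y (T : {linear X -> Y}) : linear_isometry T -> injective T.
Proof.
move=> /rnorm_isometry Ti x y xy; apply/eqP; rewrite -subr_eq0; apply/eqP/rnorm_eq0.
by rewrite -Ti linearB xy subrr rnorm0.
Qed.

Lemma isometry_inverse X Y (T : {linear X -> Y}) : linear_isometry T -> range T = setT ->
  exists S : {linear Y -> X}, [/\ linear_isometry S, range S = setT & cancel S T].
Proof.
move=> Ti Tonto; have T_inj := isometry_inj Ti.
have /choice[s sP] y : exists x, T x = y.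
  by have [x _ xE] : range T y; [rewrite Tonto|exists x].
have [|S SE] := @linear_pack R k Y X s.
  by move=> a x y; apply: T_inj; rewrite linearP !sP.
exists S; split.
- by move=> y; rewrite -Ti SE sP.
- apply/seteqP; split => // x _; exists (T x) => //.
  by apply: T_inj; rewrite SE sP.
by move=> y; rewrite SE sP.
Qed.

Lemma linear_comp X Y Z (S : {linear Y -> Z}) (T : {linear X -> Y}) :
  linear_isometry S -> linear_isometry T ->
  exists ST : {linear X -> Z}, linear_isometry ST /\ forall x, ST x = S (T x).
Proof.
move=> Si Ti; have [|ST STE] := @linear_pack R k X Z (fun x => S (T x)).
  by move=> a x y; rewrite !linearP.
by exists ST; split => // x; rewrite STE Si Ti.
Qed.

Lemma linearly_isometric_sym X Y : linearly_isometric X Y -> linearly_isometric Y X.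
Proof. by move=> [T [Ti To]]; have [S [? ? _]] := isometry_inverse Ti To; exists S. Qed.

Lemma linearly_isometric_trans X Y Z :
  linearly_isometric X Y -> linearly_isometric Y Z -> linearly_isometric X Z.
Proof.
move=> [T [Ti To]] [S [Si So]]; have [ST [STi STE]] := linear_comp Si Ti.
exists ST; split => //; apply/seteqP; split => // z _.
have [y _ yz] : range S z by rewrite So.
have [x _ xy] : range T y by rewrite To.
by exists x => //; rewrite STE xy.
Qed.

Lemma linearly_isometric_sum2 X Y Z : linearly_isometric Y Z ->
  linearly_isometric (sum2 X Y) (sum2 X Z).
Proof.
move=> [T [Ti To]].
have [|S SE] := @linear_pack R k (sum2 X Y) (sum2 X Z) (fun z => (z.1, T z.2)).
  by move=> a x y; congr pair; rewrite /= linearP.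
exists S; split.
  apply: isometry_rnorm => z; apply: eq_sqr_rnorm.
  by rewrite SE !sqr_rnorm_sum2 /= (rnorm_isometry Ti).
apply/seteqP; split => // -[x z] _.
have [y _ yz] : range T z by rewrite To.
by exists ((x, y) : sum2 X Y) => //; rewrite SE /= yz.
Qed.

Lemma principal_ultrafilter : UltraFilter [set A : set unit | A tt].
Proof.
split.
  by split=> //; split => //= A B AB; exact: AB.
move=> G PG sub; apply/seteqP; split => A; last exact: sub.
move=> GA; apply: contrapT => nA.
have /sub GnA : [set A : set unit | A tt] (~` A) by [].
by have [[] []] := filter_ex (filterI GA GnA).
Qed.

(** The second ultrapower is taken along the principal ultrafilter on [unit], where the diagonal map
    is onto. *)
Lemma elementarily_equivalent_ultrapower (I : Type) (U : set_system I)
  (FU : UltraFilter U) X : elementarily_equivalent X (ultrapower FU X).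
Proof.
exists I, unit, U, [set A : set unit | A tt], FU, principal_ultrafilter.
have [d [di dE]] := ultra_diagonal principal_ultrafilter (ultrapower FU X).
exists d; split => //; apply/seteqP; split => // v _.
have [f <-] := ultra_class_surj v; exists (linf_fun f tt) => //.
by apply: dE; case.
Qed.

Section Uniqueness.
Variables (X : completeNormedModType K) (P : nat -> X -> X).
Hypothesis PA : asymptotically_hilbert P.
Hypothesis P_cvg : forall x (e : R), 0 < e -> exists N, rnorm (x - P N x) < e.
Hypothesis P_fin : forall N, fin_span (range (P N)).

Lemma hilbert_extension_id : exists j : {linear X -> X}, (forall x, j x = x) /\
  hilbert_extension P j.
Proof.
have [|j jE] := @linear_pack R k X X id; first by [].
exists j; split => //; split; first by move=> x; rewrite jE.
by exists P; split => // [N x|N w]; [rewrite !jE|exists w; rewrite jE].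
Qed.

(** The projections of [W] have their ranges in the copy of [X], so they restrict to every subspace
    containing that copy. *)
Lemma hilbert_extension_restrict Z W (d : {linear X -> W}) (i : {linear Z -> W}) :
  linear_isometry i -> hilbert_extension P d -> (forall x, exists z, i z = d x) ->
  exists j : {linear X -> Z}, hilbert_extension P j.
Proof.
move=> i_isom [d_isom [Q [QA Qd Q_range]]] /choice[s sP].
have i_inj := isometry_inj i_isom; have ir := rnorm_isometry i_isom.
have [|j jE] := @linear_pack R k X Z s.
  by move=> a x y; apply: i_inj; rewrite linearP !sP linearP.
have ij x : i (j x) = d x by rewrite jE.
have /choice[q qP] (Nz : nat * Z) : exists y, i y = Q Nz.1 (i Nz.2).
  by have [x ->] := Q_range Nz.1 (i Nz.2); exists (j (P Nz.1 x)).
exists j; split; first by move=> x; rewrite -i_isom ij d_isom.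
exists (fun N z => q (N, z)); split.
- split.
  + by move=> N a x y; apply: i_inj; rewrite linearP !qP /= linearP (proj_linear QA).
  + move=> N x; rewrite -ir (proj_pythag QA N) -(qP (N, x)) -linearB !ir //.
  + by move=> M N x; apply: i_inj; rewrite !qP (proj_comp QA).
  move=> e e0; have [_ _ _ /(_ e e0)[N NP]] := QA; exists N => x y x0 y0.
  rewrite -(quad_isometry _ _ _ _ _ _ i_isom); apply: NP.
    by rewrite -(qP (N, x)) x0 linear0.
  by rewrite -(qP (N, y)) y0 linear0.
- by move=> N x; apply: i_inj; rewrite qP /= !ij Qd.
by move=> N z; have [x xE] := Q_range N (i z); exists x; apply: i_inj; rewrite qP /= xE ij.
Qed.

Hypothesis X_rigid : forall H : completeNormedModType K, is_hilbert H ->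
  forall T : {linear X -> sum2 X H}, linear_isometry T ->
    range T = range (@sum2_inl R k X H).

(** In the decomposition of [W] given by [j], rigidity says that every isometric copy of [X] is the
    summand [X] itself. *)
Lemma rigid_extension_range W (j a : {linear X -> W}) :
  hilbert_extension P j -> linear_isometry a -> forall x, exists y, a y = j x.
Proof.
move=> [ji [Q [QA Qj Q_range]]] ai x.
have [H [T [Hh Ti _ Tj]]] := extension_decomposition PA P_cvg ji QA Qj Q_range.
have [Ta [Tai TaE]] := linear_comp Ti ai.
have [y _ yE] : range Ta (x, 0) by rewrite (X_rigid Hh Tai); exists x.
by exists y; apply: (isometry_inj Ti); rewrite -TaE yE Tj.
Qed.

(* The ultrapower of Z is X + Hilbert, so the ultrapower of that ultrapower
   contains X both diagonally and through the ultrapower of the inclusion of Z.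
   By rigidity the two copies agree, which forces X to lie inside Z. *)
Lemma elementary_extension Z : elementarily_equivalent X Z ->
  exists j : {linear X -> Z}, hilbert_extension P j.
Proof.
move=> [I [J [U [V [FU [FV [S [Si So]]]]]]]].
have [S' [S'i _ _]] := isometry_inverse Si So.
have [id_X [idE id_ext]] := hilbert_extension_id.
have [dX [dXi dXE]] := ultra_diagonal FU X.
have [d d_E d_ext] := extension_ultrapower P_fin dXi dXE id_ext.
have [dZ [dZi dZE]] := ultra_diagonal FV Z.
have [i [ii iE]] := linear_comp S'i dZi.
have [dW [dWi dWE]] := ultra_diagonal FV (ultrapower FU X).
have [dd ddE dd_ext] := extension_ultrapower P_fin dWi dWE d_ext.
have [|iV iVE] := @ultra_map R k J V FV _ _ i; first by move=> z; rewrite (rnorm_isometry ii).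
have iVi := ultra_map_isometry ii iVE.
have di : linear_isometry d by case: d_ext.
have [Sd [Sdi SdE]] := linear_comp Si di.
have [a [ai aE]] := linear_comp iVi Sdi.
apply: (hilbert_extension_restrict ii d_ext) => x.
have [y yE] := rigid_extension_range dd_ext ai x.
(* The constant family [d x] and the family of the [i (f t)] have the same class, so some [i (f t)]
   is as close to [d x] as desired; the range of [i] is closed. *)
have [f fE] := ultra_class_surj (Sd y).
have ir := rnorm_isometry ii; apply: isometry_closed_range ii _ => e e0.
have [M fM] := linf_bounded f.
have [|g gE] := @linf_ex R k J (ultrapower FU X) (fun t => i (linf_fun f t)) M.
  by move=> t; rewrite ir.
have [h hE] := @linf_ex R k J (ultrapower FU X) (fun=> d x) (rnorm (d x)) (fun=> lexx _).
have hg : ultra_class FV h = ultra_class FV g.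
  by rewrite -(dWE _ _ hE) -ddE -yE aE -fE; apply: iVE.
have := (ultra_class_dist FV h g).2 hg e e0.
have PV : ProperFilter V := @ultra_proper _ _ FV.
move=> /filter_ex[t]; rewrite hE gE => ht; by exists (linf_fun f t).
Qed.

End Uniqueness.
End IsometryInverse.

Section NonSeparability.
Variables (R : realType) (k : scalar_kind).
Local Notation K := (scalars R k).

Lemma cantor_countable : ~ countable [set: nat -> bool].
Proof.
move=> /card_le_fun[f [_ f_inj]].
pose F (s : nat -> bool) := f (SigSub (mem_set (I : [set: nat -> bool] s))).
have F_inj s t : F s = F t -> s = t by move=> /f_inj/(congr1 val).
pose s n := `[< forall t, F t = n -> ~~ t n >].
have := erefl (s (F s)); rewrite {1}/s; case: asboolP => [sP E|sP E].
  by have := sP s erefl; rewrite -E.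
apply: sP => t /F_inj ->; by rewrite -E.
Qed.

(* Along a nonprincipal ultrafilter on nat, the branches of the binary tree of
   finite 0-1 sequences index continuum many separated elements. *)
Lemma ultrapower_nonseparable (X : completeNormedModType K) (u : nat -> X)
    (U : set_system nat) (FU : UltraFilter U) (D : set (ultrapower FU X)) :
  (forall A, (\forall n \near \oo, A n) -> U A) ->
  (forall n, rnorm (u n) <= 1) -> (forall m n, m <> n -> 1 <= rnorm (u m - u n)) ->
  dense D -> ~ countable D.
Proof.
move=> ooU u1 u_sep /dense_rnormP dD Dc.
have PU : ProperFilter U := @ultra_proper _ _ FU.
pose code (s : nat -> bool) m := pickle (mkseq s m).
have /choice[y yP] s : exists f : linf nat X, forall m, linf_fun f m = u (code s m).
  by apply: (@linf_ex R k nat X _ 1) => m; exact: u1.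
have sep s t : s <> t -> 1 <= rnorm (ultra_class FU (y s) - ultra_class FU (y t)).
  move=> st; have [n stn] : exists n, s n <> t n.
    apply: contrapT => /forallNP st'; apply: st; apply/funext => n.
    exact: contrapT (st' n).
  rewrite -ultra_classB.
  have c := @ultra_norm_cvg R k nat U FU X (y s - y t).
  rewrite -(cvg_lim _ c) //; apply: limr_ge; first by apply/cvg_ex; eexists; exact: c.
  apply: ooU; exists n.+1 => // m nm; rewrite linf_funBE !yP; apply: u_sep.
  move=> /(pcan_inj pickleK) /(congr1 (fun l => nth false l n)).
  by rewrite !nth_mkseq.
have h0 : 0 < 2^-1 :> R by rewrite invr_gt0.
have /choice[f fP] s : exists z, D z /\ rnorm (ultra_class FU (y s) - z) < 2^-1.
  by have [z Dz zy] := dD (ultra_class FU (y s)) _ h0; exists z.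
apply: cantor_countable; apply: card_le_trans Dc.
apply: (@card_le_inj _ _ _ _ f) => [s _|s t _ _ fst]; first by case: (fP s).
apply: contrapT => /sep; apply/negP; rewrite -ltNge.
apply: le_lt_trans (rnormB_trans _ (f s) _) _; rewrite [ltRHS]splitr div1r.
by rewrite ltrD //; [case: (fP s)|rewrite fst rnormBC; case: (fP t)].
Qed.

Lemma fin_span_dense (X : completeNormedModType K) (P : nat -> X -> X) :
  (forall x (e : R), 0 < e -> exists N, rnorm (x - P N x) < e) ->
  (forall N, fin_span (range (P N))) -> exists g : nat -> X, dense_span g.
Proof.
move=> P_cvg /choice[n /choice[b bP]].
exists (fun m => if unpickle m is Some Ni then b Ni.1 Ni.2 else 0) => x d /(P_cvg x)[N xN].
have [c cE] := bP N _ (imageT (P N) x).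
exists [seq (c i, pickle (N, i)) | i <- index_iota 0 (n N)].
rewrite /combination big_map; under eq_bigr do rewrite pickleK /=.
by rewrite -cE.
Qed.

(** The cardinal is that of an orthonormal basis of the Hilbert part of an ultrapower of [X] along a
    free ultrafilter on [nat]. This part is nonseparable because [X] has a finite dimensional
    approximation and a bounded separated sequence. *)
Lemma uncountably_categorical_rigid (X : completeNormedModType K) (P : nat -> X -> X)
    (u : nat -> X) :
  asymptotically_hilbert P ->
  (forall x (e : R), 0 < e -> exists N, rnorm (x - P N x) < e) ->
  (forall N, fin_span (range (P N))) ->
  (forall H : completeNormedModType K, is_hilbert H ->
    forall T : {linear X -> sum2 X H}, linear_isometry T ->
      range T = range (@sum2_inl R k X H)) ->
  ~ finite_dimensional X ->
  (forall n, rnorm (u n) <= 1) -> (forall m n, m <> n -> 1 <= rnorm (u m - u n)) ->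
  uncountably_categorical X.
Proof.
move=> PA P_cvg P_fin X_rigid X_inf u1 u_sep; split => //.
have [g gD] := fin_span_dense P_cvg P_fin.
have [U [FU ooU]] := ultraFilterLemma (@eventually_filter).
have [id_X [idE id_ext]] := hilbert_extension_id PA.
have [dX [dXi dXE]] := ultra_diagonal FU X.
have [d d_E [di [Q [QA Qd Q_range]]]] := extension_ultrapower P_fin dXi dXE id_ext.
have [H [T [/hilbert_parallelogram Hpar Ti To _]]] :=
  extension_decomposition PA P_cvg di QA Qd Q_range.
have [B [Bo BD]] := orthonormal_basis Hpar.
have Bn : ~ countable [set: set_type B].
  move=> Bc; have [D [dD DB]] := small_dense_set Ti To gD BD.
  apply: (ultrapower_nonseparable ooU u1 u_sep dD).
  exact: card_le_trans DB (countable_seq_card Bc).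
exists (set_type B); split => //; exists (ultrapower FU X); split.
- exact: elementarily_equivalent_ultrapower.
- exact: density_character_basis Hpar Ti To gD Bo BD Bn.
move=> Z /(elementary_extension PA P_cvg P_fin X_rigid)[j [ji [QZ [QZA QZj QZ_range]]]].
have [H' [T' [/hilbert_parallelogram Hpar' Ti' To' _]]] :=
  extension_decomposition PA P_cvg ji QZA QZj QZ_range.
have [B' [Bo' BD']] := orthonormal_basis Hpar'.
move=> [[D [dD DB]] Dmin].
have B'B : ([set: set_type B'] #<= [set: set_type B])%card.
  apply: card_le_trans (orthonormal_card_le Hpar' Ti' To' Bo' dD) _.
  by case/card_eqPle: DB.
(* By minimality of the density character [B] embeds in finite lists over [B']. This makes [B']
   uncountable, and then such lists are no more numerous than [B']. *)
have [D' [dD' D'B']] := small_dense_set Ti' To' gD BD'.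
have BD'' := card_le_trans (Dmin D' dD') D'B'.
have B'n : ~ countable [set: set_type B'].
  by move=> B'c; apply: Bn; exact: card_le_trans BD'' (countable_seq_card B'c).
have BB' := card_le_trans BD'' (infinite_seq_card B'n).
have /card_bijP[f [f' fK f'K]] : (B #= B')%card.
  apply: card_eq_trans (card_setT_sym B) (card_eq_trans _ (card_setT B')).
  exact/card_eqPle.
have HH' : linearly_isometric H H'.
  apply: (hilbert_isometric (f := fun b => val (f b)) Hpar Hpar' Bo _ BD).
    have [B'1 B'o] := Bo'; split => [b|b c bc]; first exact: B'1.
    by apply: B'o => fbc; apply: bc; exact: (can_inj fK).
  move=> x e /(BD' x)[l xl]; exists [seq (p.1, f' p.2) | p <- l].
  rewrite /combination big_map; under eq_bigr do rewrite f'K.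
  exact: xl.
have YH : linearly_isometric (ultrapower FU X) (sum2 X H) by exists T.
have ZH' : linearly_isometric Z (sum2 X H') by exists T'.
apply: linearly_isometric_trans YH _.
apply: linearly_isometric_trans (linearly_isometric_sum2 X HH') _.
exact: linearly_isometric_sym.
Qed.

End NonSeparability.

Section TruncatedSums.
Variables (R : realType) (k : scalar_kind).
Local Notation K := (scalars R k).
Variables V W : nat -> completeNormedModType K.
Local Notation X := (sum2 (l2sum V) (l2sum W)).

Definition sum2_trunc N (z : X) : X := (l2_trunc N z.1, l2_trunc N z.2).

Lemma sum2_trunc_cvg x (e : R) : 0 < e -> exists N, rnorm (x - sum2_trunc N x) < e.
Proof.
move=> e0; have e2 : 0 < e / 2 by rewrite divr_gt0.
have [N NP] := l2_trunc_cvg x.1 e2; have [M MP] := l2_trunc_cvg x.2 e2.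
exists (maxn N M); have := NP _ (leq_maxl N M); have := MP _ (leq_maxr N M).
move=> x2 x1; apply: (@le_lt_trans _ _ (rnorm (x.1 - l2_trunc (maxn N M) x.1) +
    rnorm (x.2 - l2_trunc (maxn N M) x.2))); last by rewrite [ltRHS]splitr ltrD.
rewrite -ler_sqr ?nnegrE ?rnorm_ge0 ?addr_ge0 ?rnorm_ge0 // sqr_rnorm_sum2 /= sqrrD.
by rewrite lerD2r lerDl mulrn_wge0 // mulr_ge0 ?rnorm_ge0.
Qed.

Lemma sum2_trunc_span N : (forall n, fin_span [set: V n]) ->
  (forall n, fin_span [set: W n]) -> fin_span (range (sum2_trunc N)).
Proof.
move=> Vs Ws.
have [|i1 i1E] := @linear_pack R k (l2sum V) X (fun x => (x, 0)).
  by move=> a x y; congr pair; rewrite /= scaler0 addr0.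
have [|i2 i2E] := @linear_pack R k (l2sum W) X (fun y => (0, y)).
  by move=> a x y; congr pair; rewrite /= scaler0 addr0.
apply: fin_span_sub (fin_span_add (fin_span_image i1 (l2_trunc_span N Vs))
  (fin_span_image i2 (l2_trunc_span N Ws))).
move=> _ [z _ <-]; exists (l2_trunc N z.1, 0), (0, l2_trunc N z.2); split.
- by exists (l2_trunc N z.1) => //; exists z.1.
- by exists (l2_trunc N z.2) => //; exists z.2.
by congr pair; rewrite /= ?addr0 ?add0r.
Qed.

Lemma sum2_separated_sequence : (forall n, exists x : V n, x != 0) ->
  ~ finite_dimensional X /\ exists u : nat -> X,
    (forall n, rnorm (u n) <= 1) /\ forall m n, m <> n -> 1 <= rnorm (u m - u n).
Proof.
move=> V0.
have v_ex n : exists v : V n, rnorm v = 1.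
  have [x x0] := V0 n; have x1 : rnorm x != 0 by apply: contra x0 => /eqP/rnorm_eq0->.
  exists (real_scalar k (rnorm x)^-1 *: x).
  by rewrite rnormZr ger0_norm ?invr_ge0 ?rnorm_ge0 // mulVf.
pose v n := sval (cid (v_ex n)); have v1 n : rnorm (v n) = 1 by rewrite /v; case: cid.
pose u n : X := (l2_in (v n), 0).
have l2_le (x : l2sum V) n : rnorm (l2fun x n) <= rnorm x := l2_coord x n.
have fst_le (z : X) : rnorm z.1 <= rnorm z.
  by rewrite -ler_sqr ?nnegrE ?rnorm_ge0 // sqr_rnorm_sum2 lerDl sqr_ge0.
split.
  move=> [n [b bP]].
  have [a [i [ilt ai a0]]] := spanned_dependent (fun i => bP (u i)).
  have coord m : l2fun (\sum_(0 <= j < m) a j *: u j).1 i =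
      if (i < m)%N then a i *: v i else 0.
    elim: m => [|m IH].
      by rewrite big_nil; exact: l2fun0.
    rewrite big_nat_recr //.
    rewrite -[LHS]/(l2fun ((\sum_(0 <= j < m) a j *: u j).1 + a m *: l2_in (v m)) i).
    rewrite l2funDE IH l2funZE ltnS.
    have [->|im] := eqVneq i m; first by rewrite ltnn leqnn l2_in_same add0r.
    by rewrite l2_in_other 1?eq_sym // scaler0 addr0 ltn_neqAle im.
  have := coord n.+1; rewrite a0 ilt => /esym; rewrite [RHS]l2fun0 => avi.
  have : rnorm (a i *: v i) = 0 by rewrite avi rnorm0.
  by rewrite rnormZ v1 mulr1 => /rnorm_eq0 /eqP; apply/negP.
exists u; split=> [n|m n /eqP mn].
  rewrite -(v1 n) -(rnorm_l2_in (v n)) -ler_sqr ?nnegrE ?rnorm_ge0 //.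
  by rewrite sqr_rnorm_sum2 /= rnorm0 expr0n addr0.
apply: le_trans (fst_le _); apply: le_trans (l2_le _ m).
rewrite -[X in rnorm X]/(l2fun (l2_in (v m) - l2_in (v n)) m) l2funBE.
by rewrite l2_in_same l2_in_other 1?eq_sym // subr0 v1.
Qed.

End TruncatedSums.

Theorem corollary5p8 (R : realType) (k : scalar_kind)
  (E F : nat -> finDimBanachType (scalars R k)) (p q : nat -> R)
  (E_nonzero : forall n, exists x : E n, x != 0)
  (F_nonzero : forall n, exists x : F n, x != 0)
  (p_range : forall n, 1 <= p n < 2)
  (p_cvg : p @ \oo --> (2 : R))
  (q_range : forall n, 2 < q n)
  (q_cvg : q @ \oo --> (2 : R))
  (E_ineq : forall n (x y : E n),
    rnorm (x + y) ^+ 2 + rnorm (x - y) ^+ 2 <=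
      2 * (rnorm x `^ p n + rnorm y `^ p n) `^ (2 / p n))
  (E_basis : forall n, exists B : seq (E n), basis_of fullv B /\
    forall y, y \in B -> exists2 x, x \in B &
      forall l : R,
        rnorm (x + real_scalar k l *: y) `^ p n = 1 + `|l| `^ p n)
  (F_ineq : forall n (x y : F n),
    rnorm (x + y) ^+ 2 + rnorm (x - y) ^+ 2 >=
      2 * (rnorm x `^ q n + rnorm y `^ q n) `^ (2 / q n))
  (F_basis : forall n, exists B : seq (F n), basis_of fullv B /\
    forall y, y \in B -> exists2 x, x \in B &
      forall l : R,
        rnorm (x + real_scalar k l *: y) `^ q n = 1 + `|l| `^ q n)
  (F_bound : exists C : R, forall n (x y : F n),
    rnorm (x + y) ^+ 2 + rnorm (x - y) ^+ 2 <=
      2 * (rnorm x ^+ 2 + rnorm (real_scalar k C *: y) ^+ 2)) :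
  let l2E : completeNormedModType (scalars R k) := l2sum (fun n => E n) in
  let l2F : completeNormedModType (scalars R k) := l2sum (fun n => F n) in
  let X : completeNormedModType (scalars R k) := sum2 l2E l2F in
  [/\ forall H : completeNormedModType (scalars R k), is_hilbert H ->
        forall T : {linear X -> sum2 X H}, linear_isometry T ->
          T @` range (@sum2_inl R k l2E l2F) =
            range (fun x : l2E => sum2_inl H (sum2_inl l2F x)) /\
          T @` range (@sum2_inr R k l2E l2F) =
            range (fun y : l2F => sum2_inl H (sum2_inr l2E y)),
      forall (I : Type) (U : set_system I) (FU : UltraFilter U),
        exists H : completeNormedModType (scalars R k),
          is_hilbert H /\ linearly_isometric (ultrapower FU X) (sum2 X H),
      forall H : completeNormedModType (scalars R k), is_hilbert H ->
        forall T : {linear X -> sum2 X H}, linear_isometry T ->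
          range T = range (@sum2_inl R k X H)
    & uncountably_categorical X].
Proof.
move=> l2E l2F X.
have rigid (H : completeNormedModType (scalars R k)) (Hh : is_hilbert H)
    (T : {linear X -> sum2 X H}) (Ti : linear_isometry T) :=
  sum_rigid p_range p_cvg q_range q_cvg E_ineq E_basis F_ineq F_basis F_bound
    (hilbert_parallelogram Hh) Ti.
have onto (H : completeNormedModType (scalars R k)) : is_hilbert H ->
    forall T : {linear X -> sum2 X H}, linear_isometry T ->
    range T = range (@sum2_inl R k X H).
  move=> Hh T Ti; have [Ein Eonto Fin Fonto] := rigid H Hh T Ti.
  have TD (x : l2E) (y : l2F) : T (x, y) = T (x, 0) + T (0, y).
    by rewrite -linearD; congr (T _); congr pair; rewrite /= ?addr0 ?add0r.
  have pair_add (x : l2E) (y : l2F) :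
      (((x, y) : X, 0 : H) : sum2 X H) = ((x, 0), 0) + ((0, y), 0).
    by congr (pair (pair _ _) _); rewrite /= ?addr0 ?add0r.
  apply/seteqP; split.
    move=> _ [[x y] _ <-]; have [x' x'E] := Ein x; have [y' y'E] := Fin y.
    by exists (x', y') => //; rewrite TD x'E y'E -pair_add.
  move=> _ [[x y] _ <-]; have [x' x'E] := Eonto x; have [y' y'E] := Fonto y.
  by exists (x', y') => //; rewrite TD x'E y'E -pair_add.
pose P : nat -> X -> X := @sum2_trunc R k E F.
have PA : asymptotically_hilbert P.
  apply: (@sum2_asymptotically_hilbert R k l2E l2F).
    apply: l2_asymptotically_hilbert; exact: upper_asymptotic p_range p_cvg E_ineq.
  apply: l2_asymptotically_hilbert; exact: lower_asymptotic q_range q_cvg F_ineq.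
have P_cvg : forall x (e : R), 0 < e -> exists N, rnorm (x - P N x) < e.
  exact: sum2_trunc_cvg.
have P_fin N : fin_span (range (P N)).
  by apply: sum2_trunc_span => n; exact: fin_span_finDim.
split=> //.
- move=> H Hh T Ti; have [Ein Eonto Fin Fonto] := rigid H Hh T Ti; split.
    apply/seteqP; split.
      move=> _ [_ [x _ <-] <-]; have [y yE] := Ein x.
      by exists y => //; rewrite [RHS]yE.
    move=> _ [y _ <-]; have [x xE] := Eonto y.
    by exists (x, 0); [exists x|rewrite xE].
  apply/seteqP; split.
    move=> _ [_ [x _ <-] <-]; have [y yE] := Fin x.
    by exists y => //; rewrite [RHS]yE.
  move=> _ [y _ <-]; have [x xE] := Fonto y.
  by exists (0, x); [exists x|rewrite xE].
- move=> I U FU.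
  have [j [_ j_ext]] := hilbert_extension_id PA.
  have [dX [dXi dXE]] := ultra_diagonal FU X.
  have [d _ [di [Q [QA Qd Q_range]]]] := extension_ultrapower P_fin dXi dXE j_ext.
  have [H [T [Hh Ti To _]]] := extension_decomposition PA P_cvg di QA Qd Q_range.
  by exists H; split => //; exists T.
have [X_inf [u [u1 u_sep]]] := @sum2_separated_sequence R k E F E_nonzero.
exact: uncountably_categorical_rigid PA P_cvg P_fin onto X_inf u1 u_sep.
Qed.
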